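(* Let $k$ be a commutative ring or a field, and let $\mathcal C$ be a cooperad with comultiplication in $k$-modules. Let $H_\bullet(\mathcal C)=H(\mathcal C_\bullet,d)$ be its homology, where $\mathcal C(n)$ is in degree $n$ and $d$ is the differential induced by the comultiplication. Then the cup coproduct $$\cup^c x:=\sum_{j=1}^{n+1}(\mu^c\otimes\mathrm{id}^{\otimes2})\circ(\Delta_{2,j-1,1}\otimes\mathrm{id})\circ\Delta_{j,n+1-j,j}(x),\qquad x\in\mathcal C(n),$$ is graded cocommutative on homology, i.e. $\tau\circ\cup^c=\cup^c$ on homology with $\tau(a\otimes b)=(-1)^{|a||b|}b\otimes a$. Hence the groups $H_\bullet(\mathcal C)$ form a graded cocommutative counital coalgebra (with counit induced by the map that is $e^c$ on $\mathcal C(0)$ and zero on $\mathcal C(n)$ for $n>0$).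
   Context: Throughout, $k$ is a commutative ring or a field (of characteristic zero if need be). Tensor products are over $k$, and $k\otimes M\cong M\cong M\otimes k$ is used implicitly. A planar counital cooperad is a sequence $\mathcal C=\{\mathcal C(n)\}_{n\ge0}$ of $k$-modules with $k$-linear maps $\epsilon\colon\mathcal C(1)\to k$ and $\Delta_{p,q,i}\colon\mathcal C(p+q-1)\to\mathcal C(p)\otimes\mathcal C(q)$ for $p\ge1$, $q\ge0$, $1\le i\le p$ (and $\Delta_{0,q,i}:=0$), such that $(\epsilon\otimes\mathrm{id})\circ\Delta_{1,n,1}=\mathrm{id}_{\mathcal C(n)}$, $(\mathrm{id}\otimes\epsilon)\circ\Delta_{n,1,i}=\mathrm{id}_{\mathcal C(n)}$ for $1\le i\le n$, and for all $p\ge 1$, $q,r\ge0$, $1\le i\le p$, $1\le j\le p+q-1$: $$(\Delta_{p,q,i}\otimes\mathrm{id})\circ\Delta_{p+q-1,r,j}=\begin{cases}(\mathrm{id}\otimes\sigma)\circ(\Delta_{p,r,j-q+1}\otimes\mathrm{id})\circ\Delta_{p+r-1,q,i}& i\le j-q,\\(\mathrm{id}\otimes\Delta_{q,r,j-i+1})\circ\Delta_{p,q+r-1,i}& j-q<i\le j,\\(\mathrm{id}\otimes\sigma)\circ(\Delta_{p,r,j}\otimes\mathrm{id})\circ\Delta_{p+r-1,q,i+r-1}& j<i\le p,\end{cases}$$ where $\sigma(a\otimes b)=b\otimes a$. A cooperad with comultiplication is a planar counital cooperad $\mathcal C$ with a morphism of counital cooperads to the linear dual of the unital associative operad; equivalently,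 with $k$-linear maps $\mu^c\colon\mathcal C(2)\to k$ and $e^c\colon\mathcal C(0)\to k$ such that $(\mu^c\otimes\mu^c)\circ\Delta_{2,2,1}=(\mu^c\otimes\mu^c)\circ\Delta_{2,2,2}$ and $(\mu^c\otimes e^c)\circ\Delta_{2,0,1}=(\mu^c\otimes e^c)\circ\Delta_{2,0,2}=\epsilon$. Differential: on $\mathcal C(n)$, $n\geq 1$, $d=(\mu^c\otimes\mathrm{id})\circ\big(\Delta_{2,n-1,2}+(-1)^n\Delta_{2,n-1,1}\big)+\sum_{i=1}^{n-1}(-1)^i(\mathrm{id}\otimes\mu^c)\circ\Delta_{n-1,2,i}\colon\mathcal C(n)\to\mathcal C(n-1)$ and $d=0$ on $\mathcal C(0)$. It satisfies $d^2=0$ and is a graded coderivation of the coassociative coproduct $\cup^c$.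
   Formalization: Over a general commutative ring the cup coproduct on homology only lands in H(C⊗C), where its laws are proved; a coproduct H→H⊗H is claimed only if k is a field or the Künneth maps H⊗H→H(C⊗C) are bijective and H⊗H⊗H→H(C⊗C⊗C) injective. *)

(* Defs.v *)
From HB Require Import structures.
From mathcomp Require Import all_boot ssralg.
From mathcomp.classical Require Import boolp.

Set Implicit Arguments.
Unset Strict Implicit.
Unset Printing Implicit Defensive.

Import GRing.Theory.
Local Open Scope ring_scope.
Local Open Scope quotient_scope.

(* An element is a class of formal sums [:: (u1, v1); ..; (um, vm)], read   *)
(* as u1 (x) v1 + .. + um (x) vm; two formal sums are identified when no    *)
(* bilinear map separates them.  The universal property is [tlift_tens],    *)
(* [tlift_linear] and [tlift_uniq].                                         *)

Section Tensor.
Variables (k : comPzRingType) (U V : lmodType k).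

Definition bilinear_map (W : lmodType k) (f : U -> V -> W) : Prop :=
  (forall v, linear (f^~ v)) /\ (forall u, linear (f u)).

Definition formal_eval (W : lmodType k) (f : U -> V -> W) (s : seq (U * V)) :=
  \sum_(x <- s) f x.1 x.2.

Definition formal_eq (s t : seq (U * V)) : bool :=
  `[< forall (W : lmodType k) (f : U -> V -> W),
        bilinear_map f -> formal_eval f s = formal_eval f t >].

Lemma formal_eq_refl : reflexive formal_eq.
Proof. by move=> s; apply/asboolP. Qed.

Lemma formal_eq_sym : symmetric formal_eq.
Proof.
by move=> s t; apply/asboolP/asboolP => st W f fP; rewrite (st W f fP).
Qed.

Lemma formal_eq_trans : transitive formal_eq.
Proof.
move=> s t r /asboolP ts /asboolP sr; apply/asboolP => W f fP.
by rewrite (ts W f fP) (sr W f fP).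
Qed.

Canonical formal_equiv :=
  EquivRel formal_eq formal_eq_refl formal_eq_sym formal_eq_trans.

Definition tensor : Type := {eq_quot formal_eq}.
HB.instance Definition _ := Choice.on tensor.
HB.instance Definition _ := EqQuotient.on tensor.

Definition tlift (W : lmodType k) (f : U -> V -> W) (x : tensor) : W :=
  formal_eval f (repr x).

Definition tens (u : U) (v : V) : tensor := \pi_tensor [:: (u, v)].

Lemma tlift_pi (W : lmodType k) (f : U -> V -> W) s :
  bilinear_map f -> tlift f (\pi_tensor s) = formal_eval f s.
Proof.
move=> fP; have /eqmodP/asboolP := reprK (\pi_tensor s : tensor).
by move/(_ W f fP).
Qed.

Lemma tlift_inj (x y : tensor) :
    (forall (W : lmodType k) (f : U -> V -> W),
       bilinear_map f -> tlift f x = tlift f y) ->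
  x = y.
Proof.
by move=> xy; rewrite -[x]reprK -[y]reprK; apply/eqmodP/asboolP.
Qed.

Definition tensor_zero : tensor := \pi_tensor [::].
Definition tensor_add (x y : tensor) : tensor :=
  \pi_tensor (repr x ++ repr y).
Definition tensor_scale (a : k) (x : tensor) : tensor :=
  \pi_tensor [seq (a *: p.1, p.2) | p <- repr x].
Definition tensor_opp (x : tensor) : tensor := tensor_scale (- 1) x.

Section Lift.
Variables (W : lmodType k) (f : U -> V -> W) (fP : bilinear_map f).

Let tlift0 : tlift f tensor_zero = 0.
Proof. by rewrite tlift_pi // /formal_eval big_nil. Qed.

Let tliftD x y : tlift f (tensor_add x y) = tlift f x + tlift f y.
Proof. by rewrite tlift_pi // /formal_eval big_cat. Qed.

Let tliftZ a x : tlift f (tensor_scale a x) = a *: tlift f x.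
Proof.
rewrite tlift_pi // /formal_eval big_map scaler_sumr; apply: eq_bigr => p _ /=.
have /(_ a p.1 0) := fP.1 p.2; have /(_ (- 1) p.1 p.1) := fP.1 p.2.
by rewrite !scaleN1r !addNr addr0 => -> ->; rewrite addr0.
Qed.

Definition tliftE := (tlift0, tliftD, tliftZ).
End Lift.

Lemma tensor_addA : associative tensor_add.
Proof. by move=> x y z; apply: tlift_inj => W f fP; rewrite !tliftE // addrA. Qed.

Lemma tensor_addC : commutative tensor_add.
Proof. by move=> x y; apply: tlift_inj => W f fP; rewrite !tliftE // addrC. Qed.

Lemma tensor_add0 : left_id tensor_zero tensor_add.
Proof. by move=> x; apply: tlift_inj => W f fP; rewrite !tliftE // add0r. Qed.

Lemma tensor_addN : left_inverse tensor_zero tensor_opp tensor_add.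
Proof.
by move=> x; apply: tlift_inj => W f fP; rewrite !tliftE // scaleN1r addNr.
Qed.

HB.instance Definition _ :=
  GRing.isZmodule.Build tensor tensor_addA tensor_addC tensor_add0 tensor_addN.

Lemma tensor_scaleA a b x :
  tensor_scale a (tensor_scale b x) = tensor_scale (a * b) x.
Proof. by apply: tlift_inj => W f fP; rewrite !tliftE // scalerA. Qed.

Lemma tensor_scale1 : left_id 1 tensor_scale.
Proof. by move=> x; apply: tlift_inj => W f fP; rewrite !tliftE // scale1r. Qed.

Lemma tensor_scaleDr : right_distributive tensor_scale tensor_add.
Proof.
by move=> a x y; apply: tlift_inj => W f fP; rewrite !tliftE // scalerDr.
Qed.

Lemma tensor_scaleDl x : {morph tensor_scale^~ x : a b / a + b >-> a + b}.
Proof.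
move=> a b; apply: tlift_inj => W f fP.
by rewrite [in RHS]/GRing.add /= !tliftE // scalerDl.
Qed.

HB.instance Definition _ := GRing.Zmodule_isLmodule.Build k tensor
  tensor_scaleA tensor_scale1 tensor_scaleDr tensor_scaleDl.

Lemma tlift_tens (W : lmodType k) (f : U -> V -> W) u v :
  bilinear_map f -> tlift f (tens u v) = f u v.
Proof. by move=> fP; rewrite tlift_pi // /formal_eval big_seq1. Qed.

Lemma tlift_linear (W : lmodType k) (f : U -> V -> W) :
  bilinear_map f -> linear (tlift f).
Proof. by move=> fP a x y; rewrite [LHS]tliftE // tliftE. Qed.

Lemma tens_bilinear : bilinear_map tens.
Proof.
split=> [v a u u'|u a v v']; apply: tlift_inj => W f fP;
  rewrite (tlift_linear fP) !tlift_tens //; [exact: fP.1 | exact: fP.2].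
Qed.

Lemma tensorE (x : tensor) : x = \sum_(p <- repr x) tens p.1 p.2.
Proof.
apply: tlift_inj => W f fP; rewrite {1}/tlift /formal_eval.
elim: (repr x) => [|p s IHs]; first by rewrite !big_nil [RHS](tliftE fP).
by rewrite !big_cons [RHS](tliftE fP) tlift_tens // IHs.
Qed.

Lemma tlift_uniq (W : lmodType k) (g h : {linear tensor -> W}) :
  (forall u v, g (tens u v) = h (tens u v)) -> g =1 h.
Proof.
by move=> gh x; rewrite (tensorE x) !linear_sum; apply: eq_bigr.
Qed.

End Tensor.

Notation "U ⊗ V" := (tensor U V) (at level 40, left associativity) : type_scope.

Section TensorMaps.
Variable k : comPzRingType.

Definition tmap (U U' V V' : lmodType k) (f : {linear U -> U'})
    (g : {linear V -> V'}) : U ⊗ V -> U' ⊗ V' :=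
  tlift (fun u v => tens (f u) (g v)).

(* f (x) id, followed by k (x) V = V, for f : U -> k *)
Definition evall (U V : lmodType k) (f : {linear U -> k^o}) : U ⊗ V -> V :=
  tlift (fun u v => (f u : k) *: v).

(* id (x) g, followed by U (x) k = U, for g : V -> k *)
Definition evalr (U V : lmodType k) (g : {linear V -> k^o}) : U ⊗ V -> U :=
  tlift (fun u v => (g v : k) *: u).

(* f (x) g, followed by k (x) k = k, for f : U -> k and g : V -> k *)
Definition evalb (U V : lmodType k) (f : {linear U -> k^o})
    (g : {linear V -> k^o}) : U ⊗ V -> k^o :=
  tlift (fun u v => (f u : k) *: g v).

Definition tswap (U V : lmodType k) : U ⊗ V -> V ⊗ U :=
  tlift (fun u v => tens v u).

(* u (x) (v (x) w) |-> (u (x) v) (x) w; threefold tensor products are       *)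
(* bracketed to the left throughout.                                        *)
Definition tassoc (U V W : lmodType k) : U ⊗ (V ⊗ W) -> U ⊗ V ⊗ W :=
  tlift (fun u => tlift (fun v w => tens (tens u v) w)).

(* (id (x) sigma) on left-bracketed tensors: u (x) v (x) w |-> u (x) w (x) v *)
Definition tswapr (U V W : lmodType k) : U ⊗ V ⊗ W -> U ⊗ W ⊗ V :=
  tlift (fun x w => tlift (fun u v => tens (tens u w) v) x).

Lemma tmap_bilinear (U U' V V' : lmodType k) (f : {linear U -> U'})
    (g : {linear V -> V'}) : bilinear_map (fun u v => tens (f u) (g v)).
Proof.
by split=> [v a x y|u a x y]; rewrite linearP;
  [apply: (tens_bilinear _ _).1 | apply: (tens_bilinear _ _).2].
Qed.

Lemma evall_bilinear (U V : lmodType k) (f : {linear U -> k^o}) :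
  bilinear_map (fun (u : U) (v : V) => (f u : k) *: v).
Proof.
split=> [v a x y|u a x y]; last by rewrite scalerDr !scalerA mulrC.
by rewrite linearP scalerDl scalerA.
Qed.

Lemma evalr_bilinear (U V : lmodType k) (g : {linear V -> k^o}) :
  bilinear_map (fun (u : U) (v : V) => (g v : k) *: u).
Proof.
split=> [v a x y|u a x y]; first by rewrite scalerDr !scalerA mulrC.
by rewrite linearP scalerDl scalerA.
Qed.

Lemma evalb_bilinear (U V : lmodType k) (f : {linear U -> k^o})
  (g : {linear V -> k^o}) :
  bilinear_map (fun u v => ((f u : k) *: g v : k^o)).
Proof.
split=> [v a x y|u a x y]; first by rewrite linearP scalerDl scalerA.
by rewrite linearP scalerDr !scalerA mulrC.
Qed.

Lemma tswap_bilinear (U V : lmodType k) :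
  bilinear_map (fun (u : U) (v : V) => tens v u).
Proof.
by split=> [v a x y|u a x y];
  [apply: (tens_bilinear _ _).2 | apply: (tens_bilinear _ _).1].
Qed.

HB.instance Definition _ (U U' V V' : lmodType k) (f : {linear U -> U'})
    (g : {linear V -> V'}) :=
  GRing.isLinear.Build k (U ⊗ V) (U' ⊗ V') _ (tmap f g)
    (tlift_linear (tmap_bilinear f g)).

HB.instance Definition _ (U V : lmodType k) (f : {linear U -> k^o}) :=
  GRing.isLinear.Build k (U ⊗ V) V _ (@evall U V f)
    (tlift_linear (@evall_bilinear U V f)).

HB.instance Definition _ (U V : lmodType k) (g : {linear V -> k^o}) :=
  GRing.isLinear.Build k (U ⊗ V) U _ (@evalr U V g)
    (tlift_linear (@evalr_bilinear U V g)).

HB.instance Definition _ (U V : lmodType k) (f : {linear U -> k^o})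
    (g : {linear V -> k^o}) :=
  GRing.isLinear.Build k (U ⊗ V) k^o _ (evalb f g)
    (tlift_linear (evalb_bilinear f g)).

HB.instance Definition _ (U V : lmodType k) :=
  GRing.isLinear.Build k (U ⊗ V) (V ⊗ U) _ (@tswap U V)
    (tlift_linear (@tswap_bilinear U V)).

End TensorMaps.

(* Homogeneous part of an indexed family of modules:                        *)
(*   degree_part deg U n = direct sum of the U i with deg i = n.            *)
(* It is realised by families supported in degree n; every degree map used  *)
(* below has finite fibres, so sums and products over a fibre agree.        *)
(* [truncate] discards the components outside degree n.                     *)

Section DegreePart.
Variables (k : comPzRingType) (I : Type) (deg : I -> nat).
Variables (U : I -> lmodType k) (n : nat).

Record degree_part : Type := DegreePart {
  component :> forall i, U i;
  component_supp : forall i, deg i != n -> component i = 0 }.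

HB.instance Definition _ := gen_eqMixin degree_part.
HB.instance Definition _ := gen_choiceMixin degree_part.

Lemma degree_partP (x y : degree_part) : (forall i, x i = y i) -> x = y.
Proof.
case: x y => [x xP] [y yP] /= xy; have {xy}xy : x = y by apply: functional_extensionality_dep.
by rewrite -xy in yP *; congr DegreePart; apply: Prop_irrelevance.
Qed.

Lemma truncate_subproof (f : forall i, U i) i :
  deg i != n -> (if deg i == n then f i else 0) = 0.
Proof. by move/negPf->. Qed.

Definition truncate (f : forall i, U i) : degree_part :=
  DegreePart (@truncate_subproof f).

Lemma truncateE f i : deg i = n -> truncate f i = f i.
Proof. by move=> /= ->; rewrite eqxx. Qed.

Let add (x y : degree_part) := truncate (fun i => x i + y i).
Let opp (x : degree_part) := truncate (fun i => - x i).
Let zero := truncate (fun=> 0).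
Let scale (a : k) (x : degree_part) := truncate (fun i => a *: x i).

Let addE x y i : add x y i = x i + y i.
Proof. by rewrite /=; case: eqP => // /eqP ni; rewrite !component_supp ?addr0. Qed.
Let oppE x i : opp x i = - x i.
Proof. by rewrite /=; case: eqP => // /eqP ni; rewrite !component_supp ?oppr0. Qed.
Let zeroE i : zero i = 0.
Proof. by rewrite /=; case: eqP. Qed.
Let scaleE a x i : scale a x i = a *: x i.
Proof. by rewrite /=; case: eqP => // /eqP ni; rewrite !component_supp ?scaler0. Qed.

Let addA : associative add.
Proof. by move=> x y z; apply: degree_partP => i; rewrite !addE addrA. Qed.
Let addC : commutative add.
Proof. by move=> x y; apply: degree_partP => i; rewrite !addE addrC. Qed.
Let add0 : left_id zero add.
Proof. by move=> x; apply: degree_partP => i; rewrite addE zeroE add0r. Qed.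
Let addN : left_inverse zero opp add.
Proof. by move=> x; apply: degree_partP => i; rewrite addE oppE zeroE addNr. Qed.

HB.instance Definition _ :=
  GRing.isZmodule.Build degree_part addA addC add0 addN.

Let scaleA a b x : scale a (scale b x) = scale (a * b) x.
Proof. by apply: degree_partP => i; rewrite !scaleE scalerA. Qed.
Let scale1 : left_id 1 scale.
Proof. by move=> x; apply: degree_partP => i; rewrite !scaleE scale1r. Qed.
Let scaleDr : right_distributive scale add.
Proof. by move=> a x y; apply: degree_partP => i; rewrite !(scaleE, addE) scalerDr. Qed.
Let scaleDl x : {morph scale^~ x : a b / a + b >-> a + b}.
Proof. by move=> a b; apply: degree_partP => i; rewrite [RHS]addE !scaleE scalerDl. Qed.

HB.instance Definition _ := GRing.Zmodule_isLmodule.Build k degree_part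
  scaleA scale1 scaleDr scaleDl.

Definition proj i (x : degree_part) : U i := x i.

Lemma proj_linear i : linear (proj i).
Proof. by move=> a x y; rewrite /proj addE scaleE. Qed.
HB.instance Definition _ i :=
  GRing.isLinear.Build k degree_part (U i) _ (proj i) (proj_linear i).

Lemma truncate_linear (W : lmodType k) (f : W -> forall i, U i) :
  (forall i, linear (f^~ i)) -> linear (fun w => truncate (f w)).
Proof.
move=> fP a x y; apply: degree_partP => i; rewrite addE scaleE /=.
by case: eqP => _; rewrite ?fP // scaler0 addr0.
Qed.

End DegreePart.

Arguments truncate {k I deg U n} f.
Arguments proj {k I deg U n} i.

(* d o d = 0 is not required: the homology below is (ker d) / (im d /\ ker d), *)
(* which is the usual ker d / im d as soon as d o d = 0.                    *)
Record precomplex (k : comPzRingType) := Precomplex {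
  chain :> nat -> lmodType k;
  bdry : forall n, {linear chain n.+1 -> chain n} }.

Section Homology.
Variables (k : comPzRingType) (D : precomplex k).

(* d = 0 on degree 0 chains *)
Definition is_cycle n : pred (D n) :=
  match n return pred (D n) with
  | 0 => fun=> true
  | m.+1 => fun x => bdry D m x == 0
  end.

Variable n : nat.

Lemma is_cycle_submod : submod_closed (@is_cycle n).
Proof.
case: n => [|m]; first by split.
split=> [|a x y]; rewrite !unfold_in /= ?linear0 ?eqxx //.
by move=> /eqP x0 /eqP y0; rewrite linearP x0 y0 scaler0 addr0.
Qed.
HB.instance Definition _ :=
  GRing.isSubmodClosed.Build k (D n) (@is_cycle n) is_cycle_submod.

Record cycles : Type := Cycle { chain_of : D n; _ : is_cycle chain_of }.
HB.instance Definition _ := [isSub for chain_of].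
HB.instance Definition _ := [Choice of cycles by <:].
HB.instance Definition _ := [SubChoice_isSubLmodule of cycles by <:].

Definition homologous (x y : cycles) : bool :=
  `[< exists c : D n.+1, chain_of x - chain_of y = bdry D n c >].

Lemma homologous_refl : reflexive homologous.
Proof. by move=> x; apply/asboolP; exists 0; rewrite linear0 subrr. Qed.

Lemma homologous_sym : symmetric homologous.
Proof.
by move=> x y; apply/asboolP/asboolP => -[c cP]; exists (- c);
  rewrite linearN -cP opprB.
Qed.

Lemma homologous_trans : transitive homologous.
Proof.
move=> y x z /asboolP[c cP] /asboolP[c' cP']; apply/asboolP; exists (c + c').
by rewrite linearD -cP -cP' addrA subrK.
Qed.

Canonical homologous_equiv :=
  EquivRel homologous homologous_refl homologous_sym homologous_trans.

Definition homology_type : Type := {eq_quot homologous}.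
HB.instance Definition _ := Choice.on homology_type.
HB.instance Definition _ := EqQuotient.on homology_type.

Definition hclass (z : cycles) : homology_type := \pi_homology_type z.

Lemma hclassP (x y : cycles) :
  hclass x = hclass y <->
  exists c : D n.+1, chain_of x - chain_of y = bdry D n c.
Proof.
split=> [/eqmodP/asboolP //|xy]; by apply/eqmodP/asboolP.
Qed.

Lemma hclassK x : hclass (repr x) = x. Proof. exact: reprK. Qed.

Let add (x y : homology_type) := hclass (repr x + repr y).
Let scale (a : k) (x : homology_type) := hclass (a *: repr x).

Let addE x y : add (hclass x) (hclass y) = hclass (x + y).
Proof.
have /hclassP[c cP] := hclassK (hclass x).
have /hclassP[c' cP'] := hclassK (hclass y).
by apply/hclassP; exists (c + c'); rewrite [bdry D n _]linearD -cP -cP' opprD addrACA.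
Qed.

Let scaleE a x : scale a (hclass x) = hclass (a *: x).
Proof.
have /hclassP[c cP] := hclassK (hclass x).
by apply/hclassP; exists (a *: c); rewrite [bdry D n _]linearZ /= -cP scalerBr.
Qed.

Let addA : associative add.
Proof.
by move=> x y z; rewrite -[x]hclassK -[y]hclassK -[z]hclassK !addE addrA.
Qed.
Let addC : commutative add.
Proof. by move=> x y; rewrite /add addrC. Qed.
Let add0 : left_id (hclass 0) add.
Proof. by move=> x; rewrite -[x]hclassK addE add0r. Qed.
Let addN : left_inverse (hclass 0) (scale (- 1)) add.
Proof. by move=> x; rewrite -[x]hclassK scaleE addE scaleN1r addNr. Qed.

HB.instance Definition _ :=
  GRing.isZmodule.Build homology_type addA addC add0 addN.

Let scaleA a b x : scale a (scale b x) = scale (a * b) x.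
Proof. by rewrite -[x]hclassK !scaleE scalerA. Qed.
Let scale1 : left_id 1 scale.
Proof. by move=> x; rewrite -[x]hclassK scaleE scale1r. Qed.
Let scaleDr : right_distributive scale add.
Proof.
by move=> a x y; rewrite -[x]hclassK -[y]hclassK !(scaleE, addE) scalerDr.
Qed.
Let scaleDl x : {morph scale^~ x : a b / a + b >-> a + b}.
Proof.
by move=> a b; rewrite -[x]hclassK !scaleE [RHS]addE scalerDl.
Qed.

HB.instance Definition _ := GRing.Zmodule_isLmodule.Build k homology_type
  scaleA scale1 scaleDr scaleDl.

Lemma hclass_linear : linear hclass.
Proof. by move=> a x y; rewrite -[RHS]/(add (scale a (hclass x)) (hclass y)) scaleE addE. Qed.
HB.instance Definition _ :=
  GRing.isLinear.Build k cycles homology_type _ hclass hclass_linear.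

Lemma chain_of_linear : linear chain_of.
Proof. exact: (@linearP _ _ _ _ (val : {linear cycles -> D n})). Qed.
HB.instance Definition _ :=
  GRing.isLinear.Build k cycles (D n) _ chain_of chain_of_linear.

End Homology.

Section GradedTensor.
Variable k : comPzRingType.
Implicit Types A B C : nat -> lmodType k.

Definition gtensor A B : nat -> lmodType k :=
  degree_part (fun i : nat * nat => i.1 + i.2)%N (fun i => A i.1 ⊗ B i.2).

Definition gtensor3 A B C : nat -> lmodType k :=
  degree_part (fun i : nat * nat * nat => i.1.1 + i.1.2 + i.2)%N
    (fun i => A i.1.1 ⊗ B i.1.2 ⊗ C i.2).

Definition gmap2 A A' B B' (f : forall n, {linear A n -> A' n})
    (g : forall n, {linear B n -> B' n}) n (x : gtensor A B n) :
    gtensor A' B' n :=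
  truncate (fun i => tmap (f i.1) (g i.2) (x i)).

Definition gmap3 A A' B B' C C' (f : forall n, {linear A n -> A' n})
    (g : forall n, {linear B n -> B' n}) (h : forall n, {linear C n -> C' n})
    n (x : gtensor3 A B C n) : gtensor3 A' B' C' n :=
  truncate (fun i => tmap (tmap (f i.1.1) (g i.1.2)) (h i.2) (x i)).

(* tau (a (x) b) = (-1)^(|a||b|) b (x) a *)
Definition gtwist A B n (x : gtensor A B n) : gtensor B A n :=
  truncate (fun i => (-1) ^+ (i.1 * i.2)%N *: tswap (x (i.2, i.1))).

(* D (x) id, resp. id (x) D: no sign occurs, D being of degree 0 *)
Definition coprod_l A (D : forall n, {linear A n -> gtensor A A n}) n
    (x : gtensor A A n) : gtensor3 A A A n :=
  truncate (fun i =>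
    tmap (proj (i.1.1, i.1.2) \o D (i.1.1 + i.1.2)%N) idfun
      (x ((i.1.1 + i.1.2)%N, i.2))).

Definition coprod_r A (D : forall n, {linear A n -> gtensor A A n}) n
    (x : gtensor A A n) : gtensor3 A A A n :=
  truncate (fun i =>
    tassoc (tmap idfun (proj (i.1.2, i.2) \o D (i.1.2 + i.2)%N)
      (x (i.1.1, (i.1.2 + i.2)%N)))).

(* e (x) id and id (x) e for the map e : A -> k that is the given one on    *)
(* A 0 and zero in positive degrees: only one summand contributes.          *)
Definition counit_l A (e : {linear A 0%N -> k^o}) n (x : gtensor A A n) : A n :=
  evall e (x (0%N, n)).

Definition counit_r A (e : {linear A 0%N -> k^o}) n (x : gtensor A A n) : A n :=
  evalr e (x (n, 0%N)).

Record graded_cocommutative_coalgebra A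
    (D : forall n, {linear A n -> gtensor A A n}) (e : {linear A 0%N -> k^o}) :
    Prop := {
  gcoalg_coassoc : forall n x, coprod_l D (D n x) = coprod_r D (D n x);
  gcoalg_counitl : forall n x, counit_l e (D n x) = x;
  gcoalg_counitr : forall n x, counit_r e (D n x) = x;
  gcoalg_cocomm : forall n x, gtwist (D n x) = D n x }.

End GradedTensor.

(* Koszul sign: d (a (x) b) = da (x) b + (-1)^|a| a (x) db *)
Section TensorComplex.
Variable k : comPzRingType.
Variables A B C : precomplex k.

Definition tensor_bdry n (x : gtensor A B n.+1) : gtensor A B n :=
  truncate (fun i =>
    tmap (bdry A i.1) idfun (x (i.1.+1, i.2))
    + (-1) ^+ i.1 *: tmap idfun (bdry B i.2) (x (i.1, i.2.+1))).

Definition tensor3_bdry n (x : gtensor3 A B C n.+1) : gtensor3 A B C n :=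
  truncate (fun i =>
    tmap (tmap (bdry A i.1.1) idfun) idfun (x (i.1.1.+1, i.1.2, i.2))
    + (-1) ^+ i.1.1 *:
        tmap (tmap idfun (bdry B i.1.2)) idfun (x (i.1.1, i.1.2.+1, i.2))
    + (-1) ^+ (i.1.1 + i.1.2)%N *:
        tmap idfun (bdry C i.2) (x (i.1.1, i.1.2, i.2.+1))).

Lemma tensor_bdry_linear n : linear (@tensor_bdry n).
Proof.
apply: truncate_linear => i a x y.
rewrite -![(_ + _ : gtensor A B n.+1) _]/(proj _ _) !linearP /=.
by rewrite scalerDr !scalerA mulrC addrACA.
Qed.
HB.instance Definition _ n :=
  GRing.isLinear.Build k _ _ _ (@tensor_bdry n) (@tensor_bdry_linear n).

Lemma tensor3_bdry_linear n : linear (@tensor3_bdry n).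
Proof.
apply: truncate_linear => i a x y.
rewrite -![(_ + _ : gtensor3 A B C n.+1) _]/(proj _ _) !linearP /=.
by rewrite !scalerDr !scalerA !(mulrC a) [X in X + _ = _]addrACA [LHS]addrACA.
Qed.
HB.instance Definition _ n :=
  GRing.isLinear.Build k _ _ _ (@tensor3_bdry n) (@tensor3_bdry_linear n).

Definition tensor_complex : precomplex k := Precomplex tensor_bdry.
Definition tensor3_complex : precomplex k := Precomplex tensor3_bdry.

End TensorComplex.

(* [decomp n p q i] is Delta_(p,q,i) : C(n) -> C(p) (x) C(q), n = p + q - 1. *)
(* Carrying n along avoids casts between C(p + q - 1) and equal modules;    *)
(* [decomp_out] makes the meaningless components zero, in particular        *)
(* Delta_(0,q,i) = 0.                                                       *)
Record cooperad (k : comPzRingType) := Cooperad {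
  coop :> nat -> lmodType k;
  counit : {linear coop 1%N -> k^o};
  decomp : forall n p q (i : nat), {linear coop n -> coop p ⊗ coop q};
  decomp_out : forall n p q i x,
    ~~ [&& n.+1 == p + q, 1 <= i & i <= p]%N -> decomp n p q i x = 0;
  decomp_counitl : forall n x, evall counit (decomp n 1%N n 1%N x) = x;
  decomp_counitr : forall n i x,
    (1 <= i <= n)%N -> evalr counit (decomp n n 1%N i x) = x;
  decomp_coassoc : forall m n p q r i j x,
    n.+1 = (p + q)%N -> m.+1 = (n + r)%N ->
    (1 <= i <= p)%N -> (1 <= j <= n)%N ->
    tmap (decomp n p q i) idfun (decomp m n r j x) =
      if (i + q <= j)%N then
        tswapr (tmap (decomp (p + r).-1 p r (j - q).+1) idfun
                     (decomp m (p + r).-1 q i x))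
      else if (i <= j)%N then
        tassoc (tmap idfun (decomp (q + r).-1 q r (j - i).+1)
                     (decomp m p (q + r).-1 i x))
      else
        tswapr (tmap (decomp (p + r).-1 p r j) idfun
                     (decomp m (p + r).-1 q (i + r).-1 x)) }.

(* [comul] is mu^c and [coune] is e^c; [counit] above is epsilon. *)
Record mcooperad (k : comPzRingType) := Mcooperad {
  mcoop :> cooperad k;
  comul : {linear mcoop 2%N -> k^o};
  coune : {linear mcoop 0%N -> k^o};
  comul_coassoc : forall x,
    evalb comul comul (decomp mcoop 3%N 2%N 2%N 1%N x) =
    evalb comul comul (decomp mcoop 3%N 2%N 2%N 2%N x);
  comul_counitr : forall x,
    evalb comul coune (decomp mcoop 1%N 2%N 0%N 1%N x) = counit mcoop x;
  comul_counitl : forall x,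
    evalb comul coune (decomp mcoop 1%N 2%N 0%N 2%N x) = counit mcoop x }.

Section CupCoproduct.
Variables (k : comPzRingType) (C : mcooperad k).

(* the differential from arity n + 1 to arity n *)
Definition coop_bdry n (x : C n.+1) : C n :=
  evall (comul C) (decomp C n.+1 2%N n 2%N x)
  + (-1) ^+ n.+1 *: evall (comul C) (decomp C n.+1 2%N n 1%N x)
  + \sum_(1 <= i < n.+1) (-1) ^+ i *: evalr (comul C) (decomp C n.+1 n 2%N i x).

Lemma coop_bdry_linear n : linear (@coop_bdry n).
Proof.
move=> a x y; rewrite /coop_bdry !linearP /= !scalerDr !scalerA (mulrC a).
under eq_bigr => i _ do rewrite !linearP /=.
by rewrite big_split /= -[X in _ + (X + _)]scaler_sumr [X in X + _ = _]addrACA [LHS]addrACA.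
Qed.
HB.instance Definition _ n :=
  GRing.isLinear.Build k _ _ _ (@coop_bdry n) (@coop_bdry_linear n).

Definition coop_complex : precomplex k := Precomplex coop_bdry.

(* the component of the cup coproduct of C(n) in C(p) (x) C(q): the summand *)
(* j = p + 1, where n + 1 - j = q                                           *)
Definition cup_component n p q : C n -> C p ⊗ C q :=
  tmap (evall (comul C) \o decomp C p.+1 2%N p 1%N) idfun
  \o decomp C n p.+1 q p.+1.

Definition cup n (x : C n) : gtensor C C n :=
  truncate (fun i => cup_component i.1 i.2 x).

Lemma cup_linear n : linear (@cup n).
Proof. by apply: truncate_linear => i a x y; rewrite /cup_component linearP. Qed.
HB.instance Definition _ n :=
  GRing.isLinear.Build k _ _ _ (@cup n) (@cup_linear n).

End CupCoproduct.

Section HomologyMaps.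
Variable k : comPzRingType.
Implicit Types A B C D E : precomplex k.

Definition homology D : nat -> lmodType k := homology_type D.

(* f sends cycles to cycles and F [z] = [f z]; F is unique if it exists,    *)
(* and it exists iff f also sends boundaries of cycles to boundaries        *)
Definition induced D E (f : forall n, D n -> E n)
    (F : forall n, {linear homology D n -> homology E n}) : Prop :=
  forall n (z : cycles D n), exists2 w : cycles E n,
    chain_of w = f n (chain_of z) & F n (hclass z) = hclass w.

(* the Kuenneth map H(A) (x) H(B) -> H(A (x) B), [a] (x) [b] |-> [a (x) b]  *)
Definition kunneth_map2 A B
    (K : forall n, {linear gtensor (homology A) (homology B) n ->
                           homology (tensor_complex A B) n}) : Prop :=
  forall n (x : gtensor (cycles A) (cycles B) n),
    exists2 w : cycles (tensor_complex A B) n,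
      chain_of w = gmap2 (@chain_of _ A) (@chain_of _ B) x &
      K n (gmap2 (@hclass _ A) (@hclass _ B) x) = hclass w.

Definition kunneth_map3 A B C
    (K : forall n, {linear gtensor3 (homology A) (homology B) (homology C) n ->
                           homology (tensor3_complex A B C) n}) : Prop :=
  forall n (x : gtensor3 (cycles A) (cycles B) (cycles C) n),
    exists2 w : cycles (tensor3_complex A B C) n,
      chain_of w =
        gmap3 (@chain_of _ A) (@chain_of _ B) (@chain_of _ C) x &
      K n (gmap3 (@hclass _ A) (@hclass _ B) (@hclass _ C) x) = hclass w.

End HomologyMaps.

Definition is_field (k : comPzRingType) : Prop :=
  (1 : k) <> 0 /\ forall x : k, x <> 0 -> exists y : k, x * y = 1.

Arguments induced {k} D E f F.
Arguments kunneth_map2 {k} A B K.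
Arguments kunneth_map3 {k} A B C K.

(* Main.v *)
(* For a commutative algebra A, the modules Hom(C(n), A) form an operad with   *)
(* multiplication: the multiplication of A absorbs the swaps of tensor factors *)
(* in the cooperad axioms.  There d is the alternating sum of the cofaces      *)
(* mu o_2 f, f o_i mu, mu o_1 f, and Gerstenhaber's homotopy                   *)
(*   g u f - (-1)^(pq) f u g =                                                 *)
(*     df o g + (-1)^(q-1) (f o dg - d(f o g)),  f o g = sum +- f o_i g,       *)
(* holds by rearranging a double sum.  Any U (x) V (x) W is a retract of a     *)
(* suitable A in which u (x) v (x) w goes to a product, so these identities    *)
(* can be read back in C(p) (x) C(q) (x) C(r).  Over a field each complex      *)
(* retracts by deformation onto its homology, whence the Kuenneth theorem.     *)

Require Import Defs.
From HB Require Import structures.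
From mathcomp Require Import all_boot ssralg ssrAC zify.
From mathcomp.classical Require Import boolp functions classical_sets.

Set Implicit Arguments.
Unset Strict Implicit.
Unset Printing Implicit Defensive.

Import GRing.Theory.
Local Open Scope ring_scope.

(** The cup coproduct and its signed twist are chain homotopic. The homotopy is the transpose of
    Gerstenhaber's: the sum [brace] inserts g at every input of f, and when its differential is
    compared with the insertions of g into df and of dg into f, everything cancels except the terms
    in which the multiplication joins f and g side by side. These are the two cup products g u f and
    f u g ([brace_diffl], [brace_homotopy]).

    This computation takes place in an operad with multiplication, and [hom_operad] supplies one for
    every commutative algebra A, with modules Hom(C(n), A). Nothing is lost by the passage:
    adjoining variables to k one after another gives an A from which U (x) V (x) W can be recovered
    linearly ([tensor3_calgebra]), so an equation in C(p) (x) C(q) or in C(p) (x) C(q) (x) C(r)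
    holds as soon as it holds after evaluation in such an A ([pairing_detect], [eval3_detect]). In
    this way [diff_diff], [diff_cup], [cup_prodA] and [brace_homotopy] become [coop_bdry_bdry],
    [cup_component_bdry], [cup_component_coassoc] and [cup_component_swap]. Collecting bidegrees
    gives [gtwist_cup], hence cocommutativity as an equation in H(C (x) C), over any commutative
    ring.

    A coproduct with values in H (x) H has to be pulled back along the Kuenneth map. The Kuenneth
    maps exist over every ring because the tensor product is right exact ([kunneth2_exists],
    [kunneth3_exists]), and they intertwine coproducts, twists and counits ([kunneth_coprod_l],
    [kunneth_coprod_r], [kunneth_twist], [kunneth_counit_l], [kunneth_counit_r]). If the twofold map
    is bijective and the threefold one injective, every coalgebra law therefore descends from H(C
    (x) C) or H(C (x) C (x) C). Over a field these two properties follow from a deformation of each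
    complex onto its homology ([homotopy_retraction], [kunneth2_inj], [kunneth2_surj],
    [kunneth3_inj]). *)

(** * Operads with multiplication *)

(* [circ n i f g] is the partial composition of f with g at the input i + 1. *)
(* The arity n = p + q - 1 is an argument, which avoids casts; [circ] is     *)
(* constrained only for such n and for i < p.                                *)
Record mul_operad (k : comPzRingType) := MulOperad {
  op :> nat -> lmodType k;
  circ : forall p q n : nat, nat -> op p -> op q -> op n;
  circ_linearl : forall p q n i (g : op q), linear (fun f : op p => circ n i f g);
  circ_linearr : forall p q n i (f : op p), linear (fun g : op q => circ n i f g);
  circ_seq : forall p q r n n' m i j (f : op p) (g : op q) (h : op r),
    n.+1 = (p + q)%N -> n'.+1 = (q + r)%N -> m.+1 = (n + r)%N ->
    (i < p)%N -> (j < q)%N ->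
    circ m (i + j) (circ n i f g) h = circ m i f (circ n' j g h);
  circ_par : forall p q r n n' m i j (f : op p) (g : op q) (h : op r),
    n.+1 = (p + q)%N -> n'.+1 = (p + r)%N -> m.+1 = (n + r)%N ->
    (i <= j)%N -> (j.+1 < p)%N ->
    circ m (j + q) (circ n i f g) h = circ m i (circ n' j.+1 f h) g;
  omul : op 2%N;
  omulA : circ 3 0 omul omul = circ 3 1 omul omul }.

Arguments circ {k m p q} n i f g : rename.
Arguments omul {k m} : rename.

Section Operad.
Variables (k : comPzRingType) (O : mul_operad k).

Let mu : O 2%N := omul.

Section Bilinear.
Variables (p q n i : nat).
Lemma circ_suml I r (P : pred I) (a : I -> k) (F : I -> O p) (g : O q) :
  circ n i (\sum_(l <- r | P l) a l *: F l) g =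
  \sum_(l <- r | P l) a l *: circ n i (F l) g.
Proof.
pose L := GRing.isLinear.Build _ _ _ _ _ (@circ_linearl k O p q n i g).
pose F' : {linear O p -> O n} := HB.pack (fun f => circ n i f g) L.
rewrite -[LHS]/(F' _) linear_sum; apply: eq_bigr => l _; exact: linearZ.
Qed.

Lemma circ_sumr I r (P : pred I) (a : I -> k) (f : O p) (G : I -> O q) :
  circ n i f (\sum_(l <- r | P l) a l *: G l) =
  \sum_(l <- r | P l) a l *: circ n i f (G l).
Proof.
pose L := GRing.isLinear.Build _ _ _ _ _ (@circ_linearr k O p q n i f).
pose F' : {linear O q -> O n} := HB.pack (fun g => circ n i f g) L.
rewrite -[LHS]/(F' _) linear_sum; apply: eq_bigr => l _; exact: linearZ.
Qed.
End Bilinear.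

(** The coface maps of the cosimplicial module attached to an operad with multiplication, for [i]
    from [0] to [n.+1]; larger indices carry no meaning. *)
Definition coface n i (f : O n) : O n.+1 :=
  if i is j.+1 then if (j < n)%N then circ n.+1 j f mu else circ n.+1 0 mu f
  else circ n.+1 1 mu f.

Arguments coface : simpl never.

Lemma coface0 n (f : O n) : coface 0 f = circ n.+1 1 mu f. Proof. by []. Qed.
Lemma cofaceS n (f : O n) i : (i < n)%N -> coface i.+1 f = circ n.+1 i f mu.
Proof. by rewrite /coface => ->. Qed.
Lemma coface_last n (f : O n) : coface n.+1 f = circ n.+1 0 mu f.
Proof. by rewrite /coface ltnn. Qed.

Definition diff n (f : O n) : O n.+1 := \sum_(0 <= i < n.+2) (-1) ^+ i *: coface i f.

Lemma circ_seqE n' p q r n m i j l (f : O p) (g : O q) (h : O r) :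
  l = (i + j)%N ->
  n.+1 = (p + q)%N -> n'.+1 = (q + r)%N -> m.+1 = (n + r)%N ->
  (i < p)%N -> (j < q)%N ->
  circ m l (circ n i f g) h = circ m i f (circ n' j g h).
Proof. by move=> ->; apply: circ_seq. Qed.

(** The parallel axiom with the customary indices i < j of two inputs of f; [l] is j + q - 1,
    characterised by its successor to avoid truncated subtraction. *)
Lemma circ_parE n' p q r n m i j l (f : O p) (g : O q) (h : O r) :
  l.+1 = (j + q)%N ->
  n.+1 = (p + q)%N -> n'.+1 = (p + r)%N -> m.+1 = (n + r)%N ->
  (i < j)%N -> (j < p)%N ->
  circ m l (circ n i f g) h = circ m i (circ n' j f h) g.
Proof.
by case: j => // j; rewrite addSn => -[->] *; apply: circ_par.
Qed.

(** A coface of f o_i g acts on f before the slot, inside g, or on f after the slot. This lemma and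
    the next two treat the index ranges 0..i, i+1..i+q and i+q+1..p+q, which exhaust all cofaces. *)
Lemma coface_circ_lt p q n (f : O p) (g : O q) i l :
  n.+1 = (p + q)%N -> (i < p)%N -> (l <= i)%N ->
  coface l (circ n i f g) = circ n.+1 i.+1 (coface l f) g.
Proof.
move=> np ip; case: l => [|l] li.
  by rewrite !coface0 (@circ_seqE n _ _ _ _ _ _ i) //; lia.
have ln : (l < n)%N by lia.
by rewrite !cofaceS; [rewrite [RHS](@circ_parE n _ _ _ _ _ l i) //|..]; lia.
Qed.

Lemma coface_circ_mid l m p q n (f : O p) (g : O q) i :
  m = (i + l).+1 -> n.+1 = (p + q)%N -> (i < p)%N -> (l < q)%N ->
  coface m (circ n i f g) = circ n.+1 i f (coface l.+1 g).
Proof.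
move=> -> np ip lq; rewrite !cofaceS; try lia.
by rewrite (@circ_seqE q.+1 _ _ _ _ _ _ l) //; lia.
Qed.

Lemma coface_circ_gt l m p q n (f : O p) (g : O q) i :
  m = (l + q)%N -> n.+1 = (p + q)%N -> (i < p)%N -> (i < l <= p)%N ->
  coface m (circ n i f g) = circ n.+1 i (coface l.+1 f) g.
Proof.
move=> -> np ip /andP[il lp]; case: (ltnP l p) => [lp'|pl].
  have -> : (l + q)%N = (l + q).-1.+1 by lia.
  by rewrite !cofaceS; [rewrite (@circ_parE p.+1 _ _ _ _ _ i l) //|..]; lia.
have -> : l = p by lia.
rewrite -np !coface_last.
by rewrite (@circ_seqE n _ _ _ _ _ 0 i) //; lia.
Qed.

(** Multiplying at an input of f and then grafting g into one leg of the product is grafting an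
    outer coface of g. This and the next lemma handle the two legs. *)
Lemma circ_coface_diag p q n (f : O p) (g : O q) i :
  n = (p + q)%N -> (i < p)%N ->
  circ n i (coface i.+1 f) g = circ n i f (coface q.+1 g).
Proof.
move=> np ip; rewrite cofaceS // coface_last.
by rewrite (@circ_seqE q.+1 _ _ _ _ _ _ 0) //; lia.
Qed.

Lemma circ_coface_diagS p q n (f : O p) (g : O q) i :
  n = (p + q)%N -> (i < p)%N ->
  circ n i.+1 (coface i.+1 f) g = circ n i f (coface 0 g).
Proof.
move=> np ip; rewrite cofaceS // coface0.
by rewrite (@circ_seqE q.+1 _ _ _ _ _ _ 1) //; lia.
Qed.

(** All four cofaces of the multiplication are the triple product; associativity enters the later
    computations in this form. *)
Lemma coface_mu l : (l <= 3)%N -> coface l mu = circ 3 0 mu mu.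
Proof. by case: l => [|[|[|[|//]]]] _; rewrite /coface //= -?omulA. Qed.

(** The inner coface is itself a partial composition, so the outer one can be pushed onto one of its
    factors. Where both multiplications meet, [coface_mu] identifies the two triple products. *)
Lemma coface_coface n (f : O n) i j : (i <= j <= n.+1)%N ->
  coface j.+1 (coface i f) = coface i (coface j f).
Proof.
case/andP; case: i => [|i] ij jn.
  rewrite (coface0 f); case: j jn {ij} => [|j] jn.
    by rewrite !coface_circ_lt // !coface_mu.
  case: (ltnP j n) => [lt_jn|le_nj]; first by rewrite (@coface_circ_mid j).
  have -> : j = n by lia.
  rewrite (@coface_circ_gt 2) // (coface_last f) (@coface_circ_lt 2) //. by rewrite !coface_mu.
case: (ltnP i n) => [lt_in|le_ni].
  rewrite (cofaceS f) //; case: (ltngtP i.+1 j) => [lt_ij|//|<-].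
  - case: j jn ij lt_ij => // j jn ij lt_ij.
    by rewrite (@coface_circ_gt j) // ?[RHS]cofaceS //; lia.
  - lia.
  - rewrite [LHS](@coface_circ_mid 1) ?(cofaceS f)
      ?[RHS](@coface_circ_mid 0) ?coface_mu ?addn0 ?addn1 //; lia.
have -> : i = n by lia. have -> : j = n.+1 by lia.
rewrite (coface_last f) (@coface_circ_gt 2) //.
by rewrite (@coface_circ_gt 1) // !coface_mu.
Qed.

(** By induction: the last row and the last column of the array are matched term by term by the
    symmetry of [F], with opposite signs. *)
Lemma alternating_double_sum (V : lmodType k) m (F : nat -> nat -> V) :
  (forall i j, (i <= j < m)%N -> F j.+1 i = F i j) ->
  \sum_(0 <= j < m.+1) \sum_(0 <= i < m) (-1) ^+ (j + i) *: F j i = 0.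
Proof.
elim: m => [|m IHm] FE; first by rewrite big_nat1 big_nil.
rewrite big_nat_recr //=; under eq_big_nat => j _ do rewrite big_nat_recr //=.
rewrite big_split /= IHm ?add0r => [|i j ij]; last by apply: FE; lia.
rewrite -big_split /= big_nat big1 // => j jm.
by rewrite FE ?[(m.+1 + j)%N]addSn 1?[(m + j)%N]addnC; [rewrite exprS mulN1r scaleNr subrr|lia].
Qed.

Lemma coface_sum n i I r (P : pred I) (a : I -> k) (F : I -> O n) :
  coface i (\sum_(l <- r | P l) a l *: F l) =
  \sum_(l <- r | P l) a l *: coface i (F l).
Proof.
by case: i => [|i]; rewrite /coface; try case: ifP => _;
  rewrite ?circ_suml ?circ_sumr.
Qed.

Lemma diff_diff n (f : O n) : diff (diff f) = 0.
Proof.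
rewrite -(@alternating_double_sum _ n.+2 (fun j i => coface j (coface i f))).
  apply: eq_bigr => j _; rewrite coface_sum scaler_sumr; apply: eq_bigr => i _.
  by rewrite scalerA exprD.
by move=> i j ij; rewrite coface_coface //; lia.
Qed.

(** * The cup product of an operad with multiplication *)

Definition cup_prod p q n (f : O p) (g : O q) : O n :=
  circ n p (circ p.+1 0 mu f) g.

Lemma coface_cup_lt p q n (f : O p) (g : O q) i :
  n = (p + q)%N -> (i <= p)%N ->
  coface i (cup_prod n f g) = cup_prod n.+1 (coface i f) g.
Proof.
move=> np ip; rewrite /cup_prod coface_circ_lt //; try lia.
congr circ; case: i ip => [|i] ip.
  by rewrite -circ_coface_diagS // coface_circ_lt // !coface_mu.
by rewrite (@coface_circ_mid i).
Qed.

Lemma coface_cup_gt p q n (f : O p) (g : O q) i :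
  n = (p + q)%N -> (i <= q)%N ->
  coface (p + i).+1 (cup_prod n f g) = cup_prod n.+1 f (coface i.+1 g).
Proof.
move=> np iq; rewrite /cup_prod.
case: (ltnP i q) => [lt_iq|le_qi]; first by rewrite (@coface_circ_mid i) //; lia.
have -> : i = q by lia.
rewrite (@coface_circ_gt p.+1) //; try lia.
rewrite -circ_coface_diag //; try lia.
by rewrite (@coface_circ_gt 2) // (@coface_circ_gt 1) // !coface_mu.
Qed.

(** Both sides are the triple product of f, a free input and g. *)
Lemma cup_coface_mid p q n (f : O p) (g : O q) :
  n = (p + q)%N ->
  cup_prod n.+1 (coface p.+1 f) g = cup_prod n.+1 f (coface 0 g).
Proof.
move=> np; rewrite /cup_prod -circ_coface_diagS //; try lia.
rewrite (@coface_circ_gt 1) //.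
by rewrite -circ_coface_diag // !coface_mu.
Qed.

Lemma cup_suml p q n I r (P : pred I) (a : I -> k) (F : I -> O p) (g : O q) :
  cup_prod n (\sum_(l <- r | P l) a l *: F l) g =
  \sum_(l <- r | P l) a l *: cup_prod n (F l) g.
Proof. by rewrite /cup_prod circ_sumr circ_suml. Qed.

Lemma cup_sumr p q n I r (P : pred I) (a : I -> k) (f : O p) (G : I -> O q) :
  cup_prod n f (\sum_(l <- r | P l) a l *: G l) =
  \sum_(l <- r | P l) a l *: cup_prod n f (G l).
Proof. by rewrite /cup_prod circ_sumr. Qed.

(** Of the cofaces of f u g, the first p + 1 act on f and the last q + 1 on g. The right-hand side
    contains two more terms, the last coface of f and the zeroth of g; they cancel by
    [cup_coface_mid]. *)
Lemma diff_cup p q n (f : O p) (g : O q) : n = (p + q)%N ->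
  diff (cup_prod n f g) =
    cup_prod n.+1 (diff f) g + (-1) ^+ p *: cup_prod n.+1 f (diff g).
Proof.
move=> np; rewrite /diff cup_suml cup_sumr.
rewrite (@big_cat_nat _ _ _ p.+1) //=; last lia.
rewrite [X in _ = X + _]big_nat_recr //= [X in _ = _ + _ *: X]big_nat_recl //=.
rewrite cup_coface_mid // expr0 scale1r scalerDr exprS mulN1r scaleNr.
rewrite addrA subrK; congr (_ + _).
  by apply: eq_big_nat => i ip; rewrite coface_cup_lt //; lia.
rewrite -{1}[p.+1]add0n big_addn scaler_sumr.
have -> : (n.+2 - p.+1 = q.+1)%N by lia.
apply: eq_big_nat => i iq; rewrite addnS addnC coface_cup_gt //; try lia.
by rewrite scalerA -exprD addnS.
Qed.

Lemma cup_prodA p q r n n' m (f : O p) (g : O q) (h : O r) :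
  n = (p + q)%N -> n' = (q + r)%N -> m = (n + r)%N ->
  cup_prod m (cup_prod n f g) h = cup_prod m f (cup_prod n' g h).
Proof.
move=> np nq mn; rewrite /cup_prod; set X := circ p.+1 0 mu f.
rewrite -(@circ_seqE n' p.+1 q.+1 r n.+1 m p q n) //; try lia.
congr circ; rewrite -(@circ_seqE q.+1 p.+1 2 q p.+2 _ p 0 p) //; try lia.
rewrite -(@circ_seqE n 2 p.+1 q p.+2 _ 0 p p) //; try lia.
have -> : circ p.+2 0 mu X = circ p.+2 0 (coface 1 mu) f.
  by rewrite circ_coface_diag // coface_last.
congr circ; rewrite -(cofaceS X) // /X.
by rewrite (@coface_circ_gt 1) // !coface_mu.
Qed.

(** * Gerstenhaber's commutativity homotopy *)

Lemma sign_eq (V : lmodType k) a b (x : V) : odd a = odd b ->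
  (-1) ^+ a *: x = (-1) ^+ b *: x.
Proof. by move=> ab; rewrite -signr_odd ab signr_odd. Qed.

Lemma sign_neq (V : lmodType k) a b (x : V) : odd a != odd b ->
  (-1) ^+ a *: x = - ((-1) ^+ b *: x).
Proof.
move=> ab; rewrite (@sign_eq _ a b.+1) ?exprS ?mulN1r ?scaleNr //=.
by move: ab; case: odd; case: odd.
Qed.

(** Gerstenhaber's circle product. Its sign is (-1)^(i(q-1)); [q.+1] has the parity of q - 1 and
    makes sense for q = 0. *)
Definition brace p q n (f : O p) (g : O q) : O n :=
  \sum_(0 <= i < p) (-1) ^+ (i * q.+1) *: circ n i f g.

(** The source of both cup products: grafting g into the first input of mu o_2 f gives g u f, and
    into the last input of mu o_1 f gives f u g. The case p = q = 0 is included, which settles arity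
    0 later. *)
Lemma brace_diffl p q N (f : O p) (g : O q) : N = (p + q)%N ->
  brace N (diff f) g =
    cup_prod N g f - (-1) ^+ (p * q) *: cup_prod N f g
    + \sum_(0 <= i < p) (
        (-1) ^+ (i.+1 * q.+1) *:
          \sum_(0 <= l < i.+1) (-1) ^+ l *: circ N i.+1 (coface l f) g
        + (-1) ^+ (i * q.+1) *:
          \sum_(i.+2 <= l < p.+2) (-1) ^+ l *: circ N i (coface l f) g
        + (-1) ^+ (i * q + q) *: circ N i f (coface 0 g)
        - (-1) ^+ (i * q) *: circ N i f (coface q.+1 g)).
Proof.
move=> Np; pose F l i := circ N i (coface l f) g.
(* At each input [i] the cofaces [l = i] and [l = i.+1] are set apart: there g is plugged directly
   into a leg of the multiplication. *)
rewrite /brace /diff; transitivity (\sum_(0 <= i < p.+1) (-1) ^+ (i * q.+1) *: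
  (\sum_(0 <= l < i) (-1) ^+ l *: F l i + \sum_(i.+2 <= l < p.+2) (-1) ^+ l *: F l i
   + (-1) ^+ i *: F i i - (-1) ^+ i *: F i.+1 i)).
  apply: eq_big_nat => i ip; congr (_ *: _); rewrite circ_suml.
  rewrite (@big_cat_nat _ _ _ i) //=; last lia.
  rewrite (@big_cat_nat _ _ _ i.+2 i) //=; try lia.
  rewrite [X in _ + (X + _)]big_nat_recl // big_nat1 exprS mulN1r scaleNr -!addrA.
  by congr (_ + _); rewrite [RHS]addrC -addrA.
under eq_bigr do rewrite scalerBr !scalerDr.
rewrite sumrB !big_split /=.

have -> : \sum_(0 <= i < p.+1) (-1) ^+ (i * q.+1) *: ((-1) ^+ i *: F i i) =
  cup_prod N g f + \sum_(0 <= i < p) (-1) ^+ (i * q + q) *: circ N i f (coface 0 g).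
  rewrite big_nat_recl //= !expr0 !scale1r; congr (_ + _).
    by rewrite /F /cup_prod -(@circ_parE p.+1 2 q p q.+1 N 0 1 q) //; lia.
  apply: eq_big_nat => i ip; rewrite scalerA -exprD /F circ_coface_diagS //.
  by apply: sign_eq; rewrite !(oddD, oddM, oddS) /=; case: odd; case: odd.
have -> : \sum_(0 <= i < p.+1) (-1) ^+ (i * q.+1) *: ((-1) ^+ i *: F i.+1 i) =
  \sum_(0 <= i < p) (-1) ^+ (i * q) *: circ N i f (coface q.+1 g)
  + (-1) ^+ (p * q) *: cup_prod N f g.
  rewrite big_nat_recr //=; congr (_ + _); last first.
    rewrite scalerA -exprD /F coface_last.
    by apply: sign_eq; rewrite !(oddD, oddM, oddS) /=; case: odd; case: odd.
  apply: eq_big_nat => i ip; rewrite scalerA -exprD /F circ_coface_diag //.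
  by apply: sign_eq; rewrite !(oddD, oddM, oddS) /=; case: odd; case: odd.
rewrite big_nat_recl // [X in _ *: X]big_geq // scaler0 add0r.
rewrite [X in _ + X + _]big_nat_recr //= [X in _ *: X]big_geq // scaler0 addr0.
rewrite sumrN opprD; set S1 := bigop _ _ _; set S2 := bigop _ _ _.
set S3 := bigop _ _ _; set S4 := bigop _ _ _; set cgf := cup_prod _ _ _.
set cfg := (_ *: _).
rewrite [RHS]addrC -!addrA; do 2 congr (_ + _); rewrite addrCA; congr (_ + _).
by rewrite addrCA.
Qed.

(** The three ranges of cofaces of a partial composition. The middle range meets only the inner
    cofaces of g, so it is dg with its two outer terms removed. *)
Lemma diff_circ p q n (f : O p) (g : O q) i : n.+1 = (p + q)%N -> (i < p)%N ->
  diff (circ n i f g) =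
    \sum_(0 <= l < i.+1) (-1) ^+ l *: circ n.+1 i.+1 (coface l f) g
    + (-1) ^+ i *: (circ n.+1 i f (diff g) - circ n.+1 i f (coface 0 g)
                    + (-1) ^+ q *: circ n.+1 i f (coface q.+1 g))
    + (-1) ^+ q.+1 *:
        \sum_(i.+2 <= l < p.+2) (-1) ^+ l *: circ n.+1 i (coface l f) g.
Proof.
move=> np ip; rewrite /diff circ_sumr.
rewrite (@big_cat_nat _ _ _ i.+1) //=; last lia.
rewrite (@big_cat_nat _ _ _ (i.+1 + q) i.+1) //=; try lia.
rewrite addrA; congr (_ + _ + _).
- by apply: eq_big_nat => l li; rewrite coface_circ_lt //; lia.
- rewrite [in RHS]big_nat_recl // [in RHS]big_nat_recr //= expr0 scale1r.
  rewrite [X in _ *: (X - _ + _)]addrC addrK exprS mulN1r scaleNr addrNK.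
  rewrite -{1}[i.+1]add0n big_addn addKn scaler_sumr.
  apply: eq_big_nat => l lq; rewrite (@coface_circ_mid l) //; try lia.
  by rewrite scalerA -exprD !addnS addnC.
- rewrite big_addn [in RHS]big_add1 /= scaler_sumr.
  have -> : (n.+2 - q = p.+1)%N by lia.
  apply: eq_big_nat => l lp; rewrite (@coface_circ_gt l) //; try lia.
  by rewrite scalerA -exprD; apply: sign_eq; rewrite !oddD /=; case: odd; case: odd.
Qed.

(** The cup products come from [brace_diffl]; the remaining terms cancel separately for each input
    [i] of f, by [diff_circ]. *)
Lemma brace_homotopy p q n (f : O p) (g : O q) : n.+1 = (p + q)%N ->
  cup_prod n.+1 g f - (-1) ^+ (p * q) *: cup_prod n.+1 f g =
    brace n.+1 (diff f) g
    + (-1) ^+ q.+1 *: (brace n.+1 f (diff g) - diff (brace n f g)).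
Proof.
move=> np; rewrite brace_diffl // -[LHS]addr0 -[RHS]addrA; congr (_ + _).
have -> : diff (brace n f g) =
    \sum_(0 <= i < p) (-1) ^+ (i * q.+1) *: diff (circ n i f g).
  rewrite /diff /brace; under eq_bigr do rewrite coface_sum scaler_sumr.
  rewrite exchange_big; apply: eq_bigr => i _; rewrite scaler_sumr.
  by apply: eq_bigr => l _; rewrite !scalerA mulrC.
rewrite /brace -sumrB scaler_sumr -big_split /= big_nat big1 // => i ip.
rewrite diff_circ //; move: (circ _ i f (diff g)) => D.
move: (circ _ i f (coface 0 g)) (circ _ i f (coface q.+1 g)) => G0 Gq.
set A := bigop _ _ _; set B := bigop _ _ _; move: A B => A B.
rewrite !(scalerBr, scalerDr) !scalerA -!exprD.
have sgn := (oddD, oddM, oddS).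
(* The signs coming from [diff_circ] are brought by parity to those of [brace_diffl]; afterwards the
   two sides differ only in the order of their summands. *)
rewrite -mulSn [X in _ - (_ + _ + X)](@sign_eq _ _ (i * q.+1)); last first.
  by rewrite !sgn /=; case: odd; case: odd.
rewrite [X in _ - (_ + (X - _ + _) + _)](@sign_eq _ _ (q.+1 + i * q.+2)); last first.
  by rewrite !sgn /=; case: odd; case: odd.
rewrite [X in _ - (_ + (_ - X + _) + _)](@sign_neq _ _ (i * q + q)); last first.
  by rewrite !sgn /=; case: odd; case: odd.
rewrite [X in _ - (_ + (_ - _ + X) + _)](@sign_neq _ _ (i * q)); last first.
  by rewrite !sgn /=; case: odd; case: odd.
rewrite opprK; apply/eqP; rewrite addrA subr_eq0; apply/eqP.
by rewrite (AC 5%AC (1*(5*3*4)*2)%AC).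
Qed.

End Operad.

Arguments coface {k O n} i f : simpl never.
Arguments circ : simpl never.

(** * Tensor products and commutative algebras *)

Section TensorLemmas.
Variable k : comPzRingType.
Implicit Types U V W X : lmodType k.

Definition mk_linear U V (f : U -> V) (fL : linear f) : {linear U -> V} :=
  HB.pack f (GRing.isLinear.Build k U V _ f fL).

Lemma linear_funD U V (f : U -> V) : linear f -> {morph f : x y / x + y}.
Proof. by move=> fL; exact: (linearD (mk_linear fL)). Qed.

Lemma linear_funZ U V (f : U -> V) a : linear f -> {morph f : x / a *: x}.
Proof. by move=> fL; exact: (linearZ_LR (mk_linear fL)). Qed.

Lemma linear_fun0 U V (f : U -> V) : linear f -> f 0 = 0.
Proof. by move=> fL; exact: (linear0 (mk_linear fL)). Qed.

Lemma linear_funB U V (f : U -> V) : linear f -> {morph f : x y / x - y}.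
Proof. by move=> fL; exact: (linearB (mk_linear fL)). Qed.

Lemma linear_funN U V (f : U -> V) : linear f -> {morph f : x / - x}.
Proof. by move=> fL; exact: (linearN (mk_linear fL)). Qed.

Lemma linear_fun_sum U V (f : U -> V) I r (P : pred I) (F : I -> U) : linear f ->
  f (\sum_(i <- r | P i) F i) = \sum_(i <- r | P i) f (F i).
Proof. by move=> fL; exact: (linear_sum (mk_linear fL)). Qed.

Lemma linear_comp U V W (f : U -> V) (g : V -> W) :
  linear f -> linear g -> linear (g \o f).
Proof. by move=> fL gL a x y; rewrite /= fL gL. Qed.

Lemma linear_add U V (f g : U -> V) : linear f -> linear g -> linear (f \+ g).
Proof. by move=> fL gL a x y; rewrite /= fL gL scalerDr addrACA. Qed.

Lemma linear_sub U V (f g : U -> V) : linear f -> linear g -> linear (f \- g).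
Proof. by move=> fL gL a x y; rewrite /= fL gL scalerBr opprD addrACA. Qed.

Lemma linear_id U : linear (@idfun U).
Proof. by []. Qed.

Lemma tensor_ext U V W (f g : U ⊗ V -> W) : linear f -> linear g ->
  (forall u v, f (tens u v) = g (tens u v)) -> f =1 g.
Proof. by move=> fL gL fg x; apply: (@tlift_uniq _ _ _ _ (mk_linear fL) (mk_linear gL)). Qed.

Lemma eq_tlift U V W (f g : U -> V -> W) : f =2 g -> tlift f =1 tlift g.
Proof. by move=> fg x; apply: eq_bigr => i _; rewrite fg. Qed.

Lemma linear_tmap U U' V V' (f : {linear U -> U'}) (g : {linear V -> V'}) :
  linear (tmap f g).
Proof. exact: linearP. Qed.

Lemma tmap_tens U U' V V' (f : {linear U -> U'}) (g : {linear V -> V'}) u v :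
  tmap f g (tens u v) = tens (f u) (g v).
Proof. by rewrite /tmap tlift_tens //; apply: tmap_bilinear. Qed.

Lemma evall_tens U V (f : {linear U -> k^o}) u (v : V) :
  evall f (tens u v) = (f u : k) *: v.
Proof. by rewrite /evall tlift_tens //; apply: evall_bilinear. Qed.

Lemma evalr_tens U V (f : {linear V -> k^o}) (u : U) v :
  evalr f (tens u v) = (f v : k) *: u.
Proof. by rewrite /evalr tlift_tens //; apply: evalr_bilinear. Qed.

Lemma evalb_tens U V (f : {linear U -> k^o}) (g : {linear V -> k^o}) u v :
  evalb f g (tens u v) = (f u : k) *: g v.
Proof. by rewrite /evalb tlift_tens //; apply: evalb_bilinear. Qed.

Lemma evall_tmapE U U' V V' (f : {linear U -> k^o}) (f' : {linear U' -> k^o})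
    (a : {linear U' -> U}) (b : {linear V -> V'}) t :
  f' =1 f \o a -> evall f (tmap a b t) = b (evall f' t).
Proof.
move=> fE; apply: (tensor_ext (f := @evall k _ _ f \o tmap a b) (g := b \o @evall k _ _ f'))
  t => [||u v].
- exact: linear_comp (linearP _) (linearP _).
- exact: linear_comp (linearP _) (linearP _).
by rewrite /= tmap_tens !evall_tens linearZ fE.
Qed.

Lemma evalr_tmapE U U' V V' (f : {linear V -> k^o}) (f' : {linear V' -> k^o})
    (a : {linear U -> U'}) (b : {linear V' -> V}) t :
  f' =1 f \o b -> evalr f (tmap a b t) = a (evalr f' t).
Proof.
move=> fE; apply: (tensor_ext (f := @evalr k _ _ f \o tmap a b) (g := a \o @evalr k _ _ f'))
  t => [||u v].
- exact: linear_comp (linearP _) (linearP _).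
- exact: linear_comp (linearP _) (linearP _).
by rewrite /= tmap_tens !evalr_tens linearZ fE.
Qed.

Lemma tswap_tens U V (u : U) (v : V) : tswap (tens u v) = tens v u.
Proof. by rewrite /tswap tlift_tens //; apply: tswap_bilinear. Qed.

Lemma bilinear_comp U U' V V' W (f : U' -> V' -> W) (a : U -> U') (b : V -> V') :
  bilinear_map f -> linear a -> linear b -> bilinear_map (fun u v => f (a u) (b v)).
Proof.
move=> [fl fr] aL bL; split=> [v|u] c x y; first by rewrite aL fl.
by rewrite bL fr.
Qed.

(** [tlift] evaluates a fixed representative of [x], so it is a finite sum of terms linear in the
    parameter u. *)
Lemma linear_tliftl U V W X (f : U -> V -> W -> X) x :
  (forall v w, linear (fun u => f u v w)) -> linear (fun u => tlift (f u) x).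
Proof.
move=> fL a u u'; rewrite /tlift /formal_eval scaler_sumr -big_split /=.
by apply: eq_bigr => i _; rewrite fL.
Qed.

Lemma tens0l U V (v : V) : tens (0 : U) v = 0.
Proof. exact: (linear_fun0 ((tens_bilinear U V).1 v)). Qed.

Lemma tens0r U V (u : U) : tens u (0 : V) = 0.
Proof. exact: (linear_fun0 ((tens_bilinear U V).2 u)). Qed.

Lemma tassoc_bilinear U V W :
  bilinear_map (fun u => tlift (fun (v : V) (w : W) => tens (tens (u : U) v) w)).
Proof.
have bil u : bilinear_map (fun (v : V) (w : W) => tens (tens (u : U) v) w).
  by apply: bilinear_comp (tens_bilinear _ _) ((tens_bilinear _ _).2 u) (@linear_id _).
split=> [t|u]; last exact: tlift_linear.
apply: (@linear_tliftl U V W _ (fun u v w => tens (tens u v) w)) => v w a u u'.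
by rewrite (tens_bilinear _ _).1 (tens_bilinear _ _).1.
Qed.

Lemma tassoc_linear U V W : linear (@tassoc k U V W).
Proof. exact: tlift_linear (tassoc_bilinear _ _ _). Qed.

Lemma tassoc_tens U V W (u : U) (v : V) (w : W) :
  tassoc (tens u (tens v w)) = tens (tens u v) w.
Proof.
rewrite /tassoc !tlift_tens //; last exact: tassoc_bilinear.
by apply: bilinear_comp (tens_bilinear _ _) ((tens_bilinear _ _).2 u) (@linear_id _).
Qed.

Lemma tswapr_bilinear U V W :
  bilinear_map (fun (x : U ⊗ V) (w : W) => tlift (fun u v => tens (tens u w) v) x).
Proof.
have bil w : bilinear_map (fun (u : U) (v : V) => tens (tens u (w : W)) v).
  by apply: bilinear_comp (tens_bilinear _ _) ((tens_bilinear _ _).1 w) (@linear_id _).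
split=> [w|t]; first exact: tlift_linear.
apply: (@linear_tliftl W U V _ (fun w u v => tens (tens u w) v)) => u v a w w'.
by rewrite (tens_bilinear _ _).2 (tens_bilinear _ _).1.
Qed.

Lemma tswapr_linear U V W : linear (@tswapr k U V W).
Proof. exact: tlift_linear (tswapr_bilinear _ _ _). Qed.

Lemma tswapr_tens U V W (u : U) (v : V) (w : W) :
  tswapr (tens (tens u v) w) = tens (tens u w) v.
Proof.
rewrite /tswapr !tlift_tens //; last exact: tswapr_bilinear.
by apply: bilinear_comp (tens_bilinear _ _) ((tens_bilinear _ _).1 w) (@linear_id _).
Qed.

Lemma tensor3_ext U V W X (f g : U ⊗ V ⊗ W -> X) : linear f -> linear g ->
  (forall u v w, f (tens (tens u v) w) = g (tens (tens u v) w)) -> f =1 g.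
Proof.
move=> fL gL fg; apply: tensor_ext => // t w.
have tL : linear (fun t : U ⊗ V => tens t w) by exact: (tens_bilinear _ _).1.
have fwL := linear_comp tL fL; have gwL := linear_comp tL gL.
exact: (tensor_ext fwL gwL (fun u v => fg u v w) t).
Qed.

Lemma tlift_tmap U U' V V' W (f : U' -> V' -> W) (a : {linear U -> U'})
    (b : {linear V -> V'}) x : bilinear_map f ->
  tlift f (tmap a b x) = tlift (fun u v => f (a u) (b v)) x.
Proof.
move=> fB; have abB := bilinear_comp fB (linearP a) (linearP b).
apply: (@tensor_ext _ _ _ (tlift f \o tmap a b) _ _ _ _ x) => [||u v].
- by apply: linear_comp; [exact: linearP | exact: tlift_linear].
- exact: tlift_linear.
by rewrite /= tmap_tens !tlift_tens.
Qed.

End TensorLemmas.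

Record calgebra (k : comPzRingType) := Calgebra {
  calg :> lmodType k;
  cmul : calg -> calg -> calg;
  cone : calg;
  cmul_linear : forall b, linear (cmul^~ b);
  cmulC : commutative cmul;
  cmulA : associative cmul;
  cmul1 : left_id cone cmul }.

Arguments cmul {k c} a b : rename.
Arguments cone {k c} : rename.

Section Calgebra.
Variable k : comPzRingType.
Implicit Types A : calgebra k.

Lemma cmul_linearr A (a : A) : linear (cmul a).
Proof. by move=> c x y; rewrite ![cmul a _]cmulC cmul_linear. Qed.

Lemma cmul_bilinear A : bilinear_map (@cmul k A).
Proof. by split; [exact: cmul_linear | exact: cmul_linearr]. Qed.

Lemma cmul0r A (a : A) : cmul a 0 = 0.
Proof. exact: (linear_fun0 (cmul_linearr a)). Qed.

Definition base_calgebra : calgebra k.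
Proof.
apply: (@Calgebra k k^o *%R 1 _ (@mulrC k) (@mulrA k) (@mul1r k)).
by move=> b c x y; rewrite /= mulrDl -mulrA.
Defined.

Section Adjoin.
Variables (A : calgebra k) (W : lmodType k).

Let bilA a : bilinear_map (fun (b : A) (w : W) => tens (cmul a b) w).
Proof. exact: bilinear_comp (tens_bilinear _ _) (cmul_linearr a) (@linear_id _ _). Qed.

Definition adj_act (a : A) : A ⊗ W -> A ⊗ W :=
  tlift (fun b w => tens (cmul a b) w).

Lemma adj_act_bilinear : bilinear_map adj_act.
Proof.
split=> [t|a]; last exact: tlift_linear.
apply: (@linear_tliftl k A A W _ (fun a b w => tens (cmul a b) w)) => b w c x y.
by rewrite cmul_linear (tens_bilinear _ _).1.
Qed.

Lemma adj_act_tens a b w : adj_act a (tens b w) = tens (cmul a b) w.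
Proof. by rewrite /adj_act tlift_tens. Qed.

Lemma adj_actM a b t : adj_act a (adj_act b t) = adj_act (cmul a b) t.
Proof.
apply: (@tensor_ext _ _ _ _ (adj_act a \o adj_act b)) t => [||c w].
- by apply: linear_comp; apply: adj_act_bilinear.2.
- exact: adj_act_bilinear.2.
by rewrite /= !adj_act_tens cmulA.
Qed.

Lemma adj_act1 t : adj_act cone t = t.
Proof.
apply: (@tensor_ext _ _ _ _ (adj_act cone) idfun) t => //; first exact: adj_act_bilinear.2.
by move=> a w; rewrite adj_act_tens cmul1.
Qed.

Let M : lmodType k := (A * (A ⊗ W))%type.
Definition adj_mul (x y : M) : M :=
  (cmul x.1 y.1, adj_act x.1 y.2 + adj_act y.1 x.2).

(* the square-zero extension of A by the A-module A (x) W *)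
Definition adjoin : calgebra k.
Proof.
apply: (@Calgebra k M adj_mul (cone, 0)).
- move=> [b s] a [x t] [y r]; congr pair => /=; first exact: cmul_linear.
  by rewrite adj_act_bilinear.1 adj_act_bilinear.2 scalerDr addrACA.
- by move=> [a t] [b s]; rewrite /adj_mul /= cmulC addrC.
- move=> [a t] [b s] [c r]; congr pair => /=; first exact: cmulA.
  rewrite !(linear_funD (adj_act_bilinear.2 _)) !adj_actM addrA.
  by congr (_ + _ + _); rewrite cmulC.
- move=> [a t]; congr pair => /=; first exact: cmul1.
  by rewrite adj_act1 (linear_fun0 (adj_act_bilinear.2 a)) addr0.
Defined.

Definition adj_in (a : A) : adjoin := (a, 0).
Definition adj_var (w : W) : adjoin := (0, tens cone w).

Lemma adj_in_linear : linear adj_in.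
Proof. by move=> a x y; congr pair; rewrite /= scaler0 addr0. Qed.

Lemma adj_var_linear : linear adj_var.
Proof.
by move=> a x y; congr pair; rewrite /= ?scaler0 ?addr0 // (tens_bilinear _ _).2.
Qed.

Lemma adj_inM a b : cmul (adj_in a) (adj_in b) = adj_in (cmul a b).
Proof. by congr pair; rewrite /= !(linear_fun0 (adj_act_bilinear.2 _)) addr0. Qed.

Lemma adj_in_var a w : cmul (adj_in a) (adj_var w) = (0, tens a w).
Proof.
congr pair => /=; first exact: cmul0r.
rewrite adj_act_tens (linear_fun0 (adj_act_bilinear.2 _)) addr0.
by rewrite cmulC cmul1.
Qed.

Definition adj_proj (N : lmodType k) (r : {linear A -> N}) (x : adjoin) : N ⊗ W :=
  tmap r idfun x.2.

Lemma adj_proj_linear (N : lmodType k) (r : {linear A -> N}) : linear (adj_proj r).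
Proof. by move=> a x y; rewrite /adj_proj linearP. Qed.

Lemma adj_projE (N : lmodType k) (r : {linear A -> N}) a w :
  adj_proj r (cmul (adj_in a) (adj_var w)) = tens (r a) w.
Proof. by rewrite adj_in_var /adj_proj tmap_tens. Qed.

End Adjoin.

(** Starting from k, the modules U, V, W are adjoined by successive square-zero extensions. In each
    extension the product of an old element a with a new variable w is a (x) w in the ideal, so a
    product of three variables from different stages survives, and [r] peels them off from the
    outermost one inwards. *)
Lemma tensor3_calgebra (U V W : lmodType k) :
  exists (A : calgebra k) (u : {linear U -> A}) (v : {linear V -> A})
    (w : {linear W -> A}) (r : {linear A -> U ⊗ V ⊗ W}),
  forall a b c, r (cmul (cmul (u a) (v b)) (w c)) = tens (tens a b) c.
Proof.
pose A1 := adjoin base_calgebra U; pose A2 := adjoin A1 V; pose A3 := adjoin A2 W.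
pose idk : {linear base_calgebra -> k^o} := @idfun k^o.
pose evk : {linear k^o ⊗ U -> U} := evall (@idfun k^o : {linear k^o -> k^o}).
(* The ideal of the first extension is k (x) U, which [evk] identifies with U. *)
pose r1 : {linear A1 -> U} :=
  mk_linear (linear_comp (@adj_proj_linear base_calgebra U k^o idk) (linearP evk)).
pose r2 : {linear A2 -> U ⊗ V} := mk_linear (@adj_proj_linear A1 V U r1).
pose r3 : {linear A3 -> U ⊗ V ⊗ W} := mk_linear (@adj_proj_linear A2 W _ r2).
pose i2 := @adj_in_linear A1 V; pose i3 := @adj_in_linear A2 W.
exists A3, (mk_linear (linear_comp (@adj_var_linear base_calgebra U) (linear_comp i2 i3))).
exists (mk_linear (linear_comp (@adj_var_linear A1 V) i3)).
exists (mk_linear (@adj_var_linear A2 W)), r3 => a b c.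
transitivity (adj_proj r2 (cmul (adj_in W (cmul (adj_in V (adj_var base_calgebra a)) (adj_var A1 b)))
  (adj_var A2 c))); first by rewrite -adj_inM.
rewrite adj_projE; congr tens; rewrite [LHS]adj_projE; congr tens.
by rewrite /= /adj_proj /= tmap_tens evall_tens scale1r.
Qed.
End Calgebra.

(** * The operad of functionals on a cooperad *)

Section LinearHom.
Variables (k : comPzRingType) (U V : lmodType k).

Definition linear_pred : pred (U -> V) := fun f => `[< linear f >].

Lemma linear_pred_submod : submod_closed linear_pred.
Proof.
split=> [|a f g /asboolP fL /asboolP gL]; apply/asboolP => b x y.
  by change (0 = b *: 0 + 0 :> V); rewrite scaler0 addr0.
change (a *: f (b *: x + y) + g (b *: x + y) = b *: (a *: f x + g x) + (a *: f y + g y)).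
by rewrite fL gL !scalerDr !scalerA [b * a]mulrC addrACA.
Qed.
HB.instance Definition _ :=
  GRing.isSubmodClosed.Build k (U -> V) linear_pred linear_pred_submod.

Record lhom : Type := LHom { lhom_fun :> U -> V; _ : linear_pred lhom_fun }.
HB.instance Definition _ := [isSub for lhom_fun].
HB.instance Definition _ := [Choice of lhom by <:].
HB.instance Definition _ := [SubChoice_isSubLmodule of lhom by <:].

Definition mk_lhom (f : U -> V) (fL : linear f) := LHom (asboolT fL).

Lemma lhom_linear (f : lhom) : linear f.
Proof. by case: f => f fL; apply/asboolP. Qed.

Lemma lhomP (f g : lhom) : f =1 g -> f = g.
Proof. by move=> fg; apply/val_inj/funext. Qed.

Lemma lhomDE a (f g : lhom) x : (a *: f + g) x = a *: f x + g x.
Proof. by []. Qed.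

Lemma lhom_sum I r (P : pred I) (F : I -> lhom) x :
  (\sum_(i <- r | P i) F i) x = \sum_(i <- r | P i) F i x.
Proof. by elim/big_rec2: _ => // i y f _ <-. Qed.

End LinearHom.

Section OperadOfCooperad.
Variables (k : comPzRingType) (C : mcooperad k) (A : calgebra k).
Implicit Types p q r n m i j : nat.

Let H n : lmodType k := lhom (C n) A.

Lemma cmul_lhom_bilinear (U V : lmodType k) (f : lhom U A) (g : lhom V A) :
  bilinear_map (fun u v => cmul (f u) (g v)).
Proof. exact: bilinear_comp (cmul_bilinear _) (lhom_linear f) (lhom_linear g). Qed.

(** The partial composition dual to the decomposition, followed by the product of A. Inputs are
    counted from 0 in the operad and from 1 in the cooperad, hence [i.+1]. *)
Definition hcirc_fun p q n i (f : H p) (g : H q) (x : C n) : A :=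
  tlift (fun u v => cmul (f u) (g v)) (decomp C n p q i.+1 x).

Lemma hcirc_linear p q n i (f : H p) (g : H q) : linear (hcirc_fun (n := n) i f g).
Proof.
move=> a x y; rewrite /hcirc_fun linearP.
exact: (tlift_linear (cmul_lhom_bilinear f g)).
Qed.

Definition hcirc p q n i (f : H p) (g : H q) : H n :=
  mk_lhom (hcirc_linear (n := n) i f g).

Lemma hcirc_linearl p q n i (g : H q) : linear (fun f : H p => hcirc n i f g).
Proof.
move=> a f f'; apply: lhomP => x; rewrite lhomDE /= /hcirc_fun.
apply: (@linear_tliftl k (H p) _ _ _ (fun f u v => cmul (f u) (g v))) => u v c y z.
by rewrite -cmul_linear.
Qed.

Lemma hcirc_linearr p q n i (f : H p) : linear (fun g : H q => hcirc n i f g).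
Proof.
move=> a g g'; apply: lhomP => x; rewrite lhomDE /= /hcirc_fun.
apply: (@linear_tliftl k (H q) _ _ _ (fun g u v => cmul (f u) (g v))) => u v c y z.
by rewrite -cmul_linearr.
Qed.

Definition eval3 (U V W : lmodType k) (f : lhom U A) (g : lhom V A) (h : lhom W A) :
    U ⊗ V ⊗ W -> A :=
  tlift (fun t w => cmul (tlift (fun u v => cmul (f u) (g v)) t) (h w)).

Lemma eval3_bilinear (U V W : lmodType k) (f : lhom U A) (g : lhom V A) (h : lhom W A) :
  bilinear_map (fun t w => cmul (tlift (fun u v => cmul (f u) (g v)) t) (h w)).
Proof.
exact: bilinear_comp (cmul_bilinear _) (tlift_linear (cmul_lhom_bilinear f g)) (lhom_linear h).
Qed.

Lemma eval3_linear (U V W : lmodType k) (f : lhom U A) (g : lhom V A) (h : lhom W A) :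
  linear (eval3 f g h).
Proof. exact: tlift_linear (eval3_bilinear f g h). Qed.

Lemma eval3_tens (U V W : lmodType k) (f : lhom U A) (g : lhom V A) (h : lhom W A) u v w :
  eval3 f g h (tens (tens u v) w) = cmul (cmul (f u) (g v)) (h w).
Proof.
rewrite /eval3 !tlift_tens //; first exact: cmul_lhom_bilinear.
exact: eval3_bilinear.
Qed.

Lemma hcircl p q r n m i j (f : H p) (g : H q) (h : H r) x :
  hcirc m j (hcirc n i f g) h x =
  eval3 f g h (tmap (decomp C n p q i.+1) idfun (decomp C m n r j.+1 x)).
Proof. by rewrite /eval3 tlift_tmap //; apply: eval3_bilinear. Qed.

Lemma hcircr p q r n m i j (f : H p) (g : H q) (h : H r) x :
  hcirc m i f (hcirc n j g h) x =
  eval3 f g h (tassoc (tmap idfun (decomp C n q r j.+1) (decomp C m p n i.+1 x))).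
Proof.
pose gh := tlift (fun v w => cmul (g v) (h w)).
have ghL : linear gh by exact: tlift_linear (cmul_lhom_bilinear g h).
have bil : bilinear_map (fun u t => cmul (f u) (gh t)).
  exact: bilinear_comp (cmul_bilinear _) (lhom_linear f) ghL.
transitivity (tlift (fun u t => cmul (f u) (gh t))
    (tmap idfun (decomp C n q r j.+1) (decomp C m p n i.+1 x))).
  by rewrite tlift_tmap.
move: (tmap _ _ _) => t.
apply: (@tensor_ext _ _ _ _ _ (eval3 f g h \o @tassoc k _ _ _)) t => [||u t].
- exact: tlift_linear.
- exact: linear_comp (@tassoc_linear _ _ _ _) (eval3_linear f g h).
rewrite tlift_tens //=.
have uL : linear (fun t : C q ⊗ C r => tens u t) by exact: (tens_bilinear _ _).2.
apply: (tensor_ext (f := fun t => cmul (f u) (gh t))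
          (g := eval3 f g h \o (@tassoc k _ _ _ \o tens u))) t => [||v w].
- exact: bil.2.
- exact: linear_comp (linear_comp uL (@tassoc_linear _ _ _ _)) (eval3_linear f g h).
by rewrite /= tassoc_tens eval3_tens /gh tlift_tens ?cmulA //; apply: cmul_lhom_bilinear.
Qed.

(** Here commutativity of A absorbs the interchange of tensor factors in the cooperad axioms. *)
Lemma eval3_tswapr (U V W : lmodType k) (f : lhom U A) (g : lhom V A) (h : lhom W A) t :
  eval3 f g h (tswapr t) = eval3 f h g t.
Proof.
apply: (tensor3_ext (f := eval3 f g h \o @tswapr k _ _ _)) t => [||u v w].
- exact: linear_comp (@tswapr_linear _ _ _ _) (eval3_linear f g h).
- exact: eval3_linear.
by rewrite /= tswapr_tens !eval3_tens -!cmulA [cmul (g _) _]cmulC.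
Qed.

(** This is the nested case of [decomp_coassoc], where the second decomposition lands in the factor
    C(q). *)
Lemma hcirc_seq p q r n n' m i j (f : H p) (g : H q) (h : H r) :
  n.+1 = (p + q)%N -> n'.+1 = (q + r)%N -> m.+1 = (n + r)%N ->
  (i < p)%N -> (j < q)%N ->
  hcirc m (i + j) (hcirc n i f g) h = hcirc m i f (hcirc n' j g h).
Proof.
move=> np nq mn ip jq; apply: lhomP => x; rewrite hcircl hcircr.
rewrite decomp_coassoc //; [|lia..].
have -> : (i.+1 + q <= (i + j).+1)%N = false by lia.
have -> : (i.+1 <= (i + j).+1)%N by lia.
by rewrite -nq /= !subSS addKn.
Qed.

(** This is the case [i + q <= j] of [decomp_coassoc], with its swap removed by [eval3_tswapr]. *)
Lemma hcirc_par p q r n n' m i j (f : H p) (g : H q) (h : H r) :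
  n.+1 = (p + q)%N -> n'.+1 = (p + r)%N -> m.+1 = (n + r)%N ->
  (i <= j)%N -> (j.+1 < p)%N ->
  hcirc m (j + q) (hcirc n i f g) h = hcirc m i (hcirc n' j.+1 f h) g.
Proof.
move=> np nq mn ij jp; apply: lhomP => x; rewrite !hcircl.
rewrite decomp_coassoc //; [|lia..].
have -> : (i.+1 + q <= (j + q).+1)%N by lia.
rewrite -nq eval3_tswapr /=.
by have -> : ((j + q).+1 - q = j.+1)%N by lia.
Qed.

Lemma mu_hom_linear : linear (fun x : C 2%N => (comul C x : k) *: (cone : A)).
Proof. by move=> a x y; rewrite linearP scalerDl scalerA. Qed.
Definition mu_hom : H 2%N := mk_lhom mu_hom_linear.

Lemma mu_homA : hcirc 3 0 mu_hom mu_hom = hcirc 3 1 mu_hom mu_hom.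
Proof.
have E i x : hcirc 3 i mu_hom mu_hom x =
    (evalb (comul C) (comul C) (decomp C 3 2 2 i.+1 x) : k) *: cone.
  apply: (tensor_ext (f := tlift (fun u v => cmul (mu_hom u) (mu_hom v)))
    (g := fun t => (evalb (comul C) (comul C) t : k) *: cone)) => [||u v].
  - exact: tlift_linear (cmul_lhom_bilinear _ _).
  - by move=> a s t; rewrite linearP scalerDl scalerA.
  rewrite evalb_tens tlift_tens; last exact: cmul_lhom_bilinear.
  rewrite /=.
  rewrite (linear_funZ _ (cmul_linear _)) (linear_funZ _ (cmul_linearr _)).
  by rewrite cmul1 scalerA.
by apply: lhomP => x; rewrite !E comul_coassoc.
Qed.

Definition hom_operad : mul_operad k :=
  MulOperad hcirc_linearl hcirc_linearr hcirc_seq hcirc_par mu_homA.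

End OperadOfCooperad.

(** * Detecting tensors by evaluation in commutative algebras *)

Section Pairing.
Variables (k : comPzRingType) (A : calgebra k).
Implicit Types U V W : lmodType k.

Definition pairing U V (f : lhom U A) (g : lhom V A) : U ⊗ V -> A :=
  tlift (fun u v => cmul (f u) (g v)).

Lemma pairing_linear U V (f : lhom U A) (g : lhom V A) : linear (pairing f g).
Proof. exact: tlift_linear (cmul_lhom_bilinear f g). Qed.

Lemma pairing_tens U V (f : lhom U A) (g : lhom V A) u v :
  pairing f g (tens u v) = cmul (f u) (g v).
Proof. by rewrite /pairing tlift_tens //; apply: cmul_lhom_bilinear. Qed.

Lemma pairing_tmap U U' V V' (f : lhom U A) (g : lhom V A) (f' : lhom U' A)
    (g' : lhom V' A) (a : {linear U' -> U}) (b : {linear V' -> V}) t :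
  f' =1 f \o a -> g' =1 g \o b -> pairing f' g' t = pairing f g (tmap a b t).
Proof.
move=> fE gE; rewrite /pairing tlift_tmap; last exact: cmul_lhom_bilinear.
by apply: eq_tlift => u v; rewrite fE gE.
Qed.

Lemma pairing_tswap U V (f : lhom U A) (g : lhom V A) t :
  pairing g f t = pairing f g (tswap t).
Proof.
apply: (tensor_ext (f := pairing g f) (g := pairing f g \o @tswap k V U)) t => [||v u].
- exact: pairing_linear.
- exact: linear_comp (linearP _) (pairing_linear f g).
by rewrite /= tswap_tens !pairing_tens cmulC.
Qed.

Lemma eval3_tmap U V W X (f : lhom U A) (g : lhom V A) (h : lhom W A) (fg : lhom X A)
    (a : {linear X -> U ⊗ V}) t :
  fg =1 pairing f g \o a -> pairing fg h t = eval3 f g h (tmap a idfun t).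
Proof.
move=> fgE; rewrite /eval3 tlift_tmap; last exact: eval3_bilinear.
by apply: eq_tlift => x w; rewrite fgE.
Qed.

Lemma eval3_tassoc U V W (f : lhom U A) (g : lhom V A) (h : lhom W A) t :
  eval3 f g h (tassoc t) = tlift (fun u x => cmul (f u) (pairing g h x)) t.
Proof.
have bil : bilinear_map (fun u x => cmul (f u) (pairing g h x)).
  exact: bilinear_comp (cmul_bilinear _) (lhom_linear f) (pairing_linear g h).
apply: (tensor_ext (f := eval3 f g h \o @tassoc k _ _ _)
  (g := tlift (fun u x => cmul (f u) (pairing g h x)))) t => [||u t].
- exact: linear_comp (@tassoc_linear _ _ _ _) (eval3_linear f g h).
- exact: tlift_linear.
rewrite tlift_tens //=.
have uL : linear (fun t : V ⊗ W => tens u t) by exact: (tens_bilinear _ _).2.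
apply: (tensor_ext (f := eval3 f g h \o (@tassoc k _ _ _ \o tens u))
  (g := fun x => cmul (f u) (pairing g h x))) t => [||v w].
- exact: linear_comp (linear_comp uL (@tassoc_linear _ _ _ _)) (eval3_linear f g h).
- exact: bil.2.
by rewrite /= tassoc_tens eval3_tens pairing_tens cmulA.
Qed.

End Pairing.

Section Detect.
Variable k : comPzRingType.

(** The threefold statement with W = k: multiply by the image of 1, apply the retraction, and
    contract the last factor. *)
Lemma pairing_detect (U V : lmodType k) :
  exists (A : calgebra k) (f : lhom U A) (g : lhom V A) (r : {linear A -> U ⊗ V}),
  forall t, r (pairing f g t) = t.
Proof.
have [A [u [v [w [r rE]]]]] := tensor3_calgebra U V (k^o : lmodType k).
pose evr : {linear U ⊗ V ⊗ k^o -> U ⊗ V} := evalr (@idfun k^o : {linear k^o -> k^o}).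
pose r' := mk_linear (linear_comp
  (linear_comp (@cmul_linear k A (w (1 : k))) (linearP r)) (linearP evr)).
exists A, (mk_lhom (linearP u)), (mk_lhom (linearP v)), r' => t.
apply: (tensor_ext (f := r' \o pairing _ _) (g := idfun)) t => [||a b].
- exact: linear_comp (pairing_linear _ _) (linearP r').
- exact: linear_id.
by rewrite /= pairing_tens /= rE evalr_tens scale1r.
Qed.

Lemma eval3_detect (U V W : lmodType k) :
  exists (A : calgebra k) (f : lhom U A) (g : lhom V A) (h : lhom W A)
    (r : {linear A -> U ⊗ V ⊗ W}), forall t, r (eval3 f g h t) = t.
Proof.
have [A [u [v [w [r rE]]]]] := tensor3_calgebra U V W.
exists A, (mk_lhom (linearP u)), (mk_lhom (linearP v)), (mk_lhom (linearP w)), r => t.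
apply: (tensor3_ext (f := r \o eval3 _ _ _) (g := idfun)) t => [||a b c].
- exact: linear_comp (eval3_linear _ _ _) (linearP r).
- exact: linear_id.
by rewrite /= eval3_tens /= rE.
Qed.

End Detect.

(** * The operadic identities read back in the cooperad *)

Section ChainIdentities.
Variables (k : comPzRingType) (C : mcooperad k).

(** The transpose of [brace], as [braceE] makes precise. *)
Definition brace_component n p q (x : C n) : C p ⊗ C q :=
  \sum_(0 <= i < p) (-1) ^+ (i * q.+1) *: decomp C n p q i.+1 x.

Lemma brace_component_linear n p q : linear (@brace_component n p q).
Proof.
move=> a x y; rewrite /brace_component scaler_sumr -big_split /=.
by apply: eq_bigr => i _; rewrite linearP scalerDr !scalerA mulrC.
Qed.

Lemma cup_component_linear n p q : linear (@cup_component k C n p q).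
Proof. by move=> a x y; rewrite /cup_component linearP. Qed.

Section Evaluation.
Variable A : calgebra k.
Let O := hom_operad C A.

Lemma circE p q n i (f : O p) (g : O q) x :
  circ n i f g x = pairing f g (decomp C n p q i.+1 x).
Proof. by []. Qed.

Lemma omul_circE q n i (g : O q) x :
  circ n i (omul : O 2%N) g x = g (evall (comul C) (decomp C n 2 q i.+1 x)).
Proof.
rewrite circE; apply: (tensor_ext (g := g \o evall (comul C))) => [||u v].
- exact: pairing_linear.
- exact: linear_comp (linearP _) (lhom_linear g).
rewrite pairing_tens /= evall_tens (linear_funZ _ (lhom_linear g)).
by rewrite (linear_funZ _ (cmul_linear _)) cmul1.
Qed.

Lemma circ_omulE p n i (f : O p) x :
  circ n i f (omul : O 2%N) x = f (evalr (comul C) (decomp C n p 2 i.+1 x)).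
Proof.
rewrite circE; apply: (tensor_ext (g := f \o evalr (comul C))) => [||u v].
- exact: pairing_linear.
- exact: linear_comp (linearP _) (lhom_linear f).
rewrite pairing_tens /= evalr_tens (linear_funZ _ (lhom_linear f)).
by rewrite (linear_funZ _ (cmul_linearr _)) cmulC cmul1.
Qed.

Let scaleE n a (f : O n) x : (a *: f) x = a *: f x.
Proof. by []. Qed.

(** The operadic differential is the transpose of the cooperadic one, without a sign: the summands
    correspond one to one. *)
Lemma diffE n (f : O n) x : diff f x = f (coop_bdry x).
Proof.
have fL := lhom_linear f.
rewrite /diff lhom_sum big_nat_recl // big_nat_recr // /coop_bdry.
rewrite !(linear_funD fL) !scaleE (linear_funZ _ fL) expr0 scale1r.
rewrite coface0 coface_last !omul_circE -addrA; congr (_ + _).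
rewrite addrC; congr (_ + _); rewrite big_add1.
rewrite (linear_fun_sum _ _ _ fL).
apply: eq_big_nat => i ip; rewrite scaleE cofaceS // circ_omulE.
by rewrite (linear_funZ _ fL).
Qed.

Lemma cup_prodE p q n (f : O p) (g : O q) x :
  cup_prod n f g x = pairing f g (cup_component p q x).
Proof.
rewrite /cup_prod circE /cup_component /=; apply: pairing_tmap => // y.
by rewrite omul_circE.
Qed.

Lemma braceE p q n (f : O p) (g : O q) x :
  brace n f g x = pairing f g (brace_component p q x).
Proof.
have fgL := pairing_linear f g; rewrite (linear_fun_sum _ _ _ fgL) lhom_sum.
by apply: eq_bigr => i _; rewrite (linear_funZ _ fgL).
Qed.

Lemma pairing_diffl p q (f : O p) (g : O q) t :
  pairing (diff f : O p.+1) g t = pairing f g (tmap (@coop_bdry k C p) idfun t).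
Proof. by apply: pairing_tmap => // y; rewrite diffE. Qed.

Lemma pairing_diffr p q (f : O p) (g : O q) t :
  pairing f (diff g : O q.+1) t = pairing f g (tmap idfun (@coop_bdry k C q) t).
Proof. by apply: pairing_tmap => // y; rewrite diffE. Qed.

End Evaluation.

Lemma coop_bdry_bdry n (x : C n.+2) : coop_bdry (coop_bdry x) = 0.
Proof.
have [A [f [g [r rE]]]] := pairing_detect (C n) (k^o : lmodType k).
have E : tens (coop_bdry (coop_bdry x)) (1 : k^o) = 0.
  rewrite -[LHS]rE pairing_tens; have := diff_diff (f : hom_operad C A n).
  move/(congr1 (fun h : lhom _ _ => h x)); rewrite !diffE => ->.
  by rewrite (linear_fun0 (cmul_linear _)) linear0.
have := congr1 (evalr (@idfun k^o : {linear k^o -> k^o})) E.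
by rewrite linear0 evalr_tens scale1r.
Qed.

Lemma cup_component_bdry p q n (x : C n.+1) : n = (p + q)%N ->
  cup_component p q (coop_bdry x) =
    tmap (@coop_bdry k C p) idfun (cup_component p.+1 q x)
    + (-1) ^+ p *: tmap idfun (@coop_bdry k C q) (cup_component p q.+1 x).
Proof.
move=> np; have [A [f [g [r rE]]]] := pairing_detect (C p) (C q).
rewrite -[LHS]rE -[RHS]rE; congr (r _).
rewrite (linear_funD (pairing_linear _ _)) (linear_funZ _ (pairing_linear _ _)).
rewrite -pairing_diffl -pairing_diffr -!cup_prodE -diffE.
by rewrite (diff_cup (f : hom_operad C A p) (g : hom_operad C A q) np).
Qed.

(** The transpose of [brace_homotopy]. The product g u f lives on C(q) (x) C(p), and commutativity
    of A lets it be evaluated after [tswap]. *)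
Lemma cup_component_swap p q n (x : C n.+1) : n.+1 = (p + q)%N ->
  tswap (cup_component q p x) - (-1) ^+ (p * q) *: cup_component p q x =
    tmap (@coop_bdry k C p) idfun (brace_component p.+1 q x)
    + (-1) ^+ q.+1 *: (tmap idfun (@coop_bdry k C q) (brace_component p q.+1 x)
                       - brace_component p q (coop_bdry x)).
Proof.
move=> np; have [A [f [g [r rE]]]] := pairing_detect (C p) (C q).
rewrite -[LHS]rE -[RHS]rE; congr (r _); have fgL := pairing_linear f g.
rewrite !(linear_funB fgL, linear_funD fgL, linear_funZ _ fgL).
rewrite -pairing_diffl -pairing_diffr -!braceE -pairing_tswap -!cup_prodE -diffE.
have := brace_homotopy (f : hom_operad C A p) (g : hom_operad C A q) np.
by move/(congr1 (fun h : lhom _ _ => h x)).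
Qed.

(** [brace_homotopy] covers total arity at least 1; in arity 0 the formula for [brace (diff f) g]
    already contains the whole commutator. *)
Lemma cup_component_swap0 (x : C 0) :
  tswap (cup_component 0 0 x) - cup_component 0 0 x =
    tmap (@coop_bdry k C 0) idfun (brace_component 1 0 x).
Proof.
have [A [f [g [r rE]]]] := pairing_detect (C 0) (C 0).
rewrite -[LHS]rE -[RHS]rE; congr (r _); have fgL := pairing_linear f g.
rewrite (linear_funB fgL).
rewrite -pairing_diffl -!braceE -pairing_tswap -!cup_prodE.
rewrite (@brace_diffl _ (hom_operad C A) 0 0 0) //.
by rewrite big_geq // addr0 expr0 scale1r.
Qed.

Lemma cup_component_coassoc i j l m n n' (x : C m) :
  n = (i + j)%N -> n' = (j + l)%N -> m = (n + l)%N ->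
  tmap (mk_linear (@cup_component_linear n i j)) idfun (cup_component n l x) =
  tassoc (tmap idfun (mk_linear (@cup_component_linear n' j l)) (cup_component i n' x)).
Proof.
move=> nE n'E mE; have [A [f [g [h [r rE]]]]] := eval3_detect (C i) (C j) (C l).
rewrite -[LHS]rE -[RHS]rE; congr (r _).
rewrite -(@eval3_tmap _ _ _ _ _ _ _ _ _
  (cup_prod n (f : hom_operad C A i) (g : hom_operad C A j))).
  rewrite eval3_tassoc tlift_tmap; last first.
    exact: bilinear_comp (cmul_bilinear _) (lhom_linear f) (pairing_linear g h).
  rewrite -cup_prodE (cup_prodA _ _ _ nE n'E mE) cup_prodE.
  by apply: eq_tlift => u v; congr cmul; exact: cup_prodE.
by move=> y; rewrite cup_prodE.
Qed.

Lemma evalb_comul_coune (t : C 2 ⊗ C 0) :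
  coune C (evall (comul C) t) = evalb (comul C) (coune C) t.
Proof.
apply: (tensor_ext (f := coune C \o evall (comul C))) t => [||u v].
- exact: linear_comp (linearP _) (linearP _).
- exact: linearP.
by rewrite /= evall_tens evalb_tens linearZ.
Qed.

(** On C(1) the differential has two terms, and e^c sends both to the cooperad counit, with opposite
    signs. *)
Lemma coune_bdry (x : C 1) : coune C (coop_bdry x) = 0.
Proof.
rewrite /coop_bdry big_geq // addr0 expr1 scaleN1r linearB !evalb_comul_coune.
by rewrite comul_counitr comul_counitl subrr.
Qed.

Lemma cup_component_counitl n (x : C n) : evall (coune C) (cup_component 0 n x) = x.
Proof.
rewrite /cup_component /= (evall_tmapE (f' := counit C)) /= ?decomp_counitl //.
by move=> y; rewrite /= evalb_comul_coune comul_counitr.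
Qed.

Lemma cup_component_counitr n (x : C n) : evalr (coune C) (cup_component n 0 x) = x.
Proof.
have [A [f [g [r rE]]]] := pairing_detect (C n) (k^o : lmodType k).
pose O := hom_operad C A.
have eL : linear (fun y : C 0 => (coune C y : k) *: (cone : A)).
  by move=> a y z; rewrite linearP scalerDl scalerA.
pose e : O 0%N := mk_lhom eL.
have fE : cup_prod n (f : O n) e x = f x.
  (* The cup product composes mu with f first; the parallel axiom composes it with [e] first
     instead, and mu o_2 e is the cooperad counit times the unit of A. *)
  rewrite /cup_prod (@circ_parE _ _ 1 2 n 0 n.+1 n 0 1 n) //; try lia.
  rewrite circE -[in RHS](decomp_counitl x).
  apply: (tensor_ext (g := f \o evall (counit C))) => [||u v].
  - exact: pairing_linear.
  - exact: linear_comp (linearP _) (lhom_linear f).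
  rewrite pairing_tens omul_circE /= evall_tens evalb_comul_coune comul_counitl.
  by rewrite (linear_funZ _ (lhom_linear f)) (linear_funZ _ (cmul_linear _)) cmul1.
have E : tens (evalr (coune C) (cup_component n 0 x)) (1 : k^o) = tens x (1 : k^o).
  rewrite -[LHS]rE -[RHS]rE !pairing_tens -fE cup_prodE; congr (r (cmul _ _)).
  apply: (tensor_ext (f := f \o evalr (coune C)) (g := pairing (f : O n) e)) => [||u v].
  - exact: linear_comp (linearP _) (lhom_linear f).
  - exact: pairing_linear.
  rewrite pairing_tens /= evalr_tens (linear_funZ _ (lhom_linear f)).
  by rewrite (linear_funZ _ (cmul_linearr _)) cmulC cmul1.
have := congr1 (evalr (@idfun k^o : {linear k^o -> k^o})) E.
by rewrite !evalr_tens !scale1r.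
Qed.

End ChainIdentities.

(** * Homology and the Kuenneth maps *)

(** The axiom of choice for dependent families. *)
Lemma exists_family (I : Type) (T : I -> Type) (P : forall i, T i -> Prop) :
  (forall i, exists x, P i x) -> exists f : forall i, T i, forall i, P i (f i).
Proof. by move=> Px; exists (fun i => sval (cid (Px i))) => i; case: cid. Qed.

Section Factor.
Variable k : comPzRingType.
Implicit Types U V W : lmodType k.

Lemma factor_linear U V W (f : {linear U -> V}) (g : {linear U -> W}) :
  (forall v, exists u, f u = v) -> (forall u, f u = 0 -> g u = 0) ->
  exists h : {linear V -> W}, forall u, h (f u) = g u.
Proof.
move=> f_surj ker_fg; pose s v := sval (cid (f_surj v)).
have sK v : f (s v) = v by rewrite /s; case: cid.
have hE u : g (s (f u)) = g u.
  by apply/eqP; rewrite -subr_eq0 -linearB ker_fg // linearB sK subrr.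
have hL : linear (g \o s).
  by move=> a x y; rewrite /= -{1}[x]sK -{1}[y]sK -linearP hE linearP.
by exists (mk_linear hL).
Qed.

Lemma tmap_comp U U' U'' V V' V'' (f : {linear U' -> U''}) (g : {linear V' -> V''})
    (f' : {linear U -> U'}) (g' : {linear V -> V'}) t :
  tmap f g (tmap f' g' t) = tmap (f \o f') (g \o g') t.
Proof.
apply: (tensor_ext (f := tmap f g \o tmap f' g')) t => [||u v].
- exact: linear_comp (linearP _) (linearP _).
- exact: linearP.
by rewrite /= !tmap_tens.
Qed.

Lemma tmap_id U V t : tmap (@idfun U) (@idfun V) t = t.
Proof.
apply: (tensor_ext (f := tmap idfun idfun) (g := idfun)) t => // [|u v].
  exact: linearP.
by rewrite tmap_tens.
Qed.

Lemma eq_tmap U U' V V' (f f' : {linear U -> U'}) (g g' : {linear V -> V'}) :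
  f =1 f' -> g =1 g' -> tmap f g =1 tmap f' g'.
Proof. by move=> ff' gg'; apply: eq_tlift => u v; rewrite ff' gg'. Qed.

Lemma tmap_eq0l U U' V V' (f : {linear U -> U'}) (g : {linear V -> V'}) t :
  (forall u, f u = 0) -> tmap f g t = 0.
Proof. by move=> f0; apply: big1 => p _; rewrite f0 tens0l. Qed.

Lemma tmap_eq0r U U' V V' (f : {linear U -> U'}) (g : {linear V -> V'}) t :
  (forall v, g v = 0) -> tmap f g t = 0.
Proof. by move=> g0; apply: big1 => p _; rewrite g0 tens0r. Qed.

Lemma tmap_tassoc U U' V V' W W' (f : {linear U -> U'}) (g : {linear V -> V'})
    (h : {linear W -> W'}) t :
  tmap (tmap f g) h (tassoc t) = tassoc (tmap f (tmap g h) t).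
Proof.
have tL : linear (fun t : U ⊗ (V ⊗ W) => tassoc (tmap f (tmap g h) t)).
  exact: linear_comp (linearP _) (@tassoc_linear _ _ _ _).
have aL := linear_comp (@tassoc_linear k U V W) (linearP (tmap (tmap f g) h)).
apply: (tensor_ext aL tL) t => u t.
have uL : linear (tens u : V ⊗ W -> _) by exact: (tens_bilinear _ _).2.
apply: (tensor_ext (linear_comp uL aL) (linear_comp uL tL)) t => v w.
by rewrite /= (tassoc_tens u v w) !tmap_tens /= !tmap_tens tassoc_tens.
Qed.

(** Choose set-theoretic sections of f and g. Since [l] ignores changes by either kernel, l(s(u')
    (x) r(v')) is bilinear, and so [l] factors through [tmap f g]. *)
Lemma right_exact U U' V V' W (f : {linear U -> U'}) (g : {linear V -> V'})
    (l : U ⊗ V -> W) :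
  (forall u', exists u, f u = u') -> (forall v', exists v, g v = v') -> linear l ->
  (forall u v, f u = 0 -> l (tens u v) = 0) ->
  (forall u v, g v = 0 -> l (tens u v) = 0) ->
  forall t, tmap f g t = 0 -> l t = 0.
Proof.
move=> f_surj g_surj lL lf lg t t0.
pose s u := sval (cid (f_surj u)); pose r v := sval (cid (g_surj v)).
have sK u : f (s u) = u by rewrite /s; case: cid.
have rK v : g (r v) = v by rewrite /r; case: cid.
have lfE u u' v : f u = f u' -> l (tens u v) = l (tens u' v).
  move=> fuu'; apply/eqP; rewrite -subr_eq0 -(linear_funB lL).
  rewrite -(linear_funB ((tens_bilinear U V).1 v)) lf //.
  by rewrite linearB fuu' subrr.
have lgE u v v' : g v = g v' -> l (tens u v) = l (tens u v').
  move=> gvv'; apply/eqP; rewrite -subr_eq0 -(linear_funB lL).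
  rewrite -(linear_funB ((tens_bilinear U V).2 u)) lg //.
  by rewrite linearB gvv' subrr.
have bil : bilinear_map (fun u' v' => l (tens (s u') (r v'))).
  split=> [v|u] a x y.
    rewrite (@lfE _ (a *: s x + s y)); last by rewrite linearP !sK.
    by rewrite (tens_bilinear _ _).1 lL.
  rewrite (@lgE _ _ (a *: r x + r y)); last by rewrite linearP !rK.
  by rewrite (tens_bilinear _ _).2 lL.
have := congr1 (tlift (fun u' v' => l (tens (s u') (r v')))) t0.
rewrite (linear_fun0 (tlift_linear bil)) => <-; rewrite tlift_tmap //.
clear t0; apply: (tensor_ext (g := tlift (fun u v => l (tens (s (f u)) (r (g v)))))) t => //.
- by apply: tlift_linear; exact: bilinear_comp bil (linearP f) (linearP g).
move=> u v; rewrite tlift_tens; last exact: bilinear_comp bil (linearP f) (linearP g).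
by rewrite (@lfE _ (s (f u))) ?sK // (@lgE _ _ (r (g v))) ?rK.
Qed.

Lemma tmap_surj U U' V V' (f : {linear U -> U'}) (g : {linear V -> V'}) :
  (forall u', exists u, f u = u') -> (forall v', exists v, g v = v') ->
  forall t', exists t, tmap f g t = t'.
Proof.
move=> f_surj g_surj t'; rewrite [t']tensorE; elim: (repr t') => [|[u' v'] s [t tE]].
  by exists 0; rewrite linear0 big_nil.
have [[u uE] [v vE]] := (f_surj u', g_surj v').
by exists (tens u v + t); rewrite linearD /= tE tmap_tens uE vE big_cons.
Qed.

End Factor.

(** * Homogeneous parts of graded tensor products *)

Section DegreePartLemmas.
Variables (k : comPzRingType).

Section One.
Variables (I : Type) (deg : I -> nat) (U : I -> lmodType k) (n : nat).
Implicit Types x y : degree_part deg U n.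

Lemma degree_part_eq x y : (forall i, deg i = n -> x i = y i) -> x = y.
Proof.
move=> xy; apply: degree_partP => i; case: (eqVneq (deg i) n) => [/xy //|ni].
by rewrite !component_supp.
Qed.

Lemma degree_partD x y i : (x + y) i = x i + y i.
Proof. exact: (linear_funD (@proj_linear k I deg U n i)). Qed.

Lemma degree_partZ a x i : (a *: x) i = a *: x i.
Proof. exact: (linear_funZ a (@proj_linear k I deg U n i)). Qed.

Lemma degree_part0 i : (0 : degree_part deg U n) i = 0.
Proof. exact: (linear_fun0 (@proj_linear k I deg U n i)). Qed.

Lemma degree_partB x y i : (x - y) i = x i - y i.
Proof. exact: (linear_funB (@proj_linear k I deg U n i)). Qed.

Lemma degree_part_sum J r (P : pred J) (F : J -> degree_part deg U n) i :
  (\sum_(j <- r | P j) F j) i = \sum_(j <- r | P j) F j i.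
Proof. exact: (linear_fun_sum _ _ _ (@proj_linear k I deg U n i)). Qed.

End One.

(** Extension by zero. The transport along [e] does no harm, as equality proofs in an [eqType] are
    unique. *)
Definition delta (I : eqType) (U : I -> lmodType k) i (u : U i) j : U j :=
  if i =P j is ReflectT e then ecast j (U j) e u else 0.

Lemma delta_id (I : eqType) (U : I -> lmodType k) i (u : U i) : delta u i = u.
Proof. by rewrite /delta; case: eqP => // e; rewrite eq_axiomK. Qed.

Lemma delta_neq (I : eqType) (U : I -> lmodType k) i (u : U i) j :
  i != j -> delta u j = 0.
Proof. by rewrite /delta; case: eqP. Qed.

Lemma delta_map (I : eqType) (U V : I -> lmodType k) (f : forall i, U i -> V i) i
    (u : U i) j :
  f j 0 = 0 -> delta (f i u) j = f j (delta u j).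
Proof. by rewrite /delta; case: eqP => // e f0; case: _ / e f0. Qed.

Section Sum.
Variables (I : eqType) (deg : I -> nat) (U : I -> lmodType k) (n : nat).

Definition single i (u : U i) : degree_part deg U n := truncate (delta u).

Lemma single_linear i : linear (@single i).
Proof.
apply: truncate_linear => j a x y; case: (eqVneq i j) => [<-|ij].
  by rewrite !delta_id.
by rewrite !delta_neq // scaler0 addr0.
Qed.

Lemma degree_part_decomp (s : seq I) (x : degree_part deg U n) : uniq s ->
  (forall i, deg i = n -> i \in s) -> x = \sum_(i <- s) single (x i).
Proof.
move=> s_uniq s_full; apply: degree_part_eq => j jn; rewrite degree_part_sum.
rewrite (bigD1_seq j) ?s_full //= jn eqxx delta_id big1 ?addr0 // => i ij.
by rewrite delta_neq.
Qed.

Lemma degree_part_ext (s : seq I) (W : lmodType k) (f g : degree_part deg U n -> W) :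
  uniq s -> (forall i, deg i = n -> i \in s) -> linear f -> linear g ->
  (forall i u, deg i = n -> f (@single i u) = g (single u)) -> f =1 g.
Proof.
move=> s_uniq s_full fL gL fg x; rewrite (degree_part_decomp x s_uniq s_full).
rewrite !linear_fun_sum //; apply: eq_bigr => i _.
case: (eqVneq (deg i) n) => [/fg //|ni].
by rewrite component_supp // !(linear_fun0 (@single_linear i)) !linear_fun0.
Qed.

End Sum.

Definition pairs_upto n : seq (nat * nat) :=
  [seq (i, j) | i <- iota 0 n.+1, j <- iota 0 n.+1].

Lemma pairs_upto_uniq n : uniq (pairs_upto n).
Proof. by apply: allpairs_uniq; rewrite ?iota_uniq // => -[? ?] [? ?] _ _. Qed.

Lemma mem_pairs_upto n (i : nat * nat) : (i.1 + i.2 <= n)%N -> i \in pairs_upto n.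
Proof. by case: i => i j /= ijn; apply: allpairs_f; rewrite mem_iota; lia. Qed.

Definition triples_upto n : seq (nat * nat * nat) :=
  [seq (i, j) | i <- pairs_upto n, j <- iota 0 n.+1].

Lemma triples_upto_uniq n : uniq (triples_upto n).
Proof.
apply: allpairs_uniq; rewrite ?iota_uniq ?pairs_upto_uniq //.
by move=> -[? ?] [? ?] _ _.
Qed.

Lemma mem_triples_upto n (i : nat * nat * nat) :
  (i.1.1 + i.1.2 + i.2 = n)%N -> i \in triples_upto n.
Proof.
case: i => i j /= ijn; apply: allpairs_f; last by rewrite mem_iota; lia.
by apply: mem_pairs_upto; lia.
Qed.

Section Pure.
Variables A B C : nat -> lmodType k.

(** Whole families replace single elements, so that formulas for differentials hold in every
    bidegree without transport along equalities of degrees. *)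
Definition pure2 n (a : forall i, A i) (b : forall i, B i) : gtensor A B n :=
  truncate (fun i => tens (a i.1) (b i.2)).

Definition pure3 n (a : forall i, A i) (b : forall i, B i) (c : forall i, C i) :
    gtensor3 A B C n :=
  truncate (fun i => tens (tens (a i.1.1) (b i.1.2)) (c i.2)).

Lemma single_tens n i (u : A i.1) (v : B i.2) :
  (single _ n (tens u v) : gtensor A B n) = pure2 n (delta u) (delta v).
Proof.
apply: degree_part_eq => j jn; rewrite /single /pure2 !truncateE //.
case: (eqVneq i j) => [<-|]; first by rewrite !delta_id.
move=> ij; rewrite delta_neq //.
have /orP[n1|n2] : (i.1 != j.1) || (i.2 != j.2).
  by move: ij; rewrite -negb_and -xpair_eqE -!surjective_pairing.
- by rewrite [delta u _]delta_neq // tens0l.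
- by rewrite [delta v _]delta_neq // tens0r.
Qed.

Lemma single_tens3 n i (u : A i.1.1) (v : B i.1.2) (w : C i.2) :
  (single _ n (tens (tens u v) w) : gtensor3 A B C n) = pure3 n (delta u) (delta v) (delta w).
Proof.
apply: degree_part_eq => j jn; rewrite /single /pure3 !truncateE //.
case: (eqVneq i j) => [<-|]; first by rewrite !delta_id.
move=> ij; rewrite delta_neq //.
have /or3P[n1|n2|n3] : [|| i.1.1 != j.1.1, i.1.2 != j.1.2 | i.2 != j.2].
  by case: i j ij {jn u v w} => [[? ?] ?] [[? ?] ?]; rewrite !xpair_eqE !negb_and orbA.
- by rewrite [delta u _]delta_neq // !tens0l.
- by rewrite [delta v _]delta_neq // tens0r tens0l.
- by rewrite [delta w _]delta_neq // tens0r.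
Qed.

Lemma gtensor_ext n (W : lmodType k) (f g : gtensor A B n -> W) :
  linear f -> linear g ->
  (forall a b, f (pure2 n a b) = g (pure2 n a b)) -> f =1 g.
Proof.
move=> fL gL fg; apply: (degree_part_ext (pairs_upto_uniq n)) => // [i <-|i t _].
  exact: mem_pairs_upto.
have sL := @single_linear _ (fun i : nat * nat => i.1 + i.2)%N (fun i => A i.1 ⊗ B i.2) n i.
apply: (tensor_ext (linear_comp sL fL) (linear_comp sL gL)) t => u v.
by rewrite /= single_tens.
Qed.

End Pure.

End DegreePartLemmas.

(** * Maps induced on homology *)

Section InducedMaps.
Variable k : comPzRingType.
Implicit Types D E : precomplex k.

Lemma hclass_surj D n (h : homology D n) : exists z : cycles D n, hclass z = h.
Proof. by exists (repr h); exact: hclassK. Qed.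

Lemma hclass_eq0 D n (z : cycles D n) :
  hclass z = 0 <-> exists c, chain_of z = bdry D n c.
Proof.
have -> : (0 : homology_type D n) = hclass 0 by rewrite linear0.
rewrite hclassP; have -> : chain_of (0 : cycles D n) = 0 by rewrite linear0.
by rewrite subr0.
Qed.

Lemma bdry_chain_of D n (z : cycles D n.+1) : bdry D n (chain_of z) = 0.
Proof. by case: z => z /= /eqP. Qed.

Lemma factor_homology D n (W : lmodType k) (g : cycles D n -> W) : linear g ->
  (forall z c, chain_of z = bdry D n c -> g z = 0) ->
  exists h : {linear homology D n -> W}, forall z, h (hclass z) = g z.
Proof.
move=> gL g0; apply: (factor_linear (f := @hclass k D n) (g := mk_linear gL)).
- exact: hclass_surj.
- by move=> z /hclass_eq0[c cz]; apply: g0 cz.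
Qed.

Section ChainMap.
Variables (D E : precomplex k) (f : forall n, D n -> E n).
Arguments f n : clear implicits.
Hypothesis (fL : forall n, linear (f n)).
Hypothesis (f_bdry : forall n x, f n (bdry D n x) = bdry E n (f n.+1 x)).

Lemma chain_map_cycle n (z : cycles D n) : is_cycle (f n (chain_of z)).
Proof.
case: n z => [//|n] z; apply/eqP.
by rewrite /= -f_bdry bdry_chain_of (linear_fun0 (@fL _)).
Qed.

Lemma induced_exists : exists F : forall n, {linear homology D n -> homology E n},
  induced D E f F.
Proof.
pose g n (z : cycles D n) := hclass (Cycle (chain_map_cycle z)).
have gL n : linear (@g n).
  move=> a x y; rewrite /g -linearP; congr hclass; apply: val_inj.
  change (f n (chain_of (a *: x + y)) =
    chain_of (a *: Cycle (chain_map_cycle x) + Cycle (chain_map_cycle y))).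
  by rewrite (@chain_of_linear k D n) (@fL n) (@chain_of_linear k E n).
have [n z c cz|F FE] := exists_family (fun n => factor_homology (gL n) _).
  apply/hclass_eq0; exists (f n.+1 c).
  by rewrite -f_bdry -cz.
by exists F => n z; exists (Cycle (chain_map_cycle z)).
Qed.
End ChainMap.

Lemma induced_eq D E (f : forall n, D n -> E n)
    (F : forall n, {linear homology D n -> homology E n}) n (z : cycles D n) (w : cycles E n) :
  induced D E f F -> chain_of w = f n (chain_of z) -> F n (hclass z) = hclass w.
Proof.
by move=> FP wE; have [w' w'E ->] := FP n z; congr hclass; apply: val_inj; rewrite /= w'E.
Qed.

End InducedMaps.

Section GradedMaps.
Variable k : comPzRingType.
Implicit Types A B C : nat -> lmodType k.

Lemma gmap2E A A' B B' (f : forall n, {linear A n -> A' n})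
    (g : forall n, {linear B n -> B' n}) n (x : gtensor A B n) i :
  (i.1 + i.2)%N = n -> gmap2 f g x i = tmap (f i.1) (g i.2) (x i).
Proof. by move=> ni; rewrite /gmap2 truncateE. Qed.

Lemma gmap3E A A' B B' C C' (f : forall n, {linear A n -> A' n})
    (g : forall n, {linear B n -> B' n}) (h : forall n, {linear C n -> C' n})
    n (x : gtensor3 A B C n) i : (i.1.1 + i.1.2 + i.2)%N = n ->
  gmap3 f g h x i = tmap (tmap (f i.1.1) (g i.1.2)) (h i.2) (x i).
Proof. by move=> ni; rewrite /gmap3 truncateE. Qed.

Lemma gmap2_linear A A' B B' (f : forall n, {linear A n -> A' n})
    (g : forall n, {linear B n -> B' n}) n : linear (@gmap2 k A A' B B' f g n).
Proof.
apply: truncate_linear => i a x y.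
by rewrite degree_partD degree_partZ linearP.
Qed.

Lemma gmap3_linear A A' B B' C C' (f : forall n, {linear A n -> A' n})
    (g : forall n, {linear B n -> B' n}) (h : forall n, {linear C n -> C' n}) n :
  linear (@gmap3 k A A' B B' C C' f g h n).
Proof.
apply: truncate_linear => i a x y.
by rewrite degree_partD degree_partZ linearP.
Qed.

Lemma gmap2_pure A A' B B' (f : forall n, {linear A n -> A' n})
    (g : forall n, {linear B n -> B' n}) n a b :
  gmap2 f g (pure2 n a b) = pure2 n (fun i => f i (a i)) (fun i => g i (b i)).
Proof.
by apply: degree_part_eq => i ni; rewrite gmap2E // !truncateE // tmap_tens.
Qed.

Lemma gmap3_pure A A' B B' C C' (f : forall n, {linear A n -> A' n})
    (g : forall n, {linear B n -> B' n}) (h : forall n, {linear C n -> C' n}) n a b c :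
  gmap3 f g h (pure3 n a b c) =
  pure3 n (fun i => f i (a i)) (fun i => g i (b i)) (fun i => h i (c i)).
Proof.
by apply: degree_part_eq => i ni; rewrite gmap3E // !truncateE // tmap_tens /= tmap_tens.
Qed.

Lemma gmap2_comp A A' A'' B B' B''
    (f : forall n, {linear A' n -> A'' n}) (g : forall n, {linear B' n -> B'' n})
    (f' : forall n, {linear A n -> A' n}) (g' : forall n, {linear B n -> B' n})
    (f'' : forall n, {linear A n -> A'' n}) (g'' : forall n, {linear B n -> B'' n})
    n (x : gtensor A B n) :
  (forall n u, f'' n u = f n (f' n u)) -> (forall n u, g'' n u = g n (g' n u)) ->
  gmap2 f g (gmap2 f' g' x) = gmap2 f'' g'' x.
Proof.
move=> fE gE; apply: degree_part_eq => i ni; rewrite !gmap2E // tmap_comp.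
by apply: eq_tmap => u /=; rewrite (fE, gE).
Qed.

Lemma gmap2_surj A A' B B' (f : forall n, {linear A n -> A' n})
    (g : forall n, {linear B n -> B' n}) n :
  (forall i y, exists x, f i x = y) -> (forall i y, exists x, g i x = y) ->
  forall y, exists x : gtensor A B n, gmap2 f g x = y.
Proof.
move=> fS gS y; have [x xE] := exists_family (fun i : nat * nat =>
  tmap_surj (fS i.1) (gS i.2) (y i)).
by exists (truncate x); apply: degree_part_eq => i ni; rewrite gmap2E // truncateE // xE.
Qed.

Lemma gmap3_surj A A' B B' C C' (f : forall n, {linear A n -> A' n})
    (g : forall n, {linear B n -> B' n}) (h : forall n, {linear C n -> C' n}) n :
  (forall i y, exists x, f i x = y) -> (forall i y, exists x, g i x = y) ->
  (forall i y, exists x, h i x = y) ->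
  forall y, exists x : gtensor3 A B C n, gmap3 f g h x = y.
Proof.
move=> fS gS hS y; have [x xE] := exists_family (fun i : nat * nat * nat =>
  tmap_surj (tmap_surj (fS i.1.1) (gS i.1.2)) (hS i.2) (y i)).
by exists (truncate x); apply: degree_part_eq => i ni; rewrite gmap3E // truncateE // xE.
Qed.

(** Reindexes chains of degree i + 1 as an ordinary family; it serves to write bounding chains. *)
Definition shift A (c : forall i, A i.+1) i : A i :=
  match i with 0 => 0 | m.+1 => c m end.

Definition alternate A (a : forall i, A i) i : A i := (-1) ^+ i *: a i.

Lemma signK (V : lmodType k) n (x : V) : (-1) ^+ n *: ((-1) ^+ n *: x) = x.
Proof. by rewrite scalerA -exprD addnn -signr_odd odd_double expr0 scale1r. Qed.

End GradedMaps.

(** * Existence of the Kuenneth maps over a commutative ring *)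

Section Kunneth.
Variables (k : comPzRingType) (A B C : precomplex k).

Lemma tensor_bdryE n (x : gtensor A B n.+1) i : (i.1 + i.2)%N = n ->
  tensor_bdry x i = tmap (bdry A i.1) idfun (x (i.1.+1, i.2))
    + (-1) ^+ i.1 *: tmap idfun (bdry B i.2) (x (i.1, i.2.+1)).
Proof. by move=> ni; rewrite /tensor_bdry truncateE. Qed.

Lemma tensor3_bdryE n (x : gtensor3 A B C n.+1) i : (i.1.1 + i.1.2 + i.2)%N = n ->
  tensor3_bdry x i =
    tmap (tmap (bdry A i.1.1) idfun) idfun (x (i.1.1.+1, i.1.2, i.2))
    + (-1) ^+ i.1.1 *: tmap (tmap idfun (bdry B i.1.2)) idfun (x (i.1.1, i.1.2.+1, i.2))
    + (-1) ^+ (i.1.1 + i.1.2)%N *: tmap idfun (bdry C i.2) (x (i.1.1, i.1.2, i.2.+1)).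
Proof. by move=> ni; rewrite /tensor3_bdry truncateE. Qed.

Lemma tensor_bdry_shiftl n (a : forall i, A i.+1) (b : forall i, B i) :
  (forall i, bdry B i (b i.+1) = 0) ->
  tensor_bdry (pure2 n.+1 (shift a) b) = pure2 n (fun i => bdry A i (a i)) b.
Proof.
move=> b0; apply: degree_part_eq => i ni; rewrite tensor_bdryE // !truncateE //=; try lia.
by rewrite !tmap_tens /= b0 tens0r scaler0 addr0.
Qed.

(** The signs of [alternate] cancel the Koszul signs picked up when the differential passes a. *)
Lemma tensor_bdry_shiftr n (a : forall i, A i) (b : forall i, B i.+1) :
  (forall i, bdry A i (a i.+1) = 0) ->
  tensor_bdry (pure2 n.+1 (alternate a) (shift b)) = pure2 n a (fun i => bdry B i (b i)).
Proof.
move=> a0; apply: degree_part_eq => i ni; rewrite tensor_bdryE // !truncateE //=; try lia.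
rewrite !tmap_tens /= /alternate linearZ /= a0 scaler0 tens0l add0r.
by rewrite (linear_funZ _ ((tens_bilinear _ _).1 _)) signK.
Qed.

Lemma tensor3_bdry_shift1 n (a : forall i, A i.+1) (b : forall i, B i) (c : forall i, C i) :
  (forall i, bdry B i (b i.+1) = 0) -> (forall i, bdry C i (c i.+1) = 0) ->
  tensor3_bdry (pure3 n.+1 (shift a) b c) = pure3 n (fun i => bdry A i (a i)) b c.
Proof.
move=> b0 c0; apply: degree_part_eq => i ni; rewrite tensor3_bdryE // !truncateE //=; try lia.
by rewrite !tmap_tens /= !tmap_tens b0 c0 !tens0r !tens0l !scaler0 !addr0.
Qed.

Lemma tensor3_bdry_shift2 n (a : forall i, A i) (b : forall i, B i.+1) (c : forall i, C i) :
  (forall i, bdry A i (a i.+1) = 0) -> (forall i, bdry C i (c i.+1) = 0) ->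
  tensor3_bdry (pure3 n.+1 (alternate a) (shift b) c) =
  pure3 n a (fun i => bdry B i (b i)) c.
Proof.
move=> a0 c0; apply: degree_part_eq => i ni; rewrite tensor3_bdryE // !truncateE //=; try lia.
rewrite !tmap_tens /= !tmap_tens /= /alternate linearZ /= a0 c0 scaler0.
rewrite !tens0l tens0r !scaler0 add0r addr0.
rewrite (linear_funZ _ ((tens_bilinear _ _).1 _)).
by rewrite (linear_funZ _ ((tens_bilinear _ _).1 _)) signK.
Qed.

Lemma tensor3_bdry_shift3 n (a : forall i, A i) (b : forall i, B i) (c : forall i, C i.+1) :
  (forall i, bdry A i (a i.+1) = 0) -> (forall i, bdry B i (b i.+1) = 0) ->
  tensor3_bdry (pure3 n.+1 (alternate a) (alternate b) (shift c)) =
  pure3 n a b (fun i => bdry C i (c i)).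
Proof.
move=> a0 b0; apply: degree_part_eq => i ni; rewrite tensor3_bdryE // !truncateE //=; try lia.
rewrite !tmap_tens /= !tmap_tens /= /alternate !linearZ /= a0 b0 !scaler0.
rewrite !(tens0l, tens0r) !scaler0 !add0r.
rewrite (linear_funZ _ ((tens_bilinear (A _) _).1 _)).
rewrite (linear_funZ _ ((tens_bilinear (A _) _).2 _)).
rewrite !(linear_funZ _ ((tens_bilinear _ (C _)).1 _)) exprD mulrC -scalerA.
by rewrite signK signK.
Qed.

Lemma delta_boundary (D : precomplex k) i (z : cycles D i) c j :
  chain_of z = bdry D i c ->
  chain_of (delta z j) = bdry D j (delta (U := fun i => D i.+1) c j).
Proof.
move=> zE.
rewrite -(@delta_map k _ _ _ (fun j => @chain_of k D j)); last by rewrite linear0.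
rewrite zE (@delta_map k _ _ _ (fun j => bdry D j)) //.
by rewrite linear0.
Qed.

Lemma gmap2_cycle n (x : gtensor (cycles A) (cycles B) n) :
  is_cycle (D := tensor_complex A B)
    (gmap2 (@chain_of k A) (@chain_of k B) x : tensor_complex A B n).
Proof.
case: n x => [//|n] x; apply/eqP/degree_part_eq => i ni.
rewrite degree_part0 tensor_bdryE // !gmap2E //=; try lia.
rewrite !tmap_comp tmap_eq0l ?tmap_eq0r ?scaler0 ?addr0 // => z;
  exact: bdry_chain_of.
Qed.

Lemma gmap3_cycle n (x : gtensor3 (cycles A) (cycles B) (cycles C) n) :
  is_cycle (D := tensor3_complex A B C)
    (gmap3 (@chain_of k A) (@chain_of k B) (@chain_of k C) x : tensor3_complex A B C n).
Proof.
case: n x => [//|n] x; apply/eqP/degree_part_eq => i ni.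
rewrite degree_part0 tensor3_bdryE // !gmap3E //=; try lia.
rewrite !tmap_comp /= [X in X + _ + _]tmap_eq0l; last first.
  by move=> z; rewrite /= tmap_comp tmap_eq0l // => w; exact: bdry_chain_of.
rewrite [X in _ + _ *: X + _]tmap_eq0l; last first.
  by move=> z; rewrite /= tmap_comp tmap_eq0r // => w; exact: bdry_chain_of.
rewrite tmap_eq0r ?scaler0 ?addr0 // => z; exact: bdry_chain_of.
Qed.

Definition kunneth2_class n (x : gtensor (cycles A) (cycles B) n) :
    homology (tensor_complex A B) n :=
  hclass (Cycle (gmap2_cycle x)).

Definition kunneth3_class n (x : gtensor3 (cycles A) (cycles B) (cycles C) n) :
    homology (tensor3_complex A B C) n :=
  hclass (Cycle (gmap3_cycle x)).

Lemma hclass_cycle_linear (D : precomplex k) (V : lmodType k) n (f : V -> D n)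
    (fP : forall v, is_cycle (f v)) :
  linear f -> linear (fun v => hclass (Cycle (fP v)) : homology D n).
Proof.
move=> fL a x y; rewrite -linearP; congr hclass; apply: val_inj.
change (f (a *: x + y) = chain_of (a *: Cycle (fP x) + Cycle (fP y))).
by rewrite fL (@chain_of_linear k D n).
Qed.

Lemma kunneth2_class_linear n : linear (@kunneth2_class n).
Proof.
exact: (hclass_cycle_linear (D := tensor_complex A B) _
  (@gmap2_linear _ _ _ _ _ _ _ n)).
Qed.

Lemma kunneth3_class_linear n : linear (@kunneth3_class n).
Proof.
exact: (hclass_cycle_linear (D := tensor3_complex A B C) _
  (@gmap3_linear _ _ _ _ _ _ _ _ _ _ n)).
Qed.

(** In a single bidegree, [right_exact] reduces the claim to tensors of cycles one of which is a
    boundary. Such a tensor bounds the one in which that factor is replaced by a chain it bounds. *)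
Lemma kunneth2_class_eq0 n x :
  gmap2 (@hclass k A) (@hclass k B) x = 0 -> @kunneth2_class n x = 0.
Proof.
move=> x0; rewrite (degree_part_decomp x (pairs_upto_uniq n)); last first.
  by move=> i <-; exact: mem_pairs_upto.
rewrite (linear_fun_sum _ _ _ (@kunneth2_class_linear n)) big1 // => i _.
have sL := linear_comp (@single_linear k _ (fun i : nat * nat => i.1 + i.2)%N
  (fun i => (cycles A i.1 : lmodType k) ⊗ (cycles B i.2 : lmodType k)) n i)
  (@kunneth2_class_linear n).
case: (eqVneq (i.1 + i.2)%N n) => [ni|ni]; last first.
  by rewrite component_supp //; exact: (linear_fun0 sL).
apply: (right_exact (f := @hclass k A i.1) (g := @hclass k B i.2) _ _ sL).
- exact: hclass_surj.
- exact: hclass_surj.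
- move=> u v /hclass_eq0[c uE]; rewrite /= single_tens; apply/hclass_eq0.
  exists (pure2 n.+1 (shift (fun j => delta (U := fun i => A i.+1) c j))
    (fun j => chain_of (delta v j))).
  rewrite /= gmap2_pure tensor_bdry_shiftl => [|j]; last exact: bdry_chain_of.
  by apply: degree_part_eq => j nj; rewrite !truncateE // -(delta_boundary _ uE).
- move=> u v /hclass_eq0[c vE]; rewrite /= single_tens; apply/hclass_eq0.
  exists (pure2 n.+1 (alternate (fun j => chain_of (delta u j)))
    (shift (fun j => delta (U := fun i => B i.+1) c j))).
  rewrite /= gmap2_pure tensor_bdry_shiftr => [|j]; last exact: bdry_chain_of.
  by apply: degree_part_eq => j nj; rewrite !truncateE // -(delta_boundary _ vE).
by have := congr1 (fun y : gtensor _ _ n => y i) x0; rewrite gmap2E // degree_part0.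
Qed.

Lemma kunneth3_class_eq0 n x :
  gmap3 (@hclass k A) (@hclass k B) (@hclass k C) x = 0 -> @kunneth3_class n x = 0.
Proof.
move=> x0; rewrite (degree_part_decomp x (triples_upto_uniq n)); last first.
  by move=> i <-; exact: mem_triples_upto.
rewrite (linear_fun_sum _ _ _ (@kunneth3_class_linear n)) big1 // => i _.
have sL := linear_comp (@single_linear k _ (fun i : nat * nat * nat => i.1.1 + i.1.2 + i.2)%N
  (fun i => (cycles A i.1.1 : lmodType k) ⊗ (cycles B i.1.2 : lmodType k)
    ⊗ (cycles C i.2 : lmodType k)) n i)
  (@kunneth3_class_linear n).
case: (eqVneq (i.1.1 + i.1.2 + i.2)%N n) => [ni|ni]; last first.
  by rewrite component_supp //; exact: (linear_fun0 sL).
apply: (right_exact (f := tmap (@hclass k A i.1.1) (@hclass k B i.1.2))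
  (g := @hclass k C i.2) _ _ sL).
- by apply: tmap_surj; exact: hclass_surj.
- exact: hclass_surj.
- move=> t w.
  have wL := (tens_bilinear ((cycles A i.1.1 : lmodType k) ⊗ (cycles B i.1.2 : lmodType k))
    (cycles C i.2)).1 w.
  apply: (right_exact (f := @hclass k A i.1.1) (g := @hclass k B i.1.2) _ _ (linear_comp wL sL)).
  + exact: hclass_surj.
  + exact: hclass_surj.
  + move=> u v /hclass_eq0[c uE]; rewrite /= single_tens3; apply/hclass_eq0.
    exists (pure3 n.+1 (shift (fun j => delta (U := fun i => A i.+1) c j))
      (fun j => chain_of (delta v j)) (fun j => chain_of (delta w j))).
    rewrite /= gmap3_pure tensor3_bdry_shift1; try by move=> j; exact: bdry_chain_of.
    by apply: degree_part_eq => j nj; rewrite !truncateE // -(delta_boundary _ uE).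
  + move=> u v /hclass_eq0[c vE]; rewrite /= single_tens3; apply/hclass_eq0.
    exists (pure3 n.+1 (alternate (fun j => chain_of (delta u j)))
      (shift (fun j => delta (U := fun i => B i.+1) c j)) (fun j => chain_of (delta w j))).
    rewrite /= gmap3_pure tensor3_bdry_shift2; try by move=> j; exact: bdry_chain_of.
    by apply: degree_part_eq => j nj; rewrite !truncateE // -(delta_boundary _ vE).
- move=> t w /hclass_eq0[c wE].
  have wL := (tens_bilinear ((cycles A i.1.1 : lmodType k) ⊗ (cycles B i.1.2 : lmodType k))
    (cycles C i.2)).1 w.
  apply: (tensor_ext (linear_comp wL sL) (g := fun=> 0)) t => [a x' y'|u v].
    by rewrite scaler0 addr0.
  rewrite /= single_tens3; apply/hclass_eq0.
  exists (pure3 n.+1 (alternate (fun j => chain_of (delta u j)))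
    (alternate (fun j => chain_of (delta v j)))
    (shift (fun j => delta (U := fun i => C i.+1) c j))).
  rewrite /= gmap3_pure tensor3_bdry_shift3; try by move=> j; exact: bdry_chain_of.
  by apply: degree_part_eq => j nj; rewrite !truncateE // -(delta_boundary _ wE).
by have := congr1 (fun y : gtensor3 _ _ _ n => y i) x0; rewrite gmap3E // degree_part0.
Qed.

Lemma kunneth2_exists : exists K, kunneth_map2 A B K.
Proof.
have K_ex n := factor_linear
  (f := mk_linear (@gmap2_linear k _ _ _ _ (@hclass k A) (@hclass k B) n))
  (g := mk_linear (@kunneth2_class_linear n))
  (gmap2_surj (hclass_surj (D := A)) (hclass_surj (D := B))) (@kunneth2_class_eq0 n).
have [K KE] := exists_family K_ex.
by exists K => n x; exists (Cycle (gmap2_cycle x)); last exact: (KE n x).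
Qed.

Lemma kunneth3_exists : exists K, kunneth_map3 A B C K.
Proof.
have K_ex n := factor_linear
  (f := mk_linear (@gmap3_linear k _ _ _ _ _ _ (@hclass k A) (@hclass k B) (@hclass k C) n))
  (g := mk_linear (@kunneth3_class_linear n))
  (gmap3_surj (hclass_surj (D := A)) (hclass_surj (D := B)) (hclass_surj (D := C)))
  (@kunneth3_class_eq0 n).
have [K KE] := exists_family K_ex.
by exists K => n x; exists (Cycle (gmap3_cycle x)); last exact: (KE n x).
Qed.

Lemma kunneth2_eq K n x (w : cycles (tensor_complex A B) n) :
  kunneth_map2 A B K -> chain_of w = gmap2 (@chain_of k A) (@chain_of k B) x ->
  K n (gmap2 (@hclass k A) (@hclass k B) x) = hclass w.
Proof.
by move=> KP wE; have [w' w'E ->] := KP n x; congr hclass; apply: val_inj; rewrite /= w'E.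
Qed.

Lemma kunneth3_eq K n x (w : cycles (tensor3_complex A B C) n) :
  kunneth_map3 A B C K ->
  chain_of w = gmap3 (@chain_of k A) (@chain_of k B) (@chain_of k C) x ->
  K n (gmap3 (@hclass k A) (@hclass k B) (@hclass k C) x) = hclass w.
Proof.
by move=> KP wE; have [w' w'E ->] := KP n x; congr hclass; apply: val_inj; rewrite /= w'E.
Qed.

End Kunneth.

(** * Chain maps *)

Section Twist.
Variables (k : comPzRingType).

Lemma tswap_tmap (U U' V V' : lmodType k) (f : {linear U -> U'}) (g : {linear V -> V'}) t :
  tswap (tmap f g t) = tmap g f (tswap t).
Proof.
apply: (tensor_ext (f := @tswap k _ _ \o tmap f g) (g := tmap g f \o @tswap k _ _)) t => [||u v].
- exact: linear_comp (linearP _) (linearP _).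
- exact: linear_comp (linearP _) (linearP _).
by rewrite /= tmap_tens !tswap_tens tmap_tens.
Qed.

Lemma gtwistE (A B : nat -> lmodType k) n (x : gtensor A B n) i : (i.1 + i.2)%N = n ->
  gtwist x i = (-1) ^+ (i.1 * i.2) *: tswap (x (i.2, i.1)).
Proof. by move=> ni; rewrite /gtwist truncateE. Qed.

Lemma gtwist_linear (A B : nat -> lmodType k) n : linear (@gtwist k A B n).
Proof.
apply: truncate_linear => i a x y.
by rewrite degree_partD degree_partZ linearP scalerDr !scalerA mulrC.
Qed.

Lemma gtwist_gmap2 (A A' B B' : nat -> lmodType k) (f : forall n, {linear A n -> A' n})
    (g : forall n, {linear B n -> B' n}) n (x : gtensor A B n) :
  gtwist (gmap2 f g x) = gmap2 g f (gtwist x).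
Proof.
apply: degree_part_eq => i ni; rewrite gmap2E // !gtwistE // gmap2E //=; last lia.
by rewrite tswap_tmap linearZ.
Qed.

Lemma gtwist_bdry (A B : precomplex k) n (x : gtensor A B n.+1) :
  gtwist (tensor_bdry x) = tensor_bdry (gtwist x).
Proof.
apply: degree_part_eq => i ni; rewrite gtwistE // !tensor_bdryE // ?gtwistE; try by rewrite /=; lia.
rewrite /=.
rewrite linearD linearZ /= !tswap_tmap scalerDr scalerA -exprD !linearZ /= scalerA -exprD.
rewrite addrC; congr (_ + _); apply: sign_eq; rewrite !(oddD, oddM, oddS) /=;
  by case: odd; case: odd.
Qed.

End Twist.

Section CoproductMaps.
Variables (k : comPzRingType) (A : nat -> lmodType k).
Variable D : forall n, {linear A n -> gtensor A A n}.
Arguments D n : clear implicits.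

Lemma coprod_lE n (x : gtensor A A n) i : (i.1.1 + i.1.2 + i.2)%N = n ->
  coprod_l D x i = tmap (proj (i.1.1, i.1.2) \o D (i.1.1 + i.1.2)%N) idfun
      (x ((i.1.1 + i.1.2)%N, i.2)).
Proof. by move=> ni; rewrite /coprod_l truncateE. Qed.

Lemma coprod_rE n (x : gtensor A A n) i : (i.1.1 + i.1.2 + i.2)%N = n ->
  coprod_r D x i = tassoc (tmap idfun (proj (i.1.2, i.2) \o D (i.1.2 + i.2)%N)
      (x (i.1.1, (i.1.2 + i.2)%N))).
Proof. by move=> ni; rewrite /coprod_r truncateE. Qed.

Lemma coprod_l_linear n : linear (@coprod_l k A D n).
Proof.
apply: truncate_linear => i a x y.
by rewrite degree_partD degree_partZ linearP.
Qed.

Lemma coprod_r_linear n : linear (@coprod_r k A D n).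
Proof.
apply: truncate_linear => i a x y.
by rewrite degree_partD degree_partZ linearP (@tassoc_linear k).
Qed.

End CoproductMaps.

Section Coproduct.
Variables (k : comPzRingType) (A : precomplex k).
Variable D : forall n, {linear A n -> gtensor A A n}.
Arguments D n : clear implicits.

Hypothesis D_bdry : forall n (x : A n.+1), D n (bdry A n x) = tensor_bdry (D n.+1 x).

Let P_linear p q n : linear (fun x : A n => D n x (p, q) : A p ⊗ A q).
Proof. by move=> a x y; rewrite linearP degree_partD degree_partZ. Qed.

Let P p q n : {linear A n -> A p ⊗ A q} := mk_linear (@P_linear p q n).

Let P_bdry p q n (x : A n.+1) : (p + q)%N = n ->
  P p q n (bdry A n x) = tmap (bdry A p) idfun (P p.+1 q n.+1 x)
    + (-1) ^+ p *: tmap idfun (bdry A q) (P p q.+1 n.+1 x).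
Proof. by move=> npq; rewrite /= D_bdry tensor_bdryE. Qed.

Let coprod_lP n (x : gtensor A A n) p q r : (p + q + r)%N = n ->
  coprod_l D x (p, q, r) = tmap (P p q (p + q)%N) idfun (x ((p + q)%N, r)).
Proof. by move=> ni; rewrite coprod_lE. Qed.

Let coprod_rP n (x : gtensor A A n) p q r : (p + q + r)%N = n ->
  coprod_r D x (p, q, r) =
  tassoc (tmap idfun (P q r (q + r)%N) (x (p, (q + r)%N))).
Proof. by move=> ni; rewrite coprod_rE. Qed.

(** Applying [D] to the differential of the left factor, [D_bdry] splits it into the first two of
    the three terms of [tensor3_bdry]. *)
Lemma coprod_l_bdry n (x : gtensor A A n.+1) :
  coprod_l D (tensor_bdry x : gtensor A A n) =
  tensor3_bdry (coprod_l D x : gtensor3 A A A n.+1).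
Proof.
apply: degree_part_eq => -[[p q] r] npqr.
rewrite coprod_lP // tensor3_bdryE // !coprod_lP; try by move: npqr => /=; lia.
rewrite tensor_bdryE //= addnS linearD linearZ /=; congr (_ + _); last first.
  by congr (_ *: _); rewrite !tmap_comp; exact: eq_tmap.
rewrite !tmap_comp; move: (x _) => t.
pose l1 : {linear A (p + q).+1 ⊗ A r -> A p ⊗ A q ⊗ A r} :=
  tmap (P p q (p + q)%N \o bdry A (p + q)%N) (idfun \o idfun : {linear A r -> A r}).
pose l2 : {linear A (p + q).+1 ⊗ A r -> A p ⊗ A q ⊗ A r} :=
  tmap (tmap (bdry A p) idfun \o P p.+1 q (p + q).+1) (idfun \o idfun : {linear A r -> A r}).
pose l3 : {linear A (p + q).+1 ⊗ A r -> A p ⊗ A q ⊗ A r} :=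
  tmap (tmap idfun (bdry A q) \o P p q.+1 (p + q).+1) (idfun \o idfun : {linear A r -> A r}).
apply: (tensor_ext (f := l1) (g := fun t => l2 t + (-1) ^+ p *: l3 t)) t => [||u v].
- exact: linearP.
- by move=> a y z; rewrite !linearP /= !scalerDr !scalerA [a * _]mulrC addrACA.
rewrite /l1 /l2 /l3 /= !tmap_tens /=.
have /= -> := P_bdry u (erefl (p + q)%N); rewrite (linear_funD ((tens_bilinear _ _).1 _)).
by rewrite (linear_funZ _ ((tens_bilinear _ _).1 _)).
Qed.

Lemma coprod_r_bdry n (x : gtensor A A n.+1) :
  coprod_r D (tensor_bdry x : gtensor A A n) =
  tensor3_bdry (coprod_r D x : gtensor3 A A A n.+1).
Proof.
apply: degree_part_eq => -[[p q] r] npqr.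
rewrite coprod_rP // tensor3_bdryE // !coprod_rP; try by move: npqr => /=; lia.
rewrite tensor_bdryE /=; last by move: npqr => /=; lia.
rewrite addnS !tmap_tassoc linearD linearZ /= !tmap_comp /=.
rewrite (linear_funD (@tassoc_linear k _ _ _)) (linear_funZ _ (@tassoc_linear k _ _ _)) -addrA.
congr (_ + _).
  congr tassoc; apply: eq_tmap => // v.
  by rewrite /= tmap_id.
rewrite exprD -scalerA -scalerDr; congr (_ *: _).
have id_tassoc (t : A p ⊗ (A q ⊗ A r.+1)) : tmap idfun (bdry A r) (tassoc t) =
    tassoc (tmap idfun (tmap idfun (bdry A r)) t).
  by rewrite -tmap_tassoc; apply: eq_tmap => // y; rewrite /= tmap_id.
rewrite id_tassoc !tmap_comp /= -(linear_funZ _ (@tassoc_linear k _ _ _)).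
rewrite -(linear_funD (@tassoc_linear k _ _ _)); congr tassoc.
move: (x _) => t.
pose l1 : {linear A p ⊗ A (q + r).+1 -> A p ⊗ (A q ⊗ A r)} :=
  tmap (idfun \o idfun : {linear A p -> A p}) (P q r (q + r)%N \o bdry A (q + r)%N).
pose l2 : {linear A p ⊗ A (q + r).+1 -> A p ⊗ (A q ⊗ A r)} :=
  tmap (idfun \o idfun : {linear A p -> A p}) (tmap (bdry A q) idfun \o P q.+1 r (q + r).+1).
pose l3 : {linear A p ⊗ A (q + r).+1 -> A p ⊗ (A q ⊗ A r)} :=
  tmap (idfun \o idfun : {linear A p -> A p}) (tmap idfun (bdry A r) \o P q r.+1 (q + r).+1).
apply: (tensor_ext (f := l1) (g := fun t => l2 t + (-1) ^+ q *: l3 t)) t => [||u v].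
- exact: linearP.
- by move=> a y z; rewrite !linearP /= !scalerDr !scalerA [a * _]mulrC addrACA.
rewrite /l1 /l2 /l3 /= !tmap_tens /=.
have /= -> := P_bdry v (erefl (q + r)%N); rewrite (linear_funD ((tens_bilinear _ _).2 _)).
by rewrite (linear_funZ _ ((tens_bilinear _ _).2 _)).
Qed.

Lemma coprod_induced : exists lH rH : forall n,
    {linear homology (tensor_complex A A) n -> homology (tensor3_complex A A A) n},
  induced (tensor_complex A A) (tensor3_complex A A A) (coprod_l D) lH /\
  induced (tensor_complex A A) (tensor3_complex A A A) (coprod_r D) rH.
Proof.
have [lH lP] := @induced_exists k (tensor_complex A A) (tensor3_complex A A A)
  (coprod_l D) (@coprod_l_linear k A D) coprod_l_bdry.
have [rH rP] := @induced_exists k (tensor_complex A A) (tensor3_complex A A A)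
  (coprod_r D) (@coprod_r_linear k A D) coprod_r_bdry.
by exists lH, rH.
Qed.

End Coproduct.

Section Counit.
Variables (k : comPzRingType) (A : precomplex k) (e : {linear A 0%N -> k^o}).
Hypothesis e_bdry : forall x, e (bdry A 0 x) = 0.

Lemma evall0 (U V : lmodType k) (f : {linear U -> k^o}) (t : U ⊗ V) :
  (forall u, f u = 0) -> evall f t = 0.
Proof. by move=> f0; apply: big1 => p _; rewrite f0 scale0r. Qed.

Lemma evalr0 (U V : lmodType k) (f : {linear V -> k^o}) (t : U ⊗ V) :
  (forall u, f u = 0) -> evalr f t = 0.
Proof. by move=> f0; apply: big1 => p _; rewrite f0 scale0r. Qed.

Lemma counit_l_linear n : linear (@counit_l k A e n).
Proof. by move=> a x y; rewrite /counit_l degree_partD degree_partZ linearP. Qed.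

Lemma counit_r_linear n : linear (@counit_r k A e n).
Proof. by move=> a x y; rewrite /counit_r degree_partD degree_partZ linearP. Qed.

Lemma counit_l_bdry n (x : gtensor A A n.+1) :
  counit_l e (tensor_bdry x : gtensor A A n) = bdry A n (counit_l e x).
Proof.
rewrite /counit_l tensor_bdryE // linearD /= expr0 scale1r (evall_tmapE (f' := e)) //.
rewrite (evall_tmapE (f' := e \o bdry A 0)) // evall0 ?add0r // => u; exact: e_bdry.
Qed.

Lemma counit_r_bdry n (x : gtensor A A n.+1) :
  counit_r e (tensor_bdry x : gtensor A A n) = bdry A n (counit_r e x).
Proof.
rewrite /counit_r tensor_bdryE ?addn0 // linearD linearZ /= (evalr_tmapE (f' := e)) //.
rewrite (evalr_tmapE (f' := e \o bdry A 0)) // [X in _ *: X]evalr0 ?scaler0 ?addr0 //.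
Qed.

Lemma counit_induced : exists lH rH : forall n,
    {linear homology (tensor_complex A A) n -> homology A n},
  induced (tensor_complex A A) A (counit_l e) lH /\
  induced (tensor_complex A A) A (counit_r e) rH.
Proof.
have [lH lP] := @induced_exists k (tensor_complex A A) A
  (counit_l e) counit_l_linear counit_l_bdry.
have [rH rP] := @induced_exists k (tensor_complex A A) A
  (counit_r e) counit_r_linear counit_r_bdry.
by exists lH, rH.
Qed.

End Counit.

(** * The cup coproduct on chains and its twist *)

Section Cup.
Variables (k : comPzRingType) (C : mcooperad k).
Let CC := coop_complex C.

Lemma cupE n (x : C n) i : (i.1 + i.2)%N = n -> cup x i = cup_component i.1 i.2 x.
Proof. by move=> ni; rewrite /cup truncateE. Qed.

Lemma cup_bdry n (x : C n.+1) : cup (coop_bdry x) = tensor_bdry (cup x : gtensor CC CC n.+1).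
Proof.
apply: degree_part_eq => i ni; rewrite (tensor_bdryE (A := CC) (B := CC)) //.
rewrite !cupE //; try by rewrite /=; lia.
by rewrite cup_component_bdry.
Qed.

Lemma cup_coassoc n (x : C n) :
  coprod_l (@cup k C) (cup x) = coprod_r (@cup k C) (cup x).
Proof.
apply: degree_part_eq => -[[p q] r] npqr.
rewrite (@coprod_lE k CC (@cup k C)) // (@coprod_rE k CC (@cup k C)) //.
rewrite !cupE //; try by move: npqr => /=; lia.
have := cup_component_coassoc x (erefl (p + q)%N) (erefl (q + r)%N) (esym npqr).
have cupP a b m (y : C m) : (a + b)%N = m -> (cup y : gtensor C C m) (a, b) = cup_component a b y.
  by move=> abm; exact: (@cupE m y (a, b) abm).
move=> E; transitivity (tmap (mk_linear (@cup_component_linear k C (p + q) p q)) idfun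
    (cup_component (p + q) r x)).
  by apply: eq_tmap => // y; exact: cupP.
rewrite E; congr tassoc; apply: eq_tmap => // y; symmetry; exact: cupP.
Qed.

(** The chain homotopy between cup coproduct and twisted cup coproduct. The sign turns the
    coefficients of [cup_component_swap] into the Koszul signs of the tensor complex. *)
Definition brace_coproduct n (x : C n) : gtensor C C n.+1 :=
  truncate (fun i => (-1) ^+ (i.1.+1 * i.2) *: brace_component i.1 i.2 x).

Lemma gtwist_cup n (x : C n.+1) :
  gtwist (cup x) - cup x =
    tensor_bdry (brace_coproduct x : gtensor CC CC n.+2) + brace_coproduct (coop_bdry x).
Proof.
apply: degree_part_eq => i ni; rewrite degree_partB degree_partD.
rewrite gtwistE // (tensor_bdryE (A := CC) (B := CC)) // !cupE //; last by rewrite /=; lia.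
rewrite /brace_coproduct !truncateE //; try by rewrite /=; lia.
case: i ni => p q /= npq; rewrite !(linear_funZ _ (linear_tmap _ _)) /=.
rewrite -[cup_component p q x](signK (p * q)) -scalerBr cup_component_swap //.
rewrite scalerDr scalerBr scalerBr !scalerA -!exprD addrA; congr (_ + _ + _).
- by apply: sign_eq; rewrite !(oddD, oddM, oddS) /=; case: odd; case: odd.
- by apply: sign_eq; rewrite !(oddD, oddM, oddS) /=; case: odd; case: odd.
- rewrite [RHS](@sign_neq _ _ _ (p * q + q.+1)) //.
  by rewrite !(oddD, oddM, oddS) /=; case: odd; case: odd.
Qed.

Lemma gtwist_cup0 (x : C 0) :
  gtwist (cup x) - cup x = tensor_bdry (brace_coproduct x : gtensor CC CC 1).
Proof.
apply: degree_part_eq => -[[|//] [|//]] _; rewrite degree_partB gtwistE // !cupE //.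
rewrite (tensor_bdryE (A := CC) (B := CC)) // /brace_coproduct !truncateE //=.
rewrite expr0 !scale1r cup_component_swap0 /brace_component.
rewrite [X in _ = _ + tmap _ _ (_ *: X)]big_geq //.
by rewrite scaler0 linear0 addr0.
Qed.

Lemma brace_coproduct_linear n : linear (@brace_coproduct n).
Proof.
apply: truncate_linear => i a x y.
by rewrite (@brace_component_linear k C) scalerDr !scalerA mulrC.
Qed.

Lemma gtwist_cup_homologous n (z : cycles CC n) :
  exists c, gtwist (cup (chain_of z)) - cup (chain_of z) = bdry (tensor_complex CC CC) n c.
Proof.
case: n z => [|n] z; first by eexists; exact: gtwist_cup0.
eexists; rewrite gtwist_cup.
have -> : coop_bdry (chain_of z) = 0 by exact: (bdry_chain_of z).
by rewrite (linear_fun0 (@brace_coproduct_linear n)) addr0.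
Qed.

Lemma cup_counitl n (x : C n) : counit_l (coune C) (cup x) = x.
Proof. by rewrite /counit_l cupE // cup_component_counitl. Qed.

Lemma cup_counitr n (x : C n) : counit_r (coune C) (cup x) = x.
Proof. by rewrite /counit_r cupE ?addn0 // cup_component_counitr. Qed.

End Cup.

(** * The Kuenneth theorem over a field *)

Section VectorSpaces.
Variables (k : comPzRingType) (k_field : is_field k).

Definition subspace (V : lmodType k) (S : set V) : Prop :=
  S 0 /\ forall a x y, S x -> S y -> S (a *: x + y).

Lemma subspaceB (V : lmodType k) (S : set V) x y : subspace S -> S x -> S y -> S (x - y).
Proof. by move=> [_ SP] Sx Sy; rewrite addrC -scaleN1r; apply: SP. Qed.

(** Zorn's lemma gives a maximal T meeting N trivially; a vector x outside N + T could still be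
    added to it, because over a field a relation y = a x + s with a nonzero would solve for x. *)
Lemma subspace_complement (V : lmodType k) (N : set V) : subspace N ->
  exists T : set V, [/\ subspace T, forall x, N x -> T x -> x = 0 &
    forall x, exists y z, [/\ N y, T z & x = y + z]].
Proof.
move=> subN; have [N0 NP] := subN.
pose Q (T : set V) := (forall a x y, T x -> T y -> T (a *: x + y)) /\
  (forall x, N x -> T x -> x = 0).
have [T [[TP NT] Tmax]] : exists T, Q T /\ forall B, (T `<` B)%classic -> ~ Q B.
  apply: Zorn_bigcup => F FQ Ftot; split=> [a x y [X FX Xx] [Y FY Yy]|x Nx [X FX Xx]].
    have [XY|YX] := Ftot _ _ FX FY.
      by exists Y => //; apply: (FQ _ FY).1 => //; exact: XY.
    by exists X => //; apply: (FQ _ FX).1 => //; exact: YX.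
  exact: (FQ _ FX).2 Xx.
(* [Q] admits the empty set, the union of the empty chain. By maximality [T] contains 0: otherwise
   [T] would be empty and [[set 0]] would be larger. *)
have T0 : T 0.
  apply: contrapT => T0; apply: (Tmax [set 0]%classic); split.
  - move=> x Tx; case: T0; rewrite -[0](subrr x) addrC -scaleN1r; exact: TP.
  - by move=> /(_ 0 erefl).
  - by move=> a x y -> ->; rewrite scaler0 addr0.
  - by move=> x _ ->.
exists T; split; [by split | exact: NT |].
move=> x; apply: contrapT => x_out.
pose B : set V := fun t => exists a s, T s /\ t = a *: x + s.
apply: (Tmax B); split.
- by move=> t Tt; exists 0, t; rewrite scale0r add0r.
- move=> BT; apply: x_out; exists 0, x; rewrite add0r; split=> //.
  by apply: BT; exists 1, 0; rewrite scale1r addr0.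
- move=> a _ _ [b [s [Ts ->]]] [c [t [Tt ->]]]; exists (a * b + c), (a *: s + t).
  by split; [exact: TP | rewrite scalerDr scalerDl scalerA addrACA].
- move=> y Ny [a [s [Ts yE]]]; have [a0|/eqP a0] := eqVneq a 0.
    by apply: NT => //; rewrite yE a0 scale0r add0r.
  have [b ab] := k_field.2 a a0; case: x_out; exists (b *: y), (- (b *: s)); split.
  + by rewrite -[_ *: _]addr0; exact: NP.
  + by rewrite -scaleNr -[_ *: _]addr0; exact: TP.
  + by rewrite yE scalerDr scalerA [b * a]mulrC ab scale1r addrK.
Qed.

(** With S a complement of the kernel and T one of the image, [g v] is the unique u in S with v -
    f(u) in T; uniqueness makes g linear. *)
Lemma pseudo_inverse (U V : lmodType k) (f : {linear U -> V}) :
  exists g : {linear V -> U}, forall u, f (g (f u)) = f u.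
Proof.
have [|T [subT imT imTsum]] := @subspace_complement V (fun v => exists u, f u = v).
  split=> [|a _ _ [u <-] [u' <-]]; first by exists 0; rewrite linear0.
  by exists (a *: u + u'); rewrite linearP.
have [|S [subS kerS kerSsum]] := @subspace_complement U (fun u => f u = 0).
  split=> [|a x y fx fy]; first by rewrite linear0.
  by rewrite linearP fx fy scaler0 addr0.
have ex_g v : exists u, S u /\ T (v - f u).
  have [_ [t [[u0 <-] Tt ->]]] := imTsum v; have [n [u [fn Su ->]]] := kerSsum u0.
  by exists u; split=> //; rewrite linearD fn add0r addrC addKr.
have uniq_g v u u' : S u -> T (v - f u) -> S u' -> T (v - f u') -> u = u'.
  move=> Su Tu Su' Tu'; apply/eqP; rewrite -subr_eq0; apply/eqP.
  apply: kerS; last exact: subspaceB.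
  apply: imT; first by exists (u - u').
  by have := subspaceB subT Tu' Tu; rewrite opprB addrC subrKA linearB.
have [g gP] := exists_family ex_g.
have gL : linear g.
  move=> a x y; apply: (uniq_g (a *: x + y)); try exact: (gP _).1; try exact: (gP _).2.
    by apply: subS.2; exact: (gP _).1.
  by rewrite linearP opprD addrACA -scalerBr; apply: subT.2; exact: (gP _).2.
exists (mk_linear gL) => u /=; apply/esym/eqP; rewrite -subr_eq0; apply/eqP.
apply: imT; last exact: (gP _).2.
by exists (u - g (f u)); rewrite linearB.
Qed.

End VectorSpaces.

(* Over a field a complex retracts by deformation onto a complex with zero *)
(* differential: with d g d = d, the map P = 1 - d g - g d satisfies       *)
(* d P = P d = 0.                                                          *)
Section Retraction.
Variables (k : comPzRingType) (k_field : is_field k) (A : precomplex k).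
Hypothesis bdry_bdry : forall n (x : A n.+2), bdry A n (bdry A n.+1 x) = 0.

Definition bdry_then (g : forall n, {linear A n -> A n.+1}) n : A n -> A n :=
  match n with 0 => fun=> 0 | m.+1 => fun x => g m (bdry A m x) end.

Lemma bdry_then_linear g n : linear (@bdry_then g n).
Proof. by case: n => [|n] a x y; rewrite /= ?scaler0 ?addr0 // !linearP. Qed.

Lemma homotopy_retraction : exists (g : forall n, {linear A n -> A n.+1})
    (P : forall n, {linear A n -> cycles A n}),
  (forall n (x : A n.+1), P n (bdry A n x) = 0) /\
  (forall n (x : A n), x - chain_of (P n x) = bdry A n (g n x) + bdry_then g x).
Proof.
have [g gP] := exists_family (fun n => pseudo_inverse k_field (bdry A n)).
pose P n (x : A n) := x - bdry A n (g n x) - bdry_then g x.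
have PL n : linear (@P n).
  move=> a x y; rewrite /P !linearP bdry_then_linear !scalerBr.
  by rewrite !opprD !addrA /= !scalerN [LHS](ACl (1*3*5*2*4*6)%AC).
have Pcycle n x : is_cycle (@P n x).
  case: n x => // n x; rewrite /= /P /= !linearB /= bdry_bdry gP subr0.
  by rewrite subrr.
pose Z n (x : A n) := Cycle (Pcycle n x).
have ZL n : linear (@Z n).
  move=> a x y; apply: val_inj.
  change (P n (a *: x + y) = chain_of (a *: Z n x + Z n y)).
  by rewrite PL (@chain_of_linear k A n).
exists g, (fun n => mk_linear (ZL n)); split=> n x /=.
- apply: val_inj; change (P n (bdry A n x) = chain_of (0 : cycles A n)).
  rewrite linear0 /P gP subrr; case: n x => [|n] x /=; first by rewrite subr0.
  by rewrite bdry_bdry linear0 subr0.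
- by rewrite /P -addrA -opprD subKr.
Qed.

(** The class map extends from cycles to all chains, still killing boundaries. *)
Lemma homology_projection : exists p : forall n, {linear A n -> homology A n},
  (forall n x, p n (bdry A n x) = 0) /\ (forall n z, p n (chain_of z) = hclass z).
Proof.
have [g [P [Pd PE]]] := homotopy_retraction.
exists (fun n => @hclass k A n \o P n); split=> [n x|n z] /=.
  by rewrite Pd linear0.
apply/esym/hclassP; exists (g n (chain_of z)).
by rewrite PE; case: n z => [|n] z /=; rewrite ?bdry_chain_of ?linear0 addr0.
Qed.

End Retraction.

Section KunnethField.
Variables (k : comPzRingType) (k_field : is_field k) (A B C : precomplex k).
Hypothesis A2 : forall n (x : A n.+2), bdry A n (bdry A n.+1 x) = 0.
Hypothesis B2 : forall n (x : B n.+2), bdry B n (bdry B n.+1 x) = 0.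
Hypothesis C2 : forall n (x : C n.+2), bdry C n (bdry C n.+1 x) = 0.

(** The tensor product of the projections p and q kills every boundary of the tensor complex and
    returns the element of H(A) (x) H(B) from a lift to cycles, so a lift that bounds represents
    0. *)
Lemma kunneth2_inj K n : kunneth_map2 A B K -> injective (K n).
Proof.
move=> KP; suff K0 t : K n t = 0 -> t = 0.
  by move=> s t st; apply/eqP; rewrite -subr_eq0; apply/eqP/K0; rewrite linearB st subrr.
have [x <-] := gmap2_surj (hclass_surj (D := A)) (hclass_surj (D := B)) t.
rewrite (kunneth2_eq (w := Cycle (gmap2_cycle x))) // => /hclass_eq0[c /= xc].
have [p [pd pz]] := homology_projection k_field A2.
have [q [qd qz]] := homology_projection k_field B2.
have <- : gmap2 p q (gmap2 (@chain_of k A) (@chain_of k B) x) =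
    gmap2 (@hclass k A) (@hclass k B) x.
  by apply: gmap2_comp => m u; rewrite (pz, qz).
rewrite xc; apply: degree_part_eq => i ni; rewrite degree_part0 gmap2E // tensor_bdryE //.
rewrite linearD linearZ /= !tmap_comp.
by rewrite tmap_eq0l ?tmap_eq0r ?scaler0 ?addr0 // => u /=; rewrite (pd, qd).
Qed.

Lemma kunneth3_inj K n : kunneth_map3 A B C K -> injective (K n).
Proof.
move=> KP; suff K0 t : K n t = 0 -> t = 0.
  by move=> s t st; apply/eqP; rewrite -subr_eq0; apply/eqP/K0; rewrite linearB st subrr.
have [x <-] := gmap3_surj (hclass_surj (D := A)) (hclass_surj (D := B)) (hclass_surj (D := C)) t.
rewrite (kunneth3_eq (w := Cycle (gmap3_cycle x))) // => /hclass_eq0[c /= xc].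
have [p [pd pz]] := homology_projection k_field A2.
have [q [qd qz]] := homology_projection k_field B2.
have [r [rd rz]] := homology_projection k_field C2.
have <- : gmap3 p q r (gmap3 (@chain_of k A) (@chain_of k B) (@chain_of k C) x) =
    gmap3 (@hclass k A) (@hclass k B) (@hclass k C) x.
  apply: degree_part_eq => i ni; rewrite !gmap3E // tmap_comp.
  apply: eq_tmap => u /=; last exact: rz.
  by rewrite tmap_comp; apply: eq_tmap => v /=; rewrite (pz, qz).
rewrite xc; apply: degree_part_eq => i ni; rewrite degree_part0 gmap3E // tensor3_bdryE //.
rewrite !linearD !linearZ /= !tmap_comp.
rewrite [X in X + _ + _]tmap_eq0l => [|u]; last first.
  by rewrite /= tmap_comp tmap_eq0l // => v /=; rewrite pd.
rewrite [X in _ + _ *: X + _]tmap_eq0l => [|u]; last first.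
  by rewrite /= tmap_comp tmap_eq0r // => v /=; rewrite qd.
by rewrite tmap_eq0r ?scaler0 ?addr0 // => u /=; rewrite rd.
Qed.

(** A cycle c is homologous to (P (x) P')c, which is built from tensors of cycles. This follows from
    1 - P (x) P' = (1 - P) (x) 1 + P (x) (1 - P') and the two homotopies; the bounding chain is (g
    (x) 1)c plus the signed (P (x) g')c, here [G1] and [G2]. *)
Lemma kunneth2_surj K n : kunneth_map2 A B K -> forall h, exists t, K n t = h.
Proof.
move=> KP h; have [w <-] := hclass_surj h.
have [g [P [Pd PE]]] := homotopy_retraction k_field A2.
have [g' [P' [Pd' PE']]] := homotopy_retraction k_field B2.
pose c : gtensor A B n := chain_of w.
pose x := gmap2 P P' c; exists (gmap2 (@hclass k A) (@hclass k B) x).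
rewrite (kunneth2_eq (w := Cycle (gmap2_cycle x))) //; apply/esym/hclassP.
have c_cycle i j : (i + j)%N.+1 = n ->
    tmap (bdry A i) idfun (c (i.+1, j)) = - ((-1) ^+ i *: tmap idfun (bdry B j) (c (i, j.+1))).
  rewrite /c; case: n w {c x h KP} => // m w [ijm]; apply/eqP; rewrite -addr_eq0; apply/eqP.
  have w0 : tensor_bdry (chain_of w : gtensor A B m.+1) = 0.
    exact: (bdry_chain_of (D := tensor_complex A B) w).
  have := congr1 (fun y : gtensor A B m => y (i, j)) w0.
  by rewrite degree_part0 tensor_bdryE.
pose pi i : {linear A i -> A i} := @chain_of k A i \o P i.
pose G1 i j : A i ⊗ B j :=
  match i with 0 => 0 | i'.+1 => tmap (g i') idfun (c (i', j)) end.
pose G2 i j : A i ⊗ B j :=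
  match j with 0 => 0 | j'.+1 => (-1) ^+ i *: tmap (pi i) (g' j') (c (i, j')) end.
exists (truncate (fun i => G1 i.1 i.2 + G2 i.1 i.2) : gtensor A B n.+1).
apply: degree_part_eq => -[i j] nij; rewrite degree_partB.
rewrite [bdry _ _ _]/(tensor_bdry _) [chain_of (Cycle _)]/(gmap2 _ _ _).
rewrite !gmap2E // tmap_comp -/c.
rewrite tensor_bdryE // !truncateE; try by move: nij => /=; lia.
rewrite /=; move: nij => /= nij.
rewrite !(linear_funD (linear_tmap _ _)) /= [tmap _ idfun (G2 _ _)](_ : _ = 0); last first.
  rewrite /G2; case: (j) => [|j']; first by rewrite linear0.
  rewrite linearZ /= tmap_comp tmap_eq0l ?scaler0 // => u; exact: bdry_chain_of.
rewrite addr0 scalerDr (linear_funZ _ (linear_tmap _ _)) /= signK !tmap_comp.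
rewrite [_ *: tmap _ _ (G1 _ _)](_ : _ =
  tmap (mk_linear (bdry_then_linear g (n := i))) idfun (c (i, j))); last first.
  rewrite /G1; case: i nij => [|i] nij.
    by rewrite linear0 scaler0 tmap_eq0l.
  rewrite tmap_comp /=.
  have := congr1 (tmap (g i) idfun) (c_cycle i j nij).
  rewrite linearN linearZ /= !tmap_comp exprS mulN1r scaleNr => E.
  transitivity (tmap (g i \o bdry A i) (idfun \o idfun) (c (i.+1, j))).
    by rewrite E; congr (- (_ *: _)); apply: eq_tmap.
  exact: eq_tmap.
(* The cycle relation trades the differential on the right for one on the left, which P kills. *)
have pi0 : tmap (pi i) (mk_linear (bdry_then_linear g' (n := j))) (c (i, j)) = 0.
  case: j nij => [|j] nij; first by rewrite tmap_eq0r.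
  have := congr1 (tmap (pi i) (g' j)) (c_cycle i j _); rewrite -addnS => /(_ nij).
  rewrite tmap_comp tmap_eq0l => [|u]; last by rewrite /pi /= Pd linear0.
  rewrite linearN linearZ /= tmap_comp => /esym/eqP; rewrite oppr_eq0 => /eqP E.
  transitivity (tmap (pi i \o idfun) (g' j \o bdry B j) (c (i, j.+1))).
    exact: eq_tmap.
  by rewrite -[LHS](signK i) E scaler0.
(* With this zero inserted the equation holds for every tensor, not only for components of a cycle,
   and may be checked on elementary ones. *)
rewrite -[LHS]addr0 -[in LHS]oppr0 -{1}pi0.
move: (c (i, j)) => t; rewrite {c x c_cycle G1 G2 pi0}.
have tl (f : {linear A i -> A i}) (f' : {linear B j -> B j}) : linear (tmap f f').
  exact: linearP.
apply: (tensor_ext (linear_sub (linear_sub (@linear_id _ (A i ⊗ B j))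
    (tl (@chain_of k A i \o P i) (@chain_of k B j \o P' j)))
    (tl (pi i) (mk_linear (bdry_then_linear g' (n := j)))))
  (linear_add (tl (bdry A i \o g i) (idfun \o idfun))
    (linear_add (tl (mk_linear (bdry_then_linear g (n := i))) idfun)
      (tl (idfun \o pi i) (bdry B j \o g' j))))) t => u v.
rewrite /= !tmap_tens /=; set pu := chain_of (P i u); set qv := chain_of (P' j v).
rewrite addrA -(linear_funD ((tens_bilinear _ _).1 _)) -PE -/pu.
rewrite (linear_funB ((tens_bilinear _ _).1 _)) -[RHS]addrA -[LHS]addrA.
congr (_ + _); rewrite -opprD -(linear_funD ((tens_bilinear _ _).2 _)).
rewrite [RHS]addrC -(linear_funB ((tens_bilinear _ _).2 _)).
rewrite -(linear_funN ((tens_bilinear _ _).2 _)); congr tens.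
rewrite -[bdry _ _ _](addrK (bdry_then g' v)) -PE' -/qv opprD.
by rewrite [RHS](ACl ((2*3)*(1*4))%AC) /= subrr addr0.
Qed.

End KunnethField.

(** * The coalgebra structure on homology *)

Section HomologyCoproduct.
Variables (k : comPzRingType) (A : precomplex k).
Let H := homology A.
Let AA := tensor_complex A A.
Let AAA := tensor3_complex A A A.
Variable D : forall n, {linear A n -> gtensor A A n}.
Variable DH : forall n, {linear H n -> homology AA n}.
Hypothesis DHP : induced A AA D DH.
Variables (K2 : forall n, {linear gtensor H H n -> homology AA n}).
Variables (K3 : forall n, {linear gtensor3 H H H n -> homology AAA n}).
Hypothesis K2P : kunneth_map2 A A K2.
Hypothesis K3P : kunneth_map3 A A A K3.
Variable Dh : forall n, {linear H n -> gtensor H H n}.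
Hypothesis K2Dh : forall n h, K2 n (Dh n h) = DH n h.

Let hcl n : {linear cycles A n -> H n} := @hclass k A n.
Let chn n : {linear cycles A n -> A n} := @chain_of k A n.

(** [K2] sends Dh[a] to the class of D(a), so any lift y of Dh[a] to tensors of cycles differs from
    D(a) by the boundary of some c. *)
Lemma coproduct_lift (a : forall i, cycles A i) :
  exists (y : forall m, gtensor (cycles A) (cycles A) m) (c : forall m, gtensor A A m.+1),
  forall m, gmap2 hcl hcl (y m) = Dh m (hclass (a m)) /\
    gmap2 chn chn (y m) - D m (chain_of (a m)) = tensor_bdry (c m).
Proof.
have ex_yc m : exists yc : gtensor (cycles A) (cycles A) m * gtensor A A m.+1,
    gmap2 hcl hcl yc.1 = Dh m (hclass (a m)) /\
    gmap2 chn chn yc.1 - D m (chain_of (a m)) = tensor_bdry yc.2.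
  have [y yE] := gmap2_surj (hclass_surj (D := A)) (hclass_surj (D := A)) (Dh m (hclass (a m))).
  have [w wE DHw] := DHP (a m).
  have : hclass (Cycle (gmap2_cycle y)) = hclass w :> homology AA m.
    by rewrite -DHw -K2Dh -yE (kunneth2_eq (w := Cycle (gmap2_cycle y)) K2P).
  by move=> /hclassP[c cE]; exists (y, c); split=> //=; rewrite -wE.
have [yc ycP] := exists_family ex_yc.
by exists (fun m => (yc m).1), (fun m => (yc m).2).
Qed.

(** It suffices to take t = [a] (x) [b]. In the notation of [coproduct_lift], the two sides are
    represented by y (x) b and D(a) (x) b, which differ by the boundary of c (x) b. *)
Lemma kunneth_coprod_l (lH : forall n, {linear homology AA n -> homology AAA n}) n t :
  induced AA AAA (coprod_l D) lH ->
  K3 n (coprod_l Dh t) = lH n (K2 n t).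
Proof.
move=> lHP; have [y <-] := gmap2_surj (hclass_surj (D := A)) (hclass_surj (D := A)) t.
have hL := @gmap2_linear k _ _ _ _ hcl hcl n.
suff E : (fun y => K3 n (coprod_l Dh (gmap2 hcl hcl y))) =1
    (fun y => lH n (K2 n (gmap2 hcl hcl y))) by exact: (E y).
apply: gtensor_ext => [||a b].
- by move=> d u v; rewrite hL (@coprod_l_linear k H Dh n) linearP.
- by move=> d u v; rewrite hL !linearP.
move=> {y}.
have [y [c ycP]] := coproduct_lift a.
pose y3 : gtensor3 (cycles A) (cycles A) (cycles A) n :=
  truncate (fun i => tens (y (i.1.1 + i.1.2)%N (i.1.1, i.1.2)) (b i.2)).
have -> : coprod_l Dh (gmap2 hcl hcl (pure2 n a b)) = gmap3 hcl hcl hcl y3.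
  apply: degree_part_eq => i ni; rewrite coprod_lE // gmap3E //.
  rewrite gmap2_pure /pure2 /y3 !truncateE // !tmap_tens /=; congr tens.
  by rewrite /proj -(ycP _).1 gmap2E.
rewrite (kunneth3_eq (w := Cycle (gmap3_cycle y3))) //.
rewrite (kunneth2_eq (w := Cycle (gmap2_cycle (pure2 n a b)))) //.
have [w /= wE ->] := lHP n (Cycle (gmap2_cycle (pure2 n a b))).
apply/hclassP; rewrite wE.
(* [c m] has total degree m + 1, so bidegree (p, q) takes its value from [c] at p + q - 1; hence
   [shift]. *)
exists (truncate (fun i => tens (shift c (i.1.1 + i.1.2)%N (i.1.1, i.1.2)) (chain_of (b i.2)))
  : gtensor3 A A A n.+1).
apply: degree_part_eq => -[[p q] r] npqr; rewrite degree_partB.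
rewrite [bdry _ _ _]/(tensor3_bdry _) [chain_of (Cycle _)]/(gmap3 _ _ _ _).
rewrite coprod_lE // gmap3E // gmap2_pure tensor3_bdryE // /pure2 /y3.
rewrite !truncateE //; try by move: npqr => /=; lia.
rewrite !tmap_tens /= bdry_chain_of tens0r scaler0 addr0 addnS /=.
have cE := congr1 (fun y : gtensor A A (p + q) => y (p, q)) (ycP (p + q)%N).2.
rewrite degree_partB gmap2E // tensor_bdryE //= in cE.
rewrite -(linear_funZ _ ((tens_bilinear _ _).1 _)) -(linear_funD ((tens_bilinear _ _).1 _)).
by rewrite -cE -(linear_funB ((tens_bilinear _ _).1 _)).
Qed.

Lemma kunneth_coprod_r (rH : forall n, {linear homology AA n -> homology AAA n}) n t :
  induced AA AAA (coprod_r D) rH ->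
  K3 n (coprod_r Dh t) = rH n (K2 n t).
Proof.
move=> rHP; have [y <-] := gmap2_surj (hclass_surj (D := A)) (hclass_surj (D := A)) t.
have hL := @gmap2_linear k _ _ _ _ hcl hcl n.
suff E : (fun y => K3 n (coprod_r Dh (gmap2 hcl hcl y))) =1
    (fun y => rH n (K2 n (gmap2 hcl hcl y))) by exact: (E y).
apply: gtensor_ext => [||a b].
- by move=> d u v; rewrite hL (@coprod_r_linear k H Dh n) linearP.
- by move=> d u v; rewrite hL !linearP.
move=> {y}.
have [y [c ycP]] := coproduct_lift b.
pose y3 : gtensor3 (cycles A) (cycles A) (cycles A) n :=
  truncate (fun i => tassoc (tens (a i.1.1) (y (i.1.2 + i.2)%N (i.1.2, i.2)))).
have -> : coprod_r Dh (gmap2 hcl hcl (pure2 n a b)) = gmap3 hcl hcl hcl y3.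
  apply: degree_part_eq => i ni; rewrite coprod_rE // gmap3E //.
  rewrite gmap2_pure /pure2 /y3 !truncateE ?addnA // tmap_tassoc !tmap_tens /=.
  by congr (tassoc (tens _ _)); rewrite /proj -(ycP _).1 gmap2E.
rewrite (kunneth3_eq (w := Cycle (gmap3_cycle y3))) //.
rewrite (kunneth2_eq (w := Cycle (gmap2_cycle (pure2 n a b)))) //.
have [w /= wE ->] := rHP n (Cycle (gmap2_cycle (pure2 n a b))).
apply/hclassP; rewrite wE.
(* The chain is a (x) c; the sign offsets the one acquired when the differential passes a. *)
exists (truncate (fun i => (-1) ^+ i.1.1 *:
  tassoc (tens (chain_of (a i.1.1)) (shift c (i.1.2 + i.2)%N (i.1.2, i.2))))
  : gtensor3 A A A n.+1).
apply: degree_part_eq => -[[p q] r] npqr; rewrite degree_partB.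
rewrite [bdry _ _ _]/(tensor3_bdry _) [chain_of (Cycle _)]/(gmap3 _ _ _ _).
rewrite coprod_rE // gmap3E // gmap2_pure tensor3_bdryE // /pure2 /y3.
rewrite !truncateE //; try by move: npqr => /=; lia.
rewrite !(linear_funZ _ (linear_tmap _ _)) exprD -scalerA /=.
rewrite [(-1) ^+ p *: ((-1) ^+ q *: _)]scalerA mulrC -scalerA !signK.
have id_tassoc (s : A p ⊗ (A q ⊗ A r.+1)) : tmap idfun (bdry A r) (tassoc s) =
    tassoc (tmap idfun (tmap idfun (bdry A r)) s).
  by rewrite -tmap_tassoc; apply: eq_tmap => // u; rewrite /= tmap_id.
rewrite id_tassoc !tmap_tassoc !tmap_tens /= bdry_chain_of tens0l.
rewrite (linear_fun0 (@tassoc_linear _ _ _ _)) scaler0 add0r addnS /=.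
have cE := congr1 (fun y : gtensor A A (q + r) => y (q, r)) (ycP (q + r)%N).2.
rewrite degree_partB gmap2E // tensor_bdryE //= in cE.
rewrite -(linear_funZ _ (@tassoc_linear _ _ _ _)) -(linear_funD (@tassoc_linear _ _ _ _)).
rewrite -(linear_funZ _ ((tens_bilinear _ _).2 _)) -(linear_funD ((tens_bilinear _ _).2 _)).
rewrite -cE -(linear_funB (@tassoc_linear _ _ _ _)).
by rewrite -(linear_funB ((tens_bilinear _ _).2 _)).
Qed.

Lemma kunneth_twist (tauH : forall n, {linear homology AA n -> homology AA n}) n t :
  induced AA AA (@gtwist k A A) tauH -> K2 n (gtwist t) = tauH n (K2 n t).
Proof.
move=> tauP; have [y <-] := gmap2_surj (hclass_surj (D := A)) (hclass_surj (D := A)) t.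
rewrite gtwist_gmap2 (kunneth2_eq (w := Cycle (gmap2_cycle (gtwist y)))) //.
rewrite (kunneth2_eq (w := Cycle (gmap2_cycle y))) //; apply/esym/(induced_eq tauP).
by rewrite /= gtwist_gmap2.
Qed.

Variables (e : {linear A 0%N -> k^o}) (eH : {linear H 0%N -> k^o}).
Hypothesis eHP : forall z : cycles A 0, eH (hclass z) = e (chain_of z).

Lemma kunneth_counit_l (lH : forall n, {linear homology AA n -> H n}) n t :
  induced AA A (counit_l e) lH -> counit_l eH t = lH n (K2 n t).
Proof.
move=> lHP; have [y <-] := gmap2_surj (hclass_surj (D := A)) (hclass_surj (D := A)) t.
rewrite (kunneth2_eq (w := Cycle (gmap2_cycle y))) //.
(* Contracting the lift itself gives an element of [cycles A n], so no separate proof that it is a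
   cycle is required. *)
pose z : cycles A n := evall (e \o chn 0) (y (0%N, n)).
have -> : counit_l eH (gmap2 hcl hcl y) = hclass z.
  by rewrite /counit_l gmap2E // (evall_tmapE (f' := e \o chn 0)) // => u; rewrite /= eHP.
apply/esym/(induced_eq lHP).
change (chain_of z = evall e (gmap2 chn chn y (0%N, n))); rewrite gmap2E //.
by rewrite (evall_tmapE (f' := e \o chn 0)).
Qed.

Lemma kunneth_counit_r (rH : forall n, {linear homology AA n -> H n}) n t :
  induced AA A (counit_r e) rH -> counit_r eH t = rH n (K2 n t).
Proof.
move=> rHP; have [y <-] := gmap2_surj (hclass_surj (D := A)) (hclass_surj (D := A)) t.
rewrite (kunneth2_eq (w := Cycle (gmap2_cycle y))) //.
pose z : cycles A n := evalr (e \o chn 0) (y (n, 0%N)).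
have -> : counit_r eH (gmap2 hcl hcl y) = hclass z.
  by rewrite /counit_r gmap2E ?addn0 // (evalr_tmapE (f' := e \o chn 0)) // => u; rewrite /= eHP.
apply/esym/(induced_eq rHP).
change (chain_of z = evalr e (gmap2 chn chn y (n, 0%N))); rewrite gmap2E ?addn0 //.
by rewrite (evalr_tmapE (f' := e \o chn 0)).
Qed.

End HomologyCoproduct.

Theorem corollary4p5 (k : comPzRingType) (C : mcooperad k) :
  let CC := coop_complex C in
  let CC2 := tensor_complex CC CC in
  let CC3 := tensor3_complex CC CC CC in
  let H := homology CC in
  (forall n (x : C n.+2), coop_bdry (coop_bdry x) = 0) /\
  exists (cupH : forall n, {linear H n -> homology CC2 n})
         (eH : {linear H 0%N -> k^o}),
  [/\ induced CC CC2 (@cup k C) cupH,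
      forall z : cycles CC 0, eH (hclass z) = coune C (chain_of z),
      exists2 tauH : forall n, {linear homology CC2 n -> homology CC2 n},
        induced CC2 CC2 (@gtwist k C C) tauH &
        forall n (h : H n), tauH n (cupH n h) = cupH n h,
      (exists lH rH : forall n, {linear homology CC2 n -> homology CC3 n},
        [/\ induced CC2 CC3 (coprod_l (@cup k C)) lH,
            induced CC2 CC3 (coprod_r (@cup k C)) rH &
            forall n (h : H n), lH n (cupH n h) = rH n (cupH n h)]) /\
      (exists lH rH : forall n, {linear homology CC2 n -> H n},
        [/\ induced CC2 CC (counit_l (coune C)) lH,
            induced CC2 CC (counit_r (coune C)) rH &
            forall n (h : H n), lH n (cupH n h) = h /\ rH n (cupH n h) = h])
    & exists (K2 : forall n, {linear gtensor H H n -> homology CC2 n})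
             (K3 : forall n, {linear gtensor3 H H H n -> homology CC3 n}),
      [/\ kunneth_map2 CC CC K2, kunneth_map3 CC CC CC K3 &
          is_field k \/ (forall n, bijective (K2 n)) /\
                        (forall n, injective (K3 n)) ->
          exists D : forall n, {linear H n -> gtensor H H n},
          [/\ forall n (h : H n), K2 n (D n h) = cupH n h,
              forall n (h : H n) (t : gtensor H H n),
                K2 n t = cupH n h -> t = D n h &
              graded_cocommutative_coalgebra D eH]]].
Proof.
move=> CC CC2 CC3 H; split; first exact: coop_bdry_bdry.
have bdry2 n (x : CC n.+2) : bdry CC n (bdry CC n.+1 x) = 0 by exact: coop_bdry_bdry.
have [cupH cupP] := @induced_exists k CC CC2 (@cup k C) (@cup_linear k C) (@cup_bdry k C).
have [tauH tauP] := @induced_exists k CC2 CC2 (@gtwist k C C) (@gtwist_linear k C C)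
  (@gtwist_bdry k CC CC).
have [lH [rH [lP rP]]] := @coprod_induced k CC (@cup k C) (@cup_bdry k C).
have [lE [rE [lEP rEP]]] := @counit_induced k CC (coune C) (@coune_bdry k C).
have [|z c zc|eH eP] := @factor_homology k CC 0 k^o (fun z => coune C (chain_of z)).
- by move=> a x y; rewrite (@chain_of_linear k CC 0) linearP.
- by rewrite zc coune_bdry.
(* Only cocommutativity goes through a homotopy; coassociativity and the counit laws below hold
   strictly on chains. *)
have tau_cup n (h : H n) : tauH n (cupH n h) = cupH n h.
  have [z <-] := hclass_surj h; have [w wE ->] := cupP n z.
  have [w' w'E ->] := tauP n w; apply/hclassP; rewrite w'E wE.
  exact: gtwist_cup_homologous.
have coassoc n (h : H n) : lH n (cupH n h) = rH n (cupH n h).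
  have [z <-] := hclass_surj h; have [w wE ->] := cupP n z.
  have [w' w'E ->] := rP n w; apply: (induced_eq lP); rewrite w'E wE.
  exact/esym/cup_coassoc.
have lE_cup n (h : H n) : lE n (cupH n h) = h.
  have [z <-] := hclass_surj h; have [w wE ->] := cupP n z.
  by apply: (induced_eq lEP); rewrite wE cup_counitl.
have rE_cup n (h : H n) : rE n (cupH n h) = h.
  have [z <-] := hclass_surj h; have [w wE ->] := cupP n z.
  by apply: (induced_eq rEP); rewrite wE cup_counitr.
exists cupH, eH; split=> //; first by exists tauH.
  by split; [exists lH, rH | exists lE, rE].
have [K2 K2P] := kunneth2_exists CC CC; have [K3 K3P] := kunneth3_exists CC CC CC.
exists K2, K3; split=> // k_field_or_bij.
have K2_inj n : injective (K2 n).
  case: k_field_or_bij => [kF|[K2bij _]]; last exact: bij_inj (K2bij n).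
  exact: (kunneth2_inj kF bdry2 bdry2).
have K3_inj n : injective (K3 n).
  case: k_field_or_bij => [kF|[_ //]].
  exact: (kunneth3_inj kF bdry2 bdry2 bdry2).
have K2_surj n h : exists t, K2 n t = h.
  case: k_field_or_bij => [kF|[K2bij _]]; first exact: (kunneth2_surj kF bdry2 bdry2).
  by have [K2' _ K2K] := K2bij n; exists (K2' h).
(* The coproduct on H is the preimage of [cupH] under [K2]; injectivity of [K2] makes it linear and
   unique. *)
have [D DE] := exists_family (fun n => exists_family (fun h => K2_surj n (cupH n h))).
have DL n : linear (D n).
  by move=> a x y; apply: K2_inj; rewrite linearP !DE linearP.
pose DD n : {linear H n -> gtensor H H n} := mk_linear (DL n).
have DDE n h : K2 n (DD n h) = cupH n h by exact: DE.
exists DD; split=> // [n h t tE|]; first by apply: K2_inj; rewrite tE DDE.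
split=> n h.
(* Coassociativity is tested after [K3], where both sides become the maps [lH] and [rH] applied to
   [cupH n h]. *)
- apply: K3_inj; rewrite (kunneth_coprod_l cupP K2P K3P DDE _ lP).
  by rewrite (kunneth_coprod_r cupP K2P K3P DDE _ rP) DDE coassoc.
- by rewrite (kunneth_counit_l K2P eP _ lEP) DDE lE_cup.
- by rewrite (kunneth_counit_r K2P eP _ rEP) DDE rE_cup.
- by apply: K2_inj; rewrite (kunneth_twist K2P _ tauP) DDE tau_cup.
Qed.
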